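(* There is an absolute constant $c>0$ such that the following holds. Let $n\ge2$ be even and $\lambda_{\max}>0$. For $1\le l\le n$ let $$\hat A^{(l)}\in\operatorname{argmin}_{A\in\mathcal S_l,\,A\ge 0}\left(\|R_{n/2}^{(l)}-A-\sigma^2I^{(l)}\|_2^2+\mu_l\|A\|_1\right),\qquad\mu_l=c(\lambda_{\max}+\sigma^2)\,\delta_{n/2}(l,l),$$ be computed from the first half-sample, and let $\hat A^{(\hat l)}$ be the aggregated estimator with $$\hat l\in\operatorname{argmin}_{1\le l\le n}\left\{\|\hat A^{(l)}\|_2^2-2\langle\hat A^{(l)},\tilde R_n^{(l)}-\sigma^2I^{(l)}\rangle\right\}.$$ (i) For any integer $r\ge1$, $c_*>0$ and $s>0$ such that $1\le r\le n^{1+2s}$, $$\sup_{K\in\mathcal K_r(s,c_*;\lambda_{\max})}\mathbb E\|\hat A^{(\hat l)}-K\|_2^2\le C\min\left(r\,n^{-\frac{2s}{2s+1}},\ r^{\frac1{s+1}}n^{-\frac s{s+1}}\right),$$ where $C>0$ is a constant that can depend only on $\lambda_{\max},\sigma^2,c_*$ and $s$. (ii) For any integer $r\ge1$ and any $\rho\ge1$, $s>0$, $\lambda_{\max}>0$, $\sigma^2\ge0$ such that $\rho^2\le(\lambda_{\max}+\sigma^2)^2\min\left(r\,n^{2s},\,n^{1+2s}\right)$, $$\sup_{K\in\overline{\mathcal K}_r(s,\rho;\lambda_{\max})}\mathbb E\|\hat A^{(\hat l)}-K\|_2^2\le C\min\left(\left(\frac rn\right)^{2s/(2s+1)},\ n^{-s/(s+1)}\right),$$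 where $C>0$ is a constant that can depend only on $\lambda_{\max},\sigma^2,\rho$ and $s$. (iii) If $r,l\ge1$ are integers with $(r\wedge l)\,l\ge\log n$ and $l\le n$, then for any $\lambda_{\max}>0$, $$\sup_{K\in\mathcal K_{r,l}(\lambda_{\max})}\mathbb E\left[\|\hat A^{(\hat l)}-K\|_2^2\right]\le C\,\frac{(r\wedge l)\,l}{n},$$ where $C>0$ is a constant that can depend only on $\lambda_{\max}$ and $\sigma^2$.
   Context: Model: $X_1,\dots,X_n$ are i.i.d. copies of $X(t)$, $t\in[0,1]$, satisfying $dX(t)=S(t)\,dt+\sigma\,dW(t)$, where $W$ is standard Brownian motion, $\sigma$ is a known noise level ($\sigma>0$; in (ii) $\sigma^2\ge0$), and $S(t)=\sum_{k}\sqrt{\lambda_k}\,\xi_k\varphi_k(t)$ with $\xi_k$ i.i.d. standard Gaussian variables independent of $W$, $\{\varphi_k\}$ orthonormal in $L_2[0,1]$, $\lambda_k>0$, $\sum_k\lambda_k<\infty$. The covariance function of $S$ is $K(t,u)=\sum_{k}\lambda_k\varphi_k(t)\varphi_k(u)$; the expectation is taken under the law of the data for the given $K$. Fix an orthonormal basis $e_1,e_2,\dots$ of $L_2[0,1]$. For $l\ge1$, set $\dot X_i^{(l)}=\sum_{k=1}^l\left(\int_0^1e_k(t)\,dX_i(t)\right)e_k$ and $I^{(l)}(t,u)=\sum_{k=1}^le_k(t)e_k(u)$. The sample is split into halves: $R_{n/2}^{(l)}(t,u)=\frac2n\sum_{i=1}^{n/2}\dot X_i^{(l)}(t)\dot X_i^{(l)}(u)$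 is computed from $X_1,\dots,X_{n/2}$, and $\tilde R_n^{(l)}(t,u)=\frac2n\sum_{i=n/2+1}^n\dot X_i^{(l)}(t)\dot X_i^{(l)}(u)$ from $X_{n/2+1},\dots,X_n$. $\mathcal S_l=\{\sum_{j,k=1}^ls_{jk}\,e_j\otimes e_k:\ s_{jk}=s_{kj}\}$, where $(e_j\otimes e_k)(t,u)=e_j(t)e_k(u)$. An element $A\in\mathcal S_l$ is identified with the symmetric $l\times l$ matrix of its coefficients; $A\ge0$ means this matrix is non-negative definite and $\|A\|_1$ is its nuclear norm. $\|\cdot\|_2$ and $\langle\cdot,\cdot\rangle$ are the norm and inner product of $L_2([0,1]^2)$; $\|K\|_\infty$ is the operator (spectral) norm of the integral operator with kernel $K$. $\delta_n(l,t)=\max\left\{\sqrt{\frac{l+t}{n}},\frac{l+t}{n}\right\}$. Norms: $\|\varphi\|_{s,2}=\left(\sum_{k\ge1}k^{2s}\langle\varphi,e_k\rangle^2\right)^{1/2}$ for $\varphi\in L_2[0,1]$; $\|K\|_{s,2}=\left(\sum_{k,k'\ge1}k^{2s}\langle Ke_k,e_{k'}\rangle^2\right)^{1/2}$ for symmetric kernels $K$. Classes: $\mathcal K_r(s,c_*;\lambda_{\max})$ is the class of all kernels $K=\sum_j\lambda_j\varphi_j\otimes\varphi_j$ with at most $r$ terms ($\lambda_j>0$, $\varphi_j$ orthonormal) such that $\|\varphi_j\|_{s,2}\le c_*$ for every $j$ and $\|K\|_\infty<\lambda_{\max}$. $\overline{\mathcal K}_r(s,\rho;\lambda_{\max})$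 is the class of all covariance functions $K$ of finite rank $r$ with $\|K\|_\infty\le\lambda_{\max}$ and $\|K\|_{s,2}\le\rho$. $\mathcal K_{r,l}(\lambda_{\max})$ is the class of all covariance functions $K=\sum_j\lambda_j\varphi_j\otimes\varphi_j$ with at most $r$ terms such that $K\in\mathcal S_l$ and $\|K\|_\infty\le\lambda_{\max}$. *)

(* Defs.v *)
From HB Require Import structures.
From mathcomp Require Export all_boot all_order all_algebra.
From mathcomp Require Export all_classical all_reals all_analysis.
From mathcomp Require Import polyrcf.

Set Implicit Arguments.
Unset Strict Implicit.
Unset Printing Implicit Defensive.

Import Order.TTheory GRing.Theory Num.Theory.
Import numFieldNormedType.Exports.

Local Open Scope classical_set_scope.
Local Open Scope ring_scope.

(* Elements of L_2[0,1] and L_2([0,1]^2) are represented by functions on the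
   whole line (plane), of which only the restriction to [0,1] (to the unit
   square) matters. *)

Section L2.
Context {R : realType}.
Implicit Types (f g : R -> R) (F G : R * R -> R).

Definition unitI : set R := [set` `[0, 1]].
Definition unitSq : set (R * R) := unitI `*` unitI.

Definition leb1 := @lebesgue_measure R.
Definition leb2 := (leb1 \x leb1)%E.

Definition isL2 f : Prop :=
  measurable_fun unitI f /\ leb1.-integrable unitI (fun t => (f t ^+ 2)%:E).

Definition ip f g : R := \int[leb1]_(t in unitI) (f t * g t).
Definition norm2 f : R := Num.sqrt (ip f f).

Definition isL2sq F : Prop :=
  measurable_fun unitSq F /\ leb2.-integrable unitSq (fun z => (F z ^+ 2)%:E).

Definition ipsq F G : R := \int[leb2]_(z in unitSq) (F z * G z).
Definition normsq2 F : R := Num.sqrt (ipsq F F).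

Definition eqsq F G : Prop := {ae leb2, forall z, unitSq z -> F z = G z}.

Definition orthonormal (I : eqType) (phi : I -> R -> R) : Prop :=
  (forall j, isL2 (phi j)) /\ (forall j k, ip (phi j) (phi k) = (j == k)%:R).

(* Indices are shifted: [e k] is the basis element usually written e_{k+1}. *)
Definition orthonormal_basis (e : nat -> R -> R) : Prop :=
  orthonormal e /\
  forall f, isL2 f ->
    norm2 (fun t => f t - \sum_(k < N) ip f (e k) * e k t) @[N --> \oo] --> 0.

Definition tensor f g : R * R -> R := fun z => f z.1 * g z.2.

Definition integral_op F f : R -> R :=
  fun t => \int[leb1]_(u in unitI) (F (t, u) * f u).

Definition opnorm F : \bar R :=
  ereal_sup [set (norm2 (integral_op F f))%:E | f in
               [set f | isL2 f /\ norm2 f <= 1]].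

(* Both norms may be infinite.  The weight is (k+1)^{2s} because of the shift
   in the indexing of the basis. *)
Definition snorm (e : nat -> R -> R) (s : R) f : \bar R :=
  ((\sum_(0 <= k <oo) ((k.+1%:R `^ (2 * s)) * ip f (e k) ^+ 2)%:E)
     `^ (2^-1))%E.

Definition snormsq (e : nat -> R -> R) (s : R) F : \bar R :=
  ((\sum_(0 <= k <oo) \sum_(0 <= k' <oo)
      ((k.+1%:R `^ (2 * s)) * ip (integral_op F (e k)) (e k') ^+ 2)%:E)
     `^ (2^-1))%E.

End L2.

Section Kernels.
Context {R : realType}.
Variable e : nat -> R -> R.
Implicit Type K : R * R -> R.

Definition symmetric_mx l (A : 'M[R]_l) : Prop := A^T = A.

Definition psd_mx l (A : 'M[R]_l) : Prop :=
  forall v : 'rV[R]_l, 0 <= (v *m A *m v^T) 0 0.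

(* Sum of the singular values, i.e. of the square roots of the eigenvalues of
   A^T A, each distinct one being counted with its multiplicity as a root of
   the characteristic polynomial. *)
Definition nuclear_norm l (A : 'M[R]_l) : R :=
  let p := char_poly (A^T *m A) in
  \sum_(x <- rootsR p) (mup x p)%:R * Num.sqrt x.

Definition ker_of_mx l (A : 'M[R]_l) : R * R -> R :=
  fun z => \sum_(j < l) \sum_(k < l) A j k * tensor (e j) (e k) z.

Definition in_S l K : Prop :=
  exists2 A : 'M[R]_l, symmetric_mx A & eqsq K (ker_of_mx A).

Definition spectral_rep m (lam : 'I_m -> R) (phi : 'I_m -> R -> R) K : Prop :=
  [/\ isL2sq K, (forall j, 0 < lam j), orthonormal phi
    & eqsq K (fun z => \sum_(j < m) lam j * tensor (phi j) (phi j) z)].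

Definition class_eigen (r : nat) (s cstar lmax : R) K : Prop :=
  (exists m, exists lam : 'I_m -> R, exists phi : 'I_m -> R -> R,
    [/\ (m <= r)%N, spectral_rep lam phi K
      & forall j, (snorm e s (phi j) <= cstar%:E)%E])
  /\ (opnorm K < lmax%:E)%E.

Definition class_sobolev (r : nat) (s rho lmax : R) K : Prop :=
  [/\ (exists lam : 'I_r -> R, exists phi : 'I_r -> R -> R,
         spectral_rep lam phi K),
      (opnorm K <= lmax%:E)%E & (snormsq e s K <= rho%:E)%E].

Definition class_fin (r l : nat) (lmax : R) K : Prop :=
  [/\ (exists m, exists lam : 'I_m -> R, exists phi : 'I_m -> R -> R,
         (m <= r)%N /\ spectral_rep lam phi K),
      in_S l K & (opnorm K <= lmax%:E)%E].

End Kernels.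

Section Model.
Context {R : realType} {d : measure_display} {T : measurableType d}.
Variable P : probability T R.

Definition sigma_gen (I : Type) (D : set I) (X : I -> T -> R) : set (set T) :=
  <<s [set A | exists i, exists2 B : set R,
        D i /\ measurable B & A = (X i @^-1` B)] >>.

Definition mutually_independent (J : eqType) (G : J -> set (set T)) : Prop :=
  forall (s : seq J) (E : J -> set T), uniq s ->
    (forall j, j \in s -> G j (E j)) ->
    P [set w | forall j, j \in s -> E j w] = (\prod_(j <- s) P (E j))%E.

(* [normal_prob] takes the standard deviation, not the variance. *)
Definition gaussian (m sd : R) (Z : T -> R) : Prop :=
  measurable_fun setT Z /\
  forall B : set R, measurable B -> P (Z @^-1` B) = normal_prob m sd B.

Definition brownian (W : R -> T -> R) : Prop :=
  [/\ (forall t, 0 <= t <= 1 -> measurable_fun setT (W t)),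
      {ae P, forall w, W 0 w = 0},
      (forall a b, 0 <= a -> a < b -> b <= 1 ->
         gaussian 0 (Num.sqrt (b - a)) (fun w => W b w - W a w)),
      (forall (N : nat) (t : nat -> R), 0 <= t 0%N ->
         (forall j, (j < N)%N -> t j <= t j.+1) -> t N <= 1 ->
         mutually_independent (fun j : 'I_N =>
           sigma_gen setT (fun (_ : unit) w => W (t j.+1) w - W (t j) w)))
    & {ae P, forall w, {within unitI, continuous (fun t => W t w)}}].

Record step_fun := StepFun {
  steps : nat;
  knot : nat -> R;
  height : nat -> R
}.

Definition step_valid (g : step_fun) : Prop :=
  [/\ 0 <= knot g 0%N,
      (forall j, (j < steps g)%N -> knot g j <= knot g j.+1)
    & knot g (steps g) <= 1].

Definition step_val (g : step_fun) (x : R) : R :=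
  \sum_(j < steps g) height g j * \1_(`]knot g j, knot g j.+1]) x.

Definition step_integral (g : step_fun) (X : R -> T -> R) (w : T) : R :=
  \sum_(j < steps g) height g j * (X (knot g j.+1) w - X (knot g j) w).

(* [stoch_integral X f Y]: Y is a version of int_0^1 f(t) dX(t) for a
   deterministic f in L_2[0,1], defined as usual as the mean-square limit of
   integrals of step functions converging to f. *)
Definition stoch_integral (X : R -> T -> R) (f : R -> R) (Y : T -> R) : Prop :=
  measurable_fun setT Y /\
  exists g : nat -> step_fun,
    [/\ (forall N, step_valid (g N)),
        norm2 (fun t => f t - step_val (g N) t) @[N --> \oo] --> 0
      & ('E_P[(fun w => (Y w - step_integral (g N) X w) ^+ 2)%R])%E
          @[N --> \oo] --> 0%E].

Definition signal m (lam : 'I_m -> R) (phi : 'I_m -> R -> R)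
    (xi : 'I_m -> T -> R) (t : R) (w : T) : R :=
  \sum_(j < m) Num.sqrt (lam j) * xi j w * phi j t.

(* X_1, ..., X_n are independent copies of the solution of
   dX(t) = S(t) dt + sigma dW(t), the i-th copy being driven by (W i, xi i).
   A finite sum in S suffices: the kernels of the three classes above have
   finite rank, hence finitely many (positive) eigenvalues. *)
Definition white_noise_sample (K : R * R -> R) (sigma : R) n
    (X : 'I_n -> R -> T -> R) : Prop :=
  exists (m : nat) (lam : 'I_m -> R) (phi : 'I_m -> R -> R)
         (W : 'I_n -> R -> T -> R) (xi : 'I_n -> 'I_m -> T -> R),
    [/\ spectral_rep lam phi K,
        (forall i, brownian (W i)),
        (forall i j, gaussian 0 1 (xi i j)),
        mutually_independent (fun a : ('I_n * 'I_m) + 'I_n =>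
          match a with
          | inl (i, j) => sigma_gen setT (fun _ : unit => xi i j)
          | inr i => sigma_gen unitI (W i)
          end)
      & (forall i t, 0 <= t <= 1 -> measurable_fun setT (X i t)) /\
        (forall i, {ae P, forall w, forall t, 0 <= t <= 1 ->
           X i t w = X i 0 w
                     + \int[leb1]_(u in [set` `[0, t]])
                          signal lam phi (xi i) u w
                     + sigma * W i t w})].

End Model.

Section Estimator.
Context {R : realType}.
Variables (e : nat -> R -> R) (n : nat).

(* [y i k] stands for int_0^1 e_{k+1}(t) dX_i(t). *)
Implicit Type y : 'I_n -> nat -> R.

Definition xdot l y i : R -> R := fun t => \sum_(k < l) y i k * e k t.

Definition Iker l : R * R -> R := fun z => \sum_(k < l) tensor (e k) (e k) z.

Definition Rhalf l y : R * R -> R := fun z =>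
  2 / n%:R * \sum_(i < n | (i < n./2)%N) tensor (xdot l y i) (xdot l y i) z.

Definition Rtilde l y : R * R -> R := fun z =>
  2 / n%:R * \sum_(i < n | (n./2 <= i)%N) tensor (xdot l y i) (xdot l y i) z.

Definition delta (N l : nat) (t : R) : R :=
  Num.max (Num.sqrt ((l%:R + t) / N%:R)) ((l%:R + t) / N%:R).

Definition mu_pen (c lmax sigma : R) l : R :=
  c * (lmax + sigma ^+ 2) * delta n./2 l l%:R.

Definition nuclear_objective (sigma mu : R) l y (A : 'M[R]_l) : R :=
  normsq2 (fun z => Rhalf l y z - ker_of_mx e A z - sigma ^+ 2 * Iker l z) ^+ 2
  + mu * nuclear_norm A.

Definition nuclear_argmin (sigma mu : R) l y (A : 'M[R]_l) : Prop :=
  [/\ symmetric_mx A, psd_mx A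
    & forall B : 'M[R]_l, symmetric_mx B -> psd_mx B ->
        nuclear_objective sigma mu y A <= nuclear_objective sigma mu y B].

Definition aggregation_objective (sigma : R) y
    (A : forall l, 'M[R]_l) (l : nat) : R :=
  normsq2 (ker_of_mx e (A l)) ^+ 2
  - 2 * ipsq (ker_of_mx e (A l))
             (fun z => Rtilde l y z - sigma ^+ 2 * Iker l z).

Definition aggregation_argmin (sigma : R) y (A : forall l, 'M[R]_l)
    (lhat : nat) : Prop :=
  (1 <= lhat <= n)%N /\
  forall l, (1 <= l <= n)%N ->
    aggregation_objective sigma y A lhat <= aggregation_objective sigma y A l.

End Estimator.

Section Experiment.
Context {R : realType} {d : measure_display} {T : measurableType d}.
Variable P : probability T R.

(* On (T, P), the data X_1, ..., X_n follow the model with covariance K, and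
   (Ahat, lhat) is a measurable choice of the successive minimizers.  The
   matrix [Ahat l w] is only meaningful for 1 <= l <= n. *)
Definition aggregated_estimator (c lmax sigma : R) (n : nat)
    (e : nat -> R -> R) (K : R * R -> R)
    (Ahat : forall l, T -> 'M[R]_l) (lhat : T -> nat) : Prop :=
  exists (X : 'I_n -> R -> T -> R) (Y : 'I_n -> nat -> T -> R),
    [/\ white_noise_sample P K sigma X,
        (forall i k, stoch_integral P (X i) (e k) (Y i k)),
        (forall l, (1 <= l <= n)%N ->
           (forall j k, measurable_fun setT (fun w => Ahat l w j k)) /\
           (forall w, nuclear_argmin e sigma (mu_pen n c lmax sigma l)
                        (fun i k => Y i k w) (Ahat l w))),
        measurable_fun setT lhat
      & forall w, aggregation_argmin e sigma (fun i k => Y i k w)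
                    (fun l => Ahat l w) (lhat w)].

Definition risk (e : nat -> R -> R) (K : R * R -> R)
    (Ahat : forall l, T -> 'M[R]_l) (lhat : T -> nat) : \bar R :=
  ('E_P[(fun w =>
    normsq2 (fun z => ker_of_mx e (Ahat (lhat w) w) z - K z) ^+ 2)%R])%E.

End Experiment.

(* [uniform_risk_bound c lmax sigma n e Kc b]: the supremum over K in the
   class Kc of the risk of the aggregated estimator is at most b. *)
Definition uniform_risk_bound (R : realType) (c lmax sigma : R) (n : nat)
    (e : nat -> R -> R) (Kc : (R * R -> R) -> Prop) (b : R) : Prop :=
  forall K, Kc K ->
  forall (d : measure_display) (T : measurableType d) (P : probability T R)
    (Ahat : forall l, T -> 'M[R]_l) (lhat : T -> nat),
    aggregated_estimator P c lmax sigma n e K Ahat lhat ->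
    (risk P e K Ahat lhat <= b%:E)%E.

(* Main.v *)
From HB Require Import structures.
Require Import Defs.
From mathcomp Require Import all_boot all_order all_algebra.
From mathcomp Require Import all_classical all_reals all_analysis.
From mathcomp Require Import spectral complex polyrcf.
From mathcomp Require Import measurable_realfun charge ring lra.

Set Implicit Arguments.
Unset Strict Implicit.
Unset Printing Implicit Defensive.

Import Order.TTheory GRing.Theory Num.Theory.
Import numFieldNormedType.Exports.

Local Open Scope classical_set_scope.
Local Open Scope ring_scope.

(** The kernels spanned by the tensors of the first [l] basis functions are
identified with their matrices of coefficients, and the squared [L_2] loss of the
kernel of an [l x l] matrix [A] splits as
[|A - K_l|^2 + bias l], in Frobenius norm, where [K_l] is the matrix of the
compression of [K] to the first [l] basis functions ([loss_split]).  The
regularity of [K] makes the bias decrease with [l] ([bias_tail], [snorm_tail],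
[snormsq_tail]); it vanishes when [K] is itself such a kernel.

For a positive semidefinite matrix the nuclear norm is the trace, so the
penalised estimator minimises [|G - A|^2 + mu tr A] over a convex cone, with [G]
the empirical covariance of the first half-sample minus [sigma^2 I].  Write
[G = K_l + N].  If the quadratic form of the noise [N] is at most [mu / 2] on the
unit ball, the squared error is at most [4 mu^2] times the rank of [K_l]
([prox_error_fast]); in all cases it is at most of the order of [|N|^2] plus that
quantity ([prox_error_crude]).  The estimator is moreover a Lipschitz function of
[G] ([prox_lipschitz]).

Everything random is deduced from one exponential inequality ([noise_exp]): if
the symmetric matrix [D], [|D| <= 1], is a continuous function of the
observations of one half-sample and [N] is the noise of the other half, then
[E exp (theta <D, N>) <= exp (40 (theta S)^2 / n)] for [|theta| <= n / (32 S)],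
where [S = lmax + sigma^2].  For finitely many independent Gaussian coordinates
this follows by integrating out one coordinate at a time, the exponent remaining
a quadratic form ([chaos]).  The observations are mean-square limits of stochastic
integrals of step functions; on a grid containing their knots the latter are
linear in the amplitudes of the signal and in the increments of the Brownian
motion, which are independent and Gaussian ([white_integral_gauss_sample]).
Fatou's lemma along an almost surely convergent subsequence gives the inequality
for the observations ([gauss_limit_exp]).

With a constant [D], it controls the noise on a finite net of the unit ball, so
that the risk of the estimator at level [l] is of the order of
[S^2 min(r, l) l / n] ([first_half_risk]).  With [D] the normalised difference of
the estimators at two levels, which only depends on the first half-sample, it
shows that the selection costs [S^2 (1 + ln n) / n] ([oracle_risk]); the
extension of a Lipschitz function to all matrices makes [D] a continuous function
of the data.  The three bounds come from choosing the level [l]: given in the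
third, and in the others balancing the bias [l^(-2s)] against [r l / n], or
against [l^2 / n]; the logarithmic term is smaller than these rates. *)

(** * The Frobenius inner product and positive semidefinite matrices *)

Section Frobenius.
Context {R : rcfType}.

Definition fdot m n (A B : 'M[R]_(m, n)) : R := \tr (A *m B^T).

Lemma scale_trmx m n a (A : 'M[R]_(m, n)) : (a *: A)^T = a *: A^T.
Proof. by apply/matrixP => i j; rewrite !mxE. Qed.

Lemma fdotE m n (A B : 'M[R]_(m, n)) :
  fdot A B = \sum_i \sum_j A i j * B i j.
Proof.
rewrite /fdot /mxtrace; apply: eq_bigr => i _; rewrite mxE.
by apply: eq_bigr => j _; rewrite mxE.
Qed.

Lemma fdotC m n (A B : 'M[R]_(m, n)) : fdot A B = fdot B A.
Proof. by rewrite !fdotE; do 2!(apply: eq_bigr => ? _); rewrite mulrC. Qed.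

Lemma fdotDl m n (A B C : 'M[R]_(m, n)) : fdot (A + B) C = fdot A C + fdot B C.
Proof. by rewrite /fdot mulmxDl mxtraceD. Qed.

Lemma fdotNl m n (A C : 'M[R]_(m, n)) : fdot (- A) C = - fdot A C.
Proof. by rewrite /fdot mulNmx raddfN. Qed.

Lemma fdotBl m n (A B C : 'M[R]_(m, n)) : fdot (A - B) C = fdot A C - fdot B C.
Proof. by rewrite fdotDl fdotNl. Qed.

Lemma fdotZl m n a (A C : 'M[R]_(m, n)) : fdot (a *: A) C = a * fdot A C.
Proof. by rewrite /fdot -scalemxAl mxtraceZ. Qed.

Lemma fdotDr m n (A B C : 'M[R]_(m, n)) : fdot C (A + B) = fdot C A + fdot C B.
Proof. by rewrite !(fdotC C) fdotDl. Qed.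

Lemma fdotNr m n (A C : 'M[R]_(m, n)) : fdot C (- A) = - fdot C A.
Proof. by rewrite !(fdotC C) fdotNl. Qed.

Lemma fdotBr m n (A B C : 'M[R]_(m, n)) : fdot C (A - B) = fdot C A - fdot C B.
Proof. by rewrite !(fdotC C) fdotBl. Qed.

Lemma fdotZr m n a (A C : 'M[R]_(m, n)) : fdot C (a *: A) = a * fdot C A.
Proof. by rewrite !(fdotC C) fdotZl. Qed.

Lemma fdot0l m n (A : 'M[R]_(m, n)) : fdot 0 A = 0.
Proof. by rewrite /fdot mul0mx raddf0. Qed.


Lemma fdot_mull m n p (X : 'M[R]_(m, n)) (A : 'M[R]_(n, p)) B :
  fdot (X *m A) B = fdot A (X^T *m B).
Proof. by rewrite /fdot trmx_mul trmxK mulmxA [RHS]mxtrace_mulC mulmxA. Qed.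

Lemma fdot_mulr m n p (A : 'M[R]_(m, n)) (X : 'M[R]_(n, p)) B :
  fdot (A *m X) B = fdot A (B *m X^T).
Proof. by rewrite /fdot trmx_mul trmxK mulmxA. Qed.

Lemma fdot_tr m n (A B : 'M[R]_(m, n)) : fdot A^T B^T = fdot A B.
Proof. by rewrite /fdot trmxK mxtrace_mulC -mxtrace_tr trmx_mul trmxK. Qed.

Definition fnorm2 m n (A : 'M[R]_(m, n)) : R := fdot A A.

Lemma fnorm2E m n (A : 'M[R]_(m, n)) : fnorm2 A = \sum_i \sum_j A i j ^+ 2.
Proof. by rewrite /fnorm2 fdotE; do 2!(apply: eq_bigr => ? _); rewrite expr2. Qed.

Lemma fnorm2_ge0 m n (A : 'M[R]_(m, n)) : 0 <= fnorm2 A.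
Proof. by rewrite fnorm2E; do 2!(apply: sumr_ge0 => ? _); rewrite sqr_ge0. Qed.

Lemma fnorm2Z m n a (A : 'M[R]_(m, n)) : fnorm2 (a *: A) = a ^+ 2 * fnorm2 A.
Proof. by rewrite /fnorm2 fdotZl fdotZr mulrA expr2. Qed.

Lemma fnorm2D m n (A B : 'M[R]_(m, n)) :
  fnorm2 (A + B) = fnorm2 A + 2 * fdot A B + fnorm2 B.
Proof. by rewrite /fnorm2 fdotDl !fdotDr (fdotC B A); ring. Qed.

Lemma fnorm2B m n (A B : 'M[R]_(m, n)) :
  fnorm2 (A - B) = fnorm2 A - 2 * fdot A B + fnorm2 B.
Proof. by rewrite /fnorm2 fdotBl !fdotBr (fdotC B A); ring. Qed.

Lemma fnorm2_entry m n (A : 'M[R]_(m, n)) i j : A i j ^+ 2 <= fnorm2 A.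
Proof.
rewrite fnorm2E (bigD1 i)//= (bigD1 j)//= -addrA lerDl addr_ge0//.
  by apply: sumr_ge0 => ? _; rewrite sqr_ge0.
by do 2!(apply: sumr_ge0 => ? _); rewrite sqr_ge0.
Qed.

(** The hypothesis says that a quadratic polynomial in [t] is nonnegative; the
leading coefficient [c] may vanish. *)
Lemma discr_le0 (a b c : R) : 0 <= a -> 0 <= c ->
  (forall t, 0 <= a - 2 * t * b + t ^+ 2 * c) -> b ^+ 2 <= a * c.
Proof.
move=> a0 c0 H; have [ceq0|cn0] := eqVneq c 0; last first.
  have cp : 0 < c by rewrite lt_def cn0.
  have := H (b / c).
  have -> : a - 2 * (b / c) * b + (b / c) ^+ 2 * c = (a * c - b ^+ 2) / c by field.
  by rewrite pmulr_lge0 ?invr_gt0// subr_ge0.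
rewrite ceq0 mulr0; have [->|bn0] := eqVneq b 0; first by rewrite expr0n.
have := H ((a + 1) / (2 * b)); rewrite ceq0 mulr0.
rewrite (_ : 2 * _ * b = a + 1); first by lra.
by field.
Qed.

Lemma fdot_CS m n (A B : 'M[R]_(m, n)) : fdot A B ^+ 2 <= fnorm2 A * fnorm2 B.
Proof.
apply: discr_le0; rewrite ?fnorm2_ge0// => t.
by have := fnorm2_ge0 (A - t *: B); rewrite fnorm2B fdotZr fnorm2Z mulrA.
Qed.

Definition fnorm m n (A : 'M[R]_(m, n)) : R := Num.sqrt (fnorm2 A).

Lemma fnorm_ge0 m n (A : 'M[R]_(m, n)) : 0 <= fnorm A.
Proof. exact: sqrtr_ge0. Qed.

Lemma sqr_fnorm m n (A : 'M[R]_(m, n)) : fnorm A ^+ 2 = fnorm2 A.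
Proof. by rewrite sqr_sqrtr// fnorm2_ge0. Qed.

Lemma ler_fdot m n (A B : 'M[R]_(m, n)) : `|fdot A B| <= fnorm A * fnorm B.
Proof.
rewrite -sqrtr_sqr -sqrtrM ?fnorm2_ge0// ler_wsqrtr//; exact: fdot_CS.
Qed.

(** ** Positive semidefinite matrices *)

Definition bform n (A : 'M[R]_n) (u v : 'rV[R]_n) : R := (u *m A *m v^T) 0 0.
Definition qform n (A : 'M[R]_n) (v : 'rV[R]_n) : R := bform A v v.
Definition psd n (A : 'M[R]_n) : Prop := A^T = A /\ forall v, 0 <= qform A v.

Lemma bform_fdot n (A : 'M[R]_n) u v : bform A u v = fdot A (u^T *m v).
Proof.
rewrite /bform /fdot trmx_mul trmxK mulmxA mxtrace_mulC mulmxA.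
by rewrite /mxtrace big_ord_recl big_ord0 addr0.
Qed.

Lemma qform_fdot n (A : 'M[R]_n) v : qform A v = fdot A (v^T *m v).
Proof. exact: bform_fdot. Qed.

Lemma dotvE n (u v : 'rV[R]_n) : fdot u v = (u *m v^T) 0 0.
Proof. by rewrite /fdot /mxtrace big_ord_recl big_ord0 addr0. Qed.

Lemma fdot_outer m n (a c : 'rV[R]_m) (b d : 'rV[R]_n) :
  fdot (a^T *m b) (c^T *m d) = fdot a c * fdot b d.
Proof.
rewrite fdot_mulr -mulmxA.
rewrite [d *m b^T]mx11_scalar -dotvE fdotC mul_mx_scalar fdotZl.
by rewrite fdot_tr mulrC (fdotC a) (fdotC b).
Qed.

Lemma bformDl n (A : 'M[R]_n) u v w :
  bform A (u + v) w = bform A u w + bform A v w.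
Proof. by rewrite /bform !mulmxDl mxE. Qed.

Lemma bformZl n (A : 'M[R]_n) a u w : bform A (a *: u) w = a * bform A u w.
Proof. by rewrite /bform -!scalemxAl mxE. Qed.

Lemma bformC n (A : 'M[R]_n) u v : A^T = A -> bform A u v = bform A v u.
Proof.
move=> AT; rewrite /bform -[in LHS](trmxK (u *m A *m v^T)) mxE.
by rewrite !trmx_mul trmxK AT mulmxA.
Qed.

Lemma bformDr n (A : 'M[R]_n) u v w : bform A w (u + v) = bform A w u + bform A w v.
Proof. by rewrite /bform raddfD/= mulmxDr mxE. Qed.

Lemma bformZr n (A : 'M[R]_n) a u w : bform A w (a *: u) = a * bform A w u.
Proof. by rewrite /bform linearZ/= -scalemxAr mxE. Qed.

Lemma qformD n (A : 'M[R]_n) u v : A^T = A ->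
  qform A (u + v) = qform A u + 2 * bform A u v + qform A v.
Proof.
by move=> AT; rewrite /qform bformDl !bformDr (bformC v u AT); ring.
Qed.

Lemma qformZ n (A : 'M[R]_n) a u : qform A (a *: u) = a ^+ 2 * qform A u.
Proof. by rewrite /qform bformZl bformZr mulrA expr2. Qed.

Lemma qform1 n (v : 'rV[R]_n) : qform 1%:M v = fnorm2 v.
Proof.
by rewrite /qform /bform mulmx1 /fnorm2 /fdot /mxtrace big_ord_recl big_ord0 addr0.
Qed.

Lemma qform_mx n (A B : 'M[R]_n) v : qform (A + B) v = qform A v + qform B v.
Proof. by rewrite !qform_fdot fdotDl. Qed.

Lemma psd_CS n (A : 'M[R]_n) u v : psd A ->
  bform A u v ^+ 2 <= qform A u * qform A v.
Proof.
move=> [AT A0]; apply: discr_le0 => // t.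
have := A0 (u + (- t) *: v); rewrite qformD// qformZ bformZr sqrrN.
by rewrite mulrA mulrN !mulNr.
Qed.

Lemma qform_delta n (A : 'M[R]_n) i : qform A (delta_mx 0 i) = A i i.
Proof. by rewrite /qform /bform -rowE trmx_delta -colE !mxE. Qed.

Lemma bform_delta n (A : 'M[R]_n) i u : bform A (delta_mx 0 i) u = fdot (row i A) u.
Proof.
by rewrite /bform -rowE /fdot /mxtrace big_ord_recl big_ord0 addr0.
Qed.

Lemma bform_delta2 n (A : 'M[R]_n) i j :
  bform A (delta_mx 0 i) (delta_mx 0 j) = A i j.
Proof. by rewrite /bform -rowE trmx_delta -colE !mxE. Qed.

(** By Cauchy-Schwarz for the form of [A], each entry of the row is bounded by
the diagonal entry. *)
Lemma psd_diag0 n (A : 'M[R]_n) i : psd A -> A i i = 0 -> row i A = 0.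
Proof.
move=> psdA Aii; apply/rowP => j; rewrite !mxE; apply/eqP.
rewrite -sqrf_eq0 eq_le sqr_ge0 andbT.
have := psd_CS (delta_mx 0 i) (delta_mx 0 j) psdA.
by rewrite bform_delta2 !qform_delta Aii mul0r.
Qed.

(** Cholesky elimination: subtracting the rank-one part carried by a nonzero
diagonal entry kills the corresponding row and stays positive semidefinite. *)
Lemma psd_factor n (A : 'M[R]_n) : psd A ->
  exists us : seq 'rV[R]_n, A = \sum_(u <- us) u^T *m u.
Proof.
have [k] := ubnP #|[pred i | A i i != 0]|.
elim: k A => // k IH A; rewrite ltnS => leAk psdA.
have [i Aii|A0] := pickP [pred i | A i i != 0]; last first.
  exists [::]; rewrite big_nil; apply/row_matrixP => i; rewrite row0.
  by apply: psd_diag0 => //; have /= /negbFE/eqP := A0 i.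
have /= {}Aii := Aii.
have [AT A0] := psdA.
have Aipos : 0 < A i i.
  by rewrite lt_def Aii -qform_delta A0.
pose u := (Num.sqrt (A i i))^-1 *: row i A.
have uu : u^T *m u = (A i i)^-1 *: ((row i A)^T *m row i A).
  have -> : u^T = (Num.sqrt (A i i))^-1 *: (row i A)^T.
    by rewrite scale_trmx.
  rewrite /u -scalemxAr -scalemxAl scalerA -invfM -expr2.
  by rewrite sqr_sqrtr// ltW.
pose B := A - u^T *m u.
have BT : B^T = B by rewrite /B linearB/= trmx_mul trmxK AT.
have Bp : psd B.
  split=> // v; rewrite /B qform_mx.
  have -> : qform (- (u^T *m u)) v = - ((A i i)^-1 * bform A (delta_mx 0 i) v ^+ 2).
    rewrite qform_fdot fdotNl uu fdotZl; congr (- (_ * _)).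
    by rewrite fdot_outer bform_delta expr2.
  rewrite subr_ge0 ler_pdivrMl//.
  by rewrite (le_trans (psd_CS _ _ psdA))// qform_delta mulrC.
have [|us Bus] := IH B _ Bp; last first.
  by exists (u :: us); rewrite big_cons -Bus addrC subrK.
have Bdiag j : B j j = A j j - (A i i)^-1 * A i j ^+ 2.
  by rewrite /B mxE mxE uu !mxE big_ord_recl big_ord0 addr0 !mxE expr2.
apply: (leq_trans _ leAk); apply: proper_card; apply/properP; split.
  apply/fintype.subsetP => j; rewrite !inE; apply: contra_neq => Ajj.
  rewrite Bdiag Ajj; have /rowP/(_ i) := psd_diag0 psdA Ajj.
  by rewrite -{1}AT !mxE => ->; rewrite expr0n mulr0 subr0.
exists i; rewrite ?inE//= Bdiag expr2 mulKf// subrr eqxx.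
by [].
Qed.

(** [A] is a sum of matrices [u^T u], and [fdot (u^T u) B] is a value of the form
of [B]. *)
Lemma psd_fdot n (A B : 'M[R]_n) : psd A -> psd B -> 0 <= fdot A B.
Proof.
move=> [_ A0] /psd_factor[us ->]; rewrite fdotC.
elim/big_ind: _ => [|x y x0 y0|u _]; first by rewrite fdot0l.
  by rewrite fdotDl addr_ge0.
by rewrite fdotC -qform_fdot A0.
Qed.

Lemma psdD n (A B : 'M[R]_n) : psd A -> psd B -> psd (A + B).
Proof.
move=> [AT A0] [BT B0]; split=> [|v]; first by rewrite linearD/= AT BT.
by rewrite qform_mx addr_ge0.
Qed.

Lemma psdZ n a (A : 'M[R]_n) : 0 <= a -> psd A -> psd (a *: A).
Proof.
move=> a0 [AT A0]; split=> [|v].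
  by rewrite scale_trmx AT.
by rewrite qform_fdot fdotZl mulr_ge0// -qform_fdot.
Qed.

Lemma psd_outer n (u : 'rV[R]_n) : psd (u^T *m u).
Proof.
split=> [|v]; first by rewrite trmx_mul trmxK.
by rewrite qform_fdot fdot_outer -expr2 sqr_ge0.
Qed.

Lemma psd0 n : psd (0 : 'M[R]_n).
Proof. by split=> [|v]; rewrite ?trmx0// qform_fdot fdot0l. Qed.

Lemma psd1 n : psd (1%:M : 'M[R]_n).
Proof. by split=> [|v]; rewrite ?trmx1// qform1 fnorm2_ge0. Qed.

Lemma psd_conj n m (A : 'M[R]_n) (X : 'M[R]_(m, n)) : psd A -> psd (X *m A *m X^T).
Proof.
move=> [AT A0]; split=> [|v]; first by rewrite !trmx_mul trmxK AT mulmxA.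
have -> : qform (X *m A *m X^T) v = qform A (v *m X); last exact: A0.
by rewrite /qform /bform trmx_mul !mulmxA.
Qed.

(** ** Orthogonal projections *)

Definition proj n (P : 'M[R]_n) : Prop := P^T = P /\ P *m P = P.

Lemma proj_psd n (P : 'M[R]_n) : proj P -> psd P.
Proof. by case=> PT PP; rewrite -PP -[X in X *m _]mulmx1 -{2}PT; exact/psd_conj/psd1. Qed.

Lemma proj1 n : proj (1%:M : 'M[R]_n).
Proof. by split; rewrite ?trmx1 ?mulmx1. Qed.

Lemma projC n (P : 'M[R]_n) : proj P -> proj (1%:M - P).
Proof.
case=> PT PP; split; first by rewrite linearB/= trmx1 PT.
by rewrite mulmxBl mul1mx mulmxBr mulmx1 PP subrr subr0.
Qed.

(** Gram-Schmidt, one vector at a time: the residual of the new vector spans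
the missing direction. *)
Lemma proj_span n (us : seq 'rV[R]_n) : exists P : 'M[R]_n,
  [/\ proj P, \tr P <= (size us)%:R & forall u, u \in us -> u *m P = u].
Proof.
elim: us => [|u us [P [[PT PP] trP Pus]]].
  by exists 0; split=> //; [split; rewrite ?trmx0 ?mulmx0|rewrite mxtrace0].
pose w := u - u *m P.
have wP : w *m P = 0 by rewrite /w mulmxBl -mulmxA PP subrr.
have [w0|wn0] := eqVneq (fnorm2 w) 0.
  exists P; split=> // [|v].
    by rewrite (le_trans trP)// ler_nat.
  rewrite inE => /predU1P[->|/Pus//]; apply/rowP => j.
  have : w 0 j ^+ 2 <= 0 by rewrite -w0 fnorm2_entry.
  rewrite le_eqVlt ltNge sqr_ge0 orbF sqrf_eq0 !mxE subr_eq0 => /eqP ->.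
  by [].
pose Q := (fnorm2 w)^-1 *: (w^T *m w).
have PwT : P *m w^T = 0 by rewrite -[P]PT -trmx_mul wP trmx0.
have QT : Q^T = Q by rewrite /Q scale_trmx trmx_mul trmxK.
have wwT : w *m w^T = (fnorm2 w)%:M by rewrite [LHS]mx11_scalar -dotvE.
have wQ : w *m Q = w.
  by rewrite /Q -scalemxAr mulmxA wwT mul_scalar_mx scalerA mulVf// scale1r.
have PQ : P *m Q = 0 by rewrite /Q -scalemxAr mulmxA PwT mul0mx scaler0.
have QP : Q *m P = 0 by rewrite -[P]PT -QT -trmx_mul PQ trmx0.
have QQ : Q *m Q = Q.
  by rewrite {1}/Q -scalemxAl -mulmxA wQ.
exists (P + Q); split.
- split; first by rewrite linearD/= PT QT.
  by rewrite mulmxDl !mulmxDr PP PQ QP QQ addr0 add0r.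
- rewrite mxtraceD /= -[(size us).+1]addn1 natrD lerD// /Q mxtraceZ mxtrace_mulC wwT.
  by rewrite mxtrace_scalar mulr1n mulVf.
move=> v; rewrite inE mulmxDr => /predU1P[->|vus].
  have -> : u *m Q = w; last by rewrite addrC subrK.
  rewrite -[in LHS](subrK (u *m P) u) mulmxDl -/w wQ.
  by rewrite -mulmxA PQ mulmx0 addr0.
have vP := Pus v vus; rewrite vP -[X in X *m Q]vP -mulmxA PQ mulmx0 addr0.
by [].
Qed.


Lemma fdot1 n (A : 'M[R]_n) : fdot 1%:M A = \tr A.
Proof. by rewrite /fdot mul1mx mxtrace_tr. Qed.

Lemma fnorm2_proj_split n (P : 'M[R]_n) p (X : 'M[R]_(n, p)) : proj P ->
  fnorm2 X = fnorm2 (P *m X) + fnorm2 ((1%:M - P) *m X).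
Proof.
move=> [PT PP]; rewrite mulmxBl mul1mx fnorm2B.
have -> : fdot X (P *m X) = fnorm2 (P *m X).
  by rewrite /fnorm2 fdot_mull PT mulmxA PP fdotC.
by ring.
Qed.

Lemma fnorm2_projl n (P : 'M[R]_n) p (X : 'M[R]_(n, p)) : proj P ->
  fnorm2 (P *m X) <= fnorm2 X.
Proof. by move=> pP; rewrite [leRHS](fnorm2_proj_split _ pP) lerDl fnorm2_ge0. Qed.

Lemma fnorm2_tr m n (A : 'M[R]_(m, n)) : fnorm2 A^T = fnorm2 A.
Proof. exact: fdot_tr. Qed.

(** The form bound transfers to the image by polarising the pair [u],
[q^-1 *: (u *m N)]. *)
Lemma fnorm2_image n (N : 'M[R]_n) q (u : 'rV[R]_n) : N^T = N -> 0 <= q ->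
  (forall v, `|qform N v| <= q * fnorm2 v) ->
  fnorm2 (u *m N) <= q ^+ 2 * fnorm2 u.
Proof.
move=> NT q0 H; set x := fnorm2 (u *m N).
have key s : 4 * s * x <= 2 * q * (fnorm2 u + s ^+ 2 * x).
  have := H (u + s *: (u *m N)); have := H (u + (- s) *: (u *m N)).
  rewrite !qformD// !qformZ !bformZr !fnorm2D !fdotZr !fnorm2Z sqrrN -/x.
  have -> : bform N u (u *m N) = x by rewrite /x /fnorm2 dotvE.
  by rewrite !ler_norml => /andP[h1 h2] /andP[h3 h4]; lra.
have [qe|qn0] := eqVneq q 0.
  have := key 1; rewrite qe expr0n/= !(mulr0, mul0r) mulr1.
  by rewrite pmulr_rle0.
have qp : 0 < q by rewrite lt_def qn0.
have := key q^-1; rewrite -(ler_pM2r qp).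
have -> : 4 * q^-1 * x * q = 4 * x by field.
have -> : 2 * q * (fnorm2 u + q^-1 ^+ 2 * x) * q = 2 * (q ^+ 2 * fnorm2 u) + 2 * x.
  by field.
by move=> h; lra.
Qed.

(** By [fnorm2_image] the matrix [q^2 I - N^2] is positive semidefinite; pair it
with [P]. *)
Lemma fnorm2_proj_image n (N P : 'M[R]_n) q : N^T = N -> 0 <= q -> proj P ->
  (forall v, `|qform N v| <= q * fnorm2 v) ->
  fnorm2 (P *m N) <= q ^+ 2 * \tr P.
Proof.
move=> NT q0 pP H; have [PT PP] := pP.
have psdq : psd (q ^+ 2 *: 1%:M - N *m N).
  split=> [|v].
    by rewrite linearB/= scale_trmx trmx1 trmx_mul NT.
  rewrite qform_fdot fdotBl fdotZl -!qform_fdot qform1 subr_ge0.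
  rewrite (le_trans _ (fnorm2_image v NT q0 H))//.
  by rewrite /fnorm2 dotvE trmx_mul NT /qform /bform !mulmxA.
have := psd_fdot psdq (proj_psd pP).
rewrite fdotBl fdotZl fdot1 subr_ge0; apply: le_trans.
by rewrite /fnorm2 fdot_mull mulmxA PT PP fdotC fdot_mulr NT fdotC.
Qed.

(** * Trace-penalised least squares over the positive semidefinite cone *)

(** Minimising [|G - A|^2 + mu * tr A] over the cone is projecting
[G - (mu/2) I]; [is_prox] is that minimality. *)
Definition is_prox n (mu : R) (G A : 'M[R]_n) : Prop :=
  psd A /\ forall B, psd B ->
    fnorm2 (G - A) + mu * \tr A <= fnorm2 (G - B) + mu * \tr B.

Lemma small_le0 (x y : R) : (forall t, 0 < t -> t <= 1 -> x <= t * y) -> x <= 0.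
Proof.
move=> H; rewrite leNgt; apply/negP => x0.
have y0 : 0 < y by have := H 1 ltr01 (lexx _); rewrite mul1r; apply: lt_le_trans.
have yx : x <= y by have := H 1 ltr01 (lexx _); rewrite mul1r.
have := H (x / y / 2); rewrite !divr_gt0// => /(_ isT).
rewrite -mulrA -invfM ler_pdivrMr ?mulr_gt0// => /(_ ltac:(lra)).
have -> : x / (y * 2) * y = x / 2 by field; rewrite gt_eqF.
by lra.
Qed.

(** First-order condition: moving from [A] toward [B] by a step [t] changes the
objective by [t] times the opposite of twice the left-hand side, up to a term in [t^2]. *)
Lemma prox_variational n mu (G A B : 'M[R]_n) : is_prox mu G A -> psd B ->
  fdot (G - A) (B - A) - mu / 2 * \tr (B - A) <= 0.
Proof.
move=> [psdA minA] psdB; apply: (@small_le0 _ (fnorm2 (B - A) / 2)) => t t0 t1.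
have psdt : psd (A + t *: (B - A)).
  have -> : A + t *: (B - A) = (1 - t) *: A + t *: B.
    by apply/matrixP => i j; rewrite !mxE; ring.
  by apply: psdD; apply: psdZ => //; lra.
have := minA _ psdt; rewrite opprD addrA (fnorm2B (G - A)) fnorm2Z fdotZr.
by rewrite mxtraceD mxtraceZ => h; rewrite -(ler_pM2l t0); lra.
Qed.

(** Adding the variational inequalities at the two minimisers: metric projections
onto a convex set do not increase distances. *)
Lemma prox_lipschitz n mu (G1 G2 A1 A2 : 'M[R]_n) :
  is_prox mu G1 A1 -> is_prox mu G2 A2 -> fnorm (A1 - A2) <= fnorm (G1 - G2).
Proof.
move=> p1 p2; have := prox_variational p1 p2.1.
have := prox_variational p2 p1.1; set D := A1 - A2.
have -> : A2 - A1 = - D by rewrite opprB.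
rewrite raddfN/= fdotNr => h1 h2.
have : fnorm2 D <= fdot (G1 - G2) D.
  have -> : fdot (G1 - G2) D = fdot (G1 - A1) D - fdot (G2 - A2) D + fnorm2 D.
    by rewrite /fnorm2 -fdotBl -fdotDl; congr fdot;
       apply/matrixP => i j; rewrite !mxE; ring.
  by lra.
move=> h; have := le_trans h (le_trans (ler_norm _) (ler_fdot _ _)).
rewrite -sqr_fnorm expr2; have [->|Dn0] := eqVneq (fnorm D) 0.
  by rewrite fnorm_ge0.
by rewrite ler_pM2r// lt_def Dn0 fnorm_ge0.
Qed.

Lemma prox_basic n mu (K N A : 'M[R]_n) : is_prox mu (K + N) A -> psd K ->
  fnorm2 (A - K) <= fdot N (A - K) - mu / 2 * \tr (A - K).
Proof.
move=> p psdK; have := prox_variational p psdK.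
have -> : K + N - A = N - (A - K) by apply/matrixP => i j; rewrite !mxE; ring.
have -> : K - A = - (A - K) by rewrite opprB.
rewrite fdotBl !fdotNr raddfN/= /fnorm2.
by lra.
Qed.

Lemma fnorm2_proj n (P : 'M[R]_n) : proj P -> fnorm2 P = \tr P.
Proof. by move=> [PT PP]; rewrite /fnorm2 /fdot PT PP. Qed.

(** Outside the range of [P] the matrix [K] vanishes and the trace of [A] is
nonnegative; inside, Cauchy-Schwarz against [P]. *)
Lemma mxtrace_support n (K A P : 'M[R]_n) : psd A -> K^T = K -> proj P ->
  K *m P = K -> \tr (K - A) <= fnorm P * fnorm (A - K).
Proof.
move=> psdA KT pP KP; rewrite -fdot1.
have -> : 1%:M = P + (1%:M - P) by rewrite addrC subrK.
rewrite fdotDl (fdotBr _ _ (_ - _)); have := psd_fdot (proj_psd (projC pP)) psdA.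
have -> : fdot (1%:M - P) K = 0.
  rewrite fdotC /fdot linearB/= trmx1 pP.1 mulmxBr mulmx1 KP subrr.
  by rewrite mxtrace0.
rewrite sub0r => h; rewrite (@le_trans _ _ (fdot P (K - A)))//; first by lra.
rewrite (le_trans (ler_norm _))// (le_trans (ler_fdot _ _))//.
by rewrite /fnorm -opprB /fnorm2 fdotNl fdotNr opprK.
Qed.

(** Cauchy-Schwarz on both terms of [prox_basic], whatever the size of the noise
relative to the penalty. *)
Lemma prox_error_crude n mu (K N A P : 'M[R]_n) : 0 <= mu ->
  is_prox mu (K + N) A -> psd K -> proj P -> K *m P = K ->
  fnorm2 (A - K) <= 2 * fnorm2 N + mu ^+ 2 / 2 * \tr P.
Proof.
move=> mu0 p psdK pP KP; have := prox_basic p psdK.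
have := mxtrace_support p.1 psdK.1 pP KP; rewrite -opprB raddfN/=.
have := le_trans (ler_norm _) (ler_fdot N (A - K)).
rewrite -(fnorm2_proj pP) -!sqr_fnorm.
have := fnorm_ge0 (A - K); have := fnorm_ge0 N; have := fnorm_ge0 P.
move: (fnorm _) (fnorm _) (fnorm _) (\tr _) (fdot _ _) => d b a t f.
move=> a0 b0 d0 h1 h2 h3.
have h4 : d ^+ 2 <= d * (b + mu / 2 * a).
  apply: (le_trans h3); rewrite mulrDr (mulrC d b).
  by have := ler_wpM2l (divr_ge0 mu0 (ler0n _ 2)) h2; lra.
have h5 : d <= b + mu / 2 * a.
  have [->|dn0] := eqVneq d 0; first by rewrite addr_ge0// mulr_ge0// divr_ge0.
  by move: h4; rewrite expr2 ler_pM2l// lt_def dn0.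
apply: (@le_trans _ _ ((b + mu / 2 * a) ^+ 2)); first by rewrite ler_sqr// nnegrE// addr_ge0// mulr_ge0// divr_ge0.
have := sqr_ge0 (b - mu / 2 * a); rewrite !expr2; lra.
Qed.

(** When the penalty dominates the noise, [M = (mu/2) I - N] is positive
semidefinite and pairs nonpositively with the part of [K - A] orthogonal to
the support of [K]; the rest of [K - A] only meets [M] through [P]. *)
Lemma prox_error_fast n mu (K N A P : 'M[R]_n) : 0 <= mu -> N^T = N ->
  is_prox mu (K + N) A -> psd K -> proj P -> K *m P = K ->
  (forall v, `|qform N v| <= mu / 2 * fnorm2 v) ->
  fnorm2 (A - K) <= 4 * mu ^+ 2 * \tr P.
Proof.
move=> mu0 NT p psdK pP KP H; have := prox_basic p psdK.
pose M := (mu / 2) *: 1%:M - N; pose D := K - A; pose Q := 1%:M - P.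
have MT : M^T = M by rewrite /M linearB/= scale_trmx trmx1 NT.
have Mv v : qform M v = mu / 2 * fnorm2 v - qform N v.
  by rewrite qform_fdot fdotBl fdotZl -!qform_fdot qform1.
have psdM : psd M.
  by split=> // v; rewrite Mv subr_ge0 (le_trans (ler_norm _)).
have HM v : `|qform M v| <= mu * fnorm2 v.
  rewrite ger0_norm ?psdM.2// Mv.
  by have := H v; rewrite ler_norml => /andP[h _]; lra.
have PM := fnorm2_proj_image MT mu0 pP HM.
have pQ : proj Q := projC pP.
have -> : fdot N (A - K) - mu / 2 * \tr (A - K) = fdot M D.
  rewrite /M /D -(opprB A) fdotNr fdotBl fdotZl fdot1; ring.
(* [D] is split along [P] and [Q]; since [Q *m K = 0], the last block is the
   opposite of a compression of [A]. *)
have -> : fdot M D = fdot M (P *m D) + fdot M (Q *m D *m P) + fdot M (Q *m D *m Q).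
  rewrite -!fdotDr -addrA -mulmxDr; congr fdot.
  rewrite [P + Q]addrC /Q subrK mulmx1 mulmxBl mul1mx.
  by rewrite addrC subrK.
have QK : Q *m K = 0.
  by rewrite /Q mulmxBl mul1mx -{2}psdK.1 -pP.1 -trmx_mul KP psdK.1 subrr.
have h1 : fdot M (Q *m D *m Q) <= 0.
  rewrite /D (mulmxBr Q) QK sub0r mulNmx fdotNr oppr_le0 psd_fdot//.
  by rewrite -{2}pQ.1; apply: psd_conj; exact: p.1.
have h2 : fdot M (P *m D) <= fnorm (P *m M) * fnorm D.
  by rewrite -{1}pP.1 -fdot_mull (le_trans (ler_norm _))// ler_fdot.
have h3 : fdot M (Q *m D *m P) <= fnorm (P *m M) * fnorm D.
  rewrite -{1}pP.1 -fdot_mulr -{1}pQ.1 -fdot_mull (le_trans (ler_norm _))//.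
  rewrite (le_trans (ler_fdot _ _))// ler_wpM2r ?fnorm_ge0//.
  rewrite /fnorm ler_wsqrtr// (le_trans (fnorm2_projl _ pQ))//.
  by rewrite -fnorm2_tr trmx_mul MT pP.1.
have DE : fnorm2 (A - K) = fnorm D ^+ 2.
  by rewrite sqr_fnorm /D -opprB /fnorm2 fdotNl fdotNr opprK.
rewrite DE => h4.
have h5 : fnorm D ^+ 2 <= 2 * fnorm (P *m M) * fnorm D by lra.
have h6 : fnorm D <= 2 * fnorm (P *m M).
  have [->|Dn0] := eqVneq (fnorm D) 0; first by rewrite mulr_ge0 ?fnorm_ge0.
  by move: h5; rewrite expr2 ler_pM2r// lt_def Dn0 fnorm_ge0.
apply: (@le_trans _ _ ((2 * fnorm (P *m M)) ^+ 2)).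
  by rewrite ler_sqr ?nnegrE ?fnorm_ge0// mulr_ge0 ?fnorm_ge0.
rewrite exprMn sqr_fnorm -natrX -mulrA ler_pM2l//.
Qed.
End Frobenius.

(** * Nuclear norm of positive semidefinite matrices *)

Lemma char_poly_conj (F : fieldType) n (P A : 'M[F]_n) : P \in unitmx ->
  char_poly (invmx P *m A *m P) = char_poly A.
Proof.
move=> Pu; rewrite /char_poly.
have -> : char_poly_mx (invmx P *m A *m P) =
  map_mx polyC (invmx P) *m char_poly_mx A *m map_mx polyC P.
  rewrite /char_poly_mx !map_mxM/= mulmxBr mulmxBl; congr (_ - _).
  by rewrite mul_mx_scalar -scalemxAl -map_mxM mulVmx// map_mx1 scalemx1.
rewrite !det_mulmx mulrC mulrA -det_mulmx -map_mxM mulmxV// map_mx1 det1 mul1r.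
by [].
Qed.

Section NuclearNorm.
Context {R : rcfType}.

Lemma fnorm2_rV n (u : 'rV[R]_n) : fnorm2 u = \sum_j u 0 j ^+ 2.
Proof. by rewrite fnorm2E big_ord_recl big_ord0 addr0. Qed.

(** Diagonalise over the complex numbers; the eigenvalues are real by symmetry, so
the factorisations descend to [R]. *)
Lemma char_poly_sym n (A : 'M[R]_n) : A^T = A -> exists x : 'I_n -> R,
  char_poly A = \prod_i ('X - (x i)%:P) /\
  char_poly (A^T *m A) = \prod_i ('X - (x i ^+ 2)%:P).
Proof.
move=> AT; pose toC := real_complex R.
pose AC := map_mx toC A.
have AC_herm : AC \is hermsymmx.
  apply: realsym_hermsym.
    by apply/is_hermitianmxP; rewrite expr0 scale1r map_mx_id// /AC map_trmx AT.
  by apply/mxOverP => i j; rewrite mxE complex_real.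
have /hermitian_normalmx/orthomx_spectralP ACE := AC_herm.
have Pu := spectral_unit AC.
have /mxOverP Dreal := hermitian_spectral_diag_real AC_herm.
move: ACE Pu Dreal; set P := spectralmx AC; set D := spectral_diag AC.
move=> ACE Pu Dreal.
pose x i := complex.Re (D 0 i).
have xE i : D 0 i = toC (x i) by rewrite /toC /x RRe_real.
exists x; split.
  apply: (map_poly_inj toC); rewrite map_char_poly -/AC ACE char_poly_conj//.
  rewrite char_poly_trig ?diag_mx_is_trig// rmorph_prod.
  apply: eq_bigr => i _.
  by rewrite mxE eqxx mulr1n xE rmorphB/= map_polyX map_polyC.
apply: (map_poly_inj toC); rewrite map_char_poly map_mxM AT -/AC ACE.
have -> : invmx P *m diag_mx D *m P *m (invmx P *m diag_mx D *m P) =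
          invmx P *m (diag_mx D *m diag_mx D) *m P.
  by rewrite !mulmxA mulmxK.
rewrite char_poly_conj// mulmx_diag char_poly_trig ?diag_mx_is_trig// rmorph_prod.
apply: eq_bigr => i _.
by rewrite mxE eqxx mulr1n mxE rmorphB/= map_polyX map_polyC/= xE -rmorphM -expr2.
Qed.

Lemma mup_prod_XsubC (s : seq R) x :
  mup x (\prod_(y <- s) ('X - y%:P)) = count_mem x s.
Proof.
elim: s => [|y s IH]; first by rewrite big_nil mupNroot// rootE hornerC oner_eq0.
rewrite big_cons mupM ?polyXsubC_eq0 ?IH//; last first.
  by rewrite monic_neq0// monic_prod_XsubC.
by have := @mup_XsubCX R 1 x y; rewrite expr1 => ->; rewrite /= eq_sym; case: eqP.
Qed.

(** Roots counted with their multiplicity enumerate the factors. *)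
Lemma sum_rootsR_prod (s : seq R) (f : R -> R) :
  let p := \prod_(y <- s) ('X - y%:P) in
  \sum_(x <- rootsR p) (mup x p)%:R * f x = \sum_(y <- s) f y.
Proof.
move=> p; have p0 : p != 0 by rewrite monic_neq0// monic_prod_XsubC.
under eq_bigr do rewrite mup_prod_XsubC.
have mem_r y : (y \in rootsR p) = (y \in s).
  by have := roots_on_rootsR p0 y; rewrite in_itv/= root_prod_XsubC => <-.
have ur : uniq (rootsR p) by exact: uniq_roots.
move: (rootsR p) ur mem_r => rs ur mem_r.
have : {subset s <= rs} by move=> y; rewrite mem_r.
elim: s {p p0 mem_r} => [_|y s IH sub].
  by rewrite big_nil big1// => x _; rewrite mul0r.
rewrite big_cons -IH; last by move=> z zs; apply: sub; rewrite inE zs orbT.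
under eq_bigr do rewrite /= natrD mulrDl.
rewrite big_split/=; congr (_ + _).
rewrite (bigD1_seq y)//= ?sub ?mem_head// eqxx mul1r big1 ?addr0// => x xy.
by rewrite eq_sym (negbTE xy) mul0r.
Qed.

Lemma char_poly_root_psd n (A : 'M[R]_n) x : psd A -> root (char_poly A) x -> 0 <= x.
Proof.
move=> [_ A0]; rewrite -eigenvalue_root_char => /eigenvalueP[v vA vn0].
have vv : 0 < fnorm2 v.
  rewrite lt_def fnorm2_ge0 andbT; apply: contra_neq vn0 => v0.
  apply/rowP => j; rewrite mxE; apply/eqP; rewrite -sqrf_eq0 eq_le sqr_ge0 andbT.
  by rewrite -v0 fnorm2_entry.
have := A0 v; rewrite /qform /bform vA -scalemxAl mxE -dotvE.
by rewrite pmulr_lge0.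
Qed.

(** The characteristic polynomial of [A^T A] has for roots the squares of those of
[A], which are nonnegative and sum to the trace. *)
Lemma nuclear_sum_trace n (A : 'M[R]_n) : psd A ->
  let p := char_poly (A^T *m A) in
  \sum_(x <- rootsR p) (mup x p)%:R * Num.sqrt x = \tr A.
Proof.
move=> psdA; have [x [pA ->]] := char_poly_sym psdA.1.
have -> : \prod_i ('X - (x i ^+ 2)%:P) =
    \prod_(y <- [seq x i ^+ 2 | i <- index_enum 'I_n]) ('X - y%:P).
  by rewrite big_map.
rewrite /= (sum_rootsR_prod _ (fun y => Num.sqrt y)) big_map.
have x0 i : 0 <= x i.
  apply: (char_poly_root_psd psdA); rewrite pA.
  by rewrite (bigD1 i)//= rootM root_XsubC eqxx.
under eq_bigr do rewrite sqrtr_sqr ger0_norm//.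
case: n A psdA x pA x0 => [|n] A psdA x pA x0.
  by rewrite big_ord0 /mxtrace big_ord0.
have := char_poly_trace A (ltn0Sn n); rewrite pA.
have -> : \prod_i ('X - (x i)%:P) =
    \prod_(y <- [seq x i | i <- index_enum 'I_n.+1]) ('X - y%:P).
  by rewrite big_map.
have := @coefPn_prod_XsubC R [seq x i | i <- index_enum 'I_n.+1].
have sz : size (index_enum 'I_n.+1) = n.+1.
  by rewrite /index_enum unlock -enumT size_enum_ord.
rewrite size_map sz => /(_ isT) ->.
by rewrite big_map => /oppr_inj.
Qed.
End NuclearNorm.

(** * A finite net of the Euclidean ball *)

Section Net.
Context {R : realType}.

(** Rounding coordinates toward zero on the lattice of mesh [1/(4 sqrt l)]
moves a vector of the unit ball by at most [1/4], inside the ball.  The lattice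
points [z] kept satisfy [sum z_i^2 <= 16 l], hence [sum |z_i| <= 16 l], and the
weights [2^(- |z_i|)] bound their number. *)
Definition lattice_pt l (z : {ffun 'I_l -> bool * 'I_(16 * l).+1}) : 'rV[R]_l :=
  \row_i ((-1) ^+ (z i).1 * (z i).2%:R / (4 * Num.sqrt l%:R)).

Definition net l : seq 'rV[R]_l :=
  [seq lattice_pt z |
    z <- enum [pred z : {ffun 'I_l -> bool * 'I_(16 * l).+1} |
                (\sum_i ((z i).2 : nat) ^ 2 <= 16 * l)%N]].

Lemma halfX_ge0 k : 0 <= (2^-1 : R) ^+ k.
Proof. by rewrite exprn_ge0// invr_ge0. Qed.

Lemma geom_half N : (\sum_(k < N) (2^-1 : R) ^+ k) <= 2.
Proof.
suff -> : (\sum_(k < N) (2^-1 : R) ^+ k) = 2 - 2 * (2^-1) ^+ N.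
  by rewrite gerBl mulr_ge0// halfX_ge0.
elim: N => [|N IH]; first by rewrite big_ord0; lra.
by rewrite big_ord_recr/= IH exprS; lra.
Qed.

(** Each point kept has weight at least [2^(- 16 l)], and the weights of all the
sequences of signed integers sum to at most [4^l]. *)
Lemma size_net l : (size (net l))%:R <= 2 ^+ (18 * l) :> R.
Proof.
rewrite size_map -cardE -sum1_card natr_sum.
apply: (@le_trans _ _ (\sum_(z : {ffun 'I_l -> bool * 'I_(16 * l).+1})
    2 ^+ (16 * l) * \prod_i (2^-1 : R) ^+ (z i).2)).
  rewrite big_mkcond/=; apply: ler_sum => z _; case: ifPn => [h|_]; last first.
    by rewrite mulr_ge0 ?exprn_ge0// prodr_ge0// => i _; rewrite halfX_ge0.
  rewrite prodrXr exprVn ler_pdivlMr ?exprn_gt0// mul1r.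
  rewrite ler_weXn2l//; first by lra.
  rewrite inE in h; apply: leq_trans h; apply: leq_sum => i _.
  by case: (nat_of_ord _) => // k; rewrite expnS leq_pmulr// expn_gt0.
rewrite -big_distrr/= -(bigA_distr_bigA (fun _ (b : bool * 'I_(16 * l).+1) =>
   (2^-1 : R) ^+ b.2)) /= prodr_const card_ord.
have -> : (18 * l = 16 * l + 2 * l)%N by rewrite -mulnDl.
rewrite exprD ler_pM2l ?exprn_gt0// exprM; apply: lerXn2r; rewrite ?nnegrE.
- by rewrite sumr_ge0// => i _; rewrite halfX_ge0.
- by rewrite exprn_ge0.
have -> : \sum_(b : bool * 'I_(16 * l).+1) (2^-1 : R) ^+ b.2 =
    \sum_(b : bool) \sum_(k < (16 * l).+1) 2^-1 ^+ k by rewrite pair_bigA.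
rewrite big_bool/=; have := geom_half (16 * l).+1; lra.
Qed.

Lemma fnorm2_net l v : v \in net l -> fnorm2 v <= 1.
Proof.
case/mapP => z; rewrite mem_enum inE => hz ->.
case: l {v} z hz => [|l] z hz.
  by rewrite fnorm2_rV big_ord0.
rewrite fnorm2_rV.
have -> : \sum_j lattice_pt z 0 j ^+ 2 =
    (\sum_i ((z i).2 : nat) ^ 2)%:R / (16 * l.+1%:R).
  rewrite natr_sum mulr_suml; apply: eq_bigr => j _.
  rewrite mxE exprMn exprMn sqrr_sign mul1r exprVn exprMn sqr_sqrtr//.
  by rewrite natrX -[(4 : R) ^+ 2]natrX.
rewrite ler_pdivrMr ?mulr_gt0// mul1r -natrM ler_nat//.
Qed.

Lemma net_dense l (u : 'rV[R]_l.+1) : fnorm2 u <= 1 ->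
  exists2 v, v \in net l.+1 & fnorm2 (u - v) <= 16^-1.
Proof.
move=> u1; pose s : R := 4 * Num.sqrt l.+1%:R.
have s0 : 0 < s by rewrite mulr_gt0// sqrtr_gt0.
have s2 : s ^+ 2 = 16 * l.+1%:R by rewrite exprMn sqr_sqrtr// -natrX.
pose k i := Num.truncn (`|u 0 i| * s).
have kle i : (k i)%:R <= `|u 0 i| * s.
  by have /andP[] := truncn_itv (mulr_ge0 (normr_ge0 (u 0 i)) (ltW s0)).
have ltk i : `|u 0 i| * s < (k i)%:R + 1.
  have /andP[_] := truncn_itv (mulr_ge0 (normr_ge0 (u 0 i)) (ltW s0)).
  by rewrite -natr1.
have sumk : (\sum_i (k i) ^ 2 <= 16 * l.+1)%N.
  rewrite -(ler_nat R) natr_sum natrM -s2.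
  apply: (@le_trans _ _ (s ^+ 2 * fnorm2 u)); last first.
    by rewrite ler_piMr// sqr_ge0.
  rewrite fnorm2_rV mulr_sumr ler_sum// => i _.
  rewrite natrX -[u 0 i ^+ 2]real_normK ?num_real// mulrC -exprMn lerXn2r// nnegrE//.
  by rewrite mulr_ge0// ltW.
have kb i : (k i < (16 * l.+1).+1)%N.
  rewrite ltnS (leq_trans _ sumk)// (bigD1 i)//=.
  by apply: leq_trans (leq_addr _ _); case: (k i) => // j; rewrite expnS leq_pmulr// expn_gt0.
pose z := [ffun i => (u 0 i < 0, Ordinal (kb i))] : {ffun 'I_l.+1 -> bool * _}.
exists (lattice_pt z).
  apply: map_f; rewrite mem_enum inE; apply: leq_trans sumk.
  by apply: leq_sum => i _; rewrite ffunE.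
rewrite fnorm2_rV.
apply: (@le_trans _ _ (\sum_(i < l.+1) (s ^-1) ^+ 2)); last first.
  rewrite sumr_const card_ord exprVn s2 -[leLHS]mulr_natr.
  have : l.+1%:R != 0 :> R by rewrite pnatr_eq0. 
  by move: (l.+1%:R) => x x0; rewrite le_eqVlt; apply/orP; left; apply/eqP; field.
apply: ler_sum => i _; rewrite !mxE ffunE/= -[leLHS]real_normK ?num_real//.
rewrite lerXn2r ?nnegrE ?invr_ge0 ?(ltW s0)// -/s.
have -> : u 0 i - (-1) ^+ (u 0 i < 0)%R * (k i)%:R / s =
    (-1) ^+ (u 0 i < 0)%R * (`|u 0 i| - (k i)%:R / s).
  by rewrite mulrBr -numEsign mulrA.
rewrite normrM normr_sign mul1r ger0_norm.
  rewrite lerBlDr -(ler_pM2r s0) mulrDl mulVf ?gt_eqF// mulfVK ?gt_eqF//.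
  by rewrite addrC ltW.
by rewrite subr_ge0 ler_pdivrMr.
Qed.

(** Let [q] bound the form on the ball.  For [v] in the ball and [w] in the net at
distance at most [1/4], the difference of the values at [v] and [w] is
[bform N (v - w) (v + w)], at most [q / 2]; hence [q <= t + q / 2]. *)
Lemma qform_net l (N : 'M[R]_l) t : N^T = N ->
  (forall v, v \in net l -> `|qform N v| <= t) ->
  forall u, `|qform N u| <= 2 * t * fnorm2 u.
Proof.
case: l N => [|l] N NT H u.
  have -> : qform N u = 0 by rewrite qform_fdot fdotE big_ord0.
  have -> : fnorm2 u = 0 by rewrite fnorm2_rV big_ord0.
  by rewrite normr0 mulr0.
pose A := [set `|qform N v| | v in [set v : 'rV[R]_l.+1 | fnorm2 v <= 1]]%classic.
have f00 : fnorm2 (0 : 'rV[R]_l.+1) = 0 by rewrite /fnorm2 fdot0l.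
have supA : has_sup A.
  split; first by exists `|qform N 0|; exists 0; rewrite //= f00.
  exists (fnorm N) => _ [v /= v1 <-]; rewrite qform_fdot.
  rewrite (le_trans (ler_fdot _ _))// ler_piMr ?fnorm_ge0//.
  rewrite /fnorm /fnorm2 fdot_outer -/(fnorm2 v) -expr2 sqrtr_sqr ger0_norm//.
  exact: fnorm2_ge0.
pose q := sup A.
have q0 : 0 <= q.
  apply: (@le_trans _ _ `|qform N 0|) => //; apply: sup_upper_bound => //.
  by exists 0; rewrite //= f00.
have Hq v : `|qform N v| <= q * fnorm2 v.
  have [v0|vn0] := eqVneq (fnorm2 v) 0.
    rewrite v0 mulr0 qform_fdot (le_trans (ler_fdot _ _))// /fnorm /fnorm2.
    by rewrite fdot_outer -/(fnorm2 v) v0 mul0r sqrtr0 mulr0.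
  have vp : 0 < fnorm2 v by rewrite lt_def vn0 fnorm2_ge0.
  have : `|qform N ((Num.sqrt (fnorm2 v))^-1 *: v)| <= q.
    apply: sup_upper_bound => //; exists ((Num.sqrt (fnorm2 v))^-1 *: v) => //=.
    by rewrite fnorm2Z exprVn sqr_sqrtr ?fnorm2_ge0// mulVf.
  rewrite qformZ exprVn sqr_sqrtr ?fnorm2_ge0// normrM ger0_norm ?invr_ge0 ?fnorm2_ge0//.
  by rewrite ler_pdivrMl// mulrC.
have bq x y : `|bform N x y| <= q * fnorm x * fnorm y.
  have -> : bform N x y = fdot (x *m N) y by rewrite dotvE.
  rewrite (le_trans (ler_fdot _ _))// ler_wpM2r ?fnorm_ge0//.
  rewrite /fnorm -[q](ger0_norm q0) -sqrtr_sqr -sqrtrM ?sqr_ge0// ler_wsqrtr//.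
  exact: fnorm2_image.
have qt : q <= t + q / 2.
  apply: sup_le_ub => [|_ [v /= v1 <-]]; first by case: supA.
  have [w wnet vw] := net_dense v1.
  have -> : qform N v = qform N w + bform N (v - w) (v + w).
    rewrite bformDl !bformDr -scaleN1r !bformZl (bformC w v NT) /qform; ring.
  rewrite (le_trans (ler_normD _ _))// lerD ?H//.
  rewrite (le_trans (bq _ _))// -mulrA ler_wpM2l//.
  have a1 : fnorm (v - w) <= 4^-1.
    rewrite /fnorm; have -> : 4^-1 = Num.sqrt (4^-1 ^+ 2) :> R.
      by rewrite sqrtr_sqr ger0_norm// invr_ge0.
    by rewrite ler_wsqrtr// exprVn -natrX.
  have a2 : fnorm (v + w) <= 2.
    rewrite -(ler_sqr (_ : _ \is Num.nneg)) ?nnegrE ?fnorm_ge0// sqr_fnorm.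
    have := fnorm2D v w; have := fnorm2B v w; have := fnorm2_ge0 (v - w).
    by have := fnorm2_net wnet; rewrite -natrX; lra.
  have := ler_pM (fnorm_ge0 _) (fnorm_ge0 _) a1 a2; lra.
apply: (le_trans (Hq u)); rewrite ler_wpM2r ?fnorm2_ge0//; lra.
Qed.

End Net.

(** * Gaussian integrals and independence *)

Section GaussianIntegral.
Context {R : realType}.
Notation mu := (@lebesgue_measure R).

(** The density is almost everywhere the Radon-Nikodym derivative. *)
Lemma ge0_integral_normal_prob (m s : R) (f : R -> \bar R) : s != 0 ->
  (forall x, 0 <= f x)%E -> measurable_fun setT f ->
  (\int[normal_prob m s]_x f x = \int[mu]_x (f x * (normal_pdf m s x)%:E))%E.
Proof.
move=> s0 f0 mf; have dom := normal_prob_dominates m s.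
rewrite -(Radon_Nikodym_SigmaFinite.change_of_variables dom f0 measurableT mf).
have pdf_meas : measurable_fun setT (EFin \o normal_pdf m s).
  by apply/measurable_EFinP; exact: measurable_normal_pdf.
have RN_int := Radon_Nikodym_SigmaFinite.f_integrable dom.
have pdfE : ae_eq mu setT (EFin \o normal_pdf m s)
    (Radon_Nikodym_SigmaFinite.f (normal_prob m s) mu).
  apply: integral_ae_eq => //; first exact: integrable_normal_pdf.
    exact: measurable_int RN_int.
  by move=> E _ mE; rewrite -(Radon_Nikodym_SigmaFinite.f_integral dom).
apply: ae_eq_integral => //.
- by apply: emeasurable_funM => //; exact: measurable_int RN_int.
- exact: emeasurable_funM.
- by apply: filterS pdfE => x /(_ I) <-.
Qed.

(** Completing the square turns the integrand into a multiple of another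
normal density. *)
Lemma normal_quadratic_mgf (q b : R) : q < 2^-1 ->
  (\int[normal_prob 0 1]_x (expR (q * x ^+ 2 + 2 * b * x))%:E =
   (Num.sqrt (1 - 2 * q))^-1%:E * (expR (2 * b ^+ 2 / (1 - 2 * q)))%:E)%E.
Proof.
move=> q12; have r0 : 0 < 1 - 2 * q by lra.
pose s := (Num.sqrt (1 - 2 * q))^-1; pose m := 2 * b / (1 - 2 * q).
have s0 : 0 < s by rewrite invr_gt0 sqrtr_gt0.
have s2 : s ^+ 2 = (1 - 2 * q)^-1 by rewrite exprVn sqr_sqrtr// ltW.
rewrite ge0_integral_normal_prob ?oner_neq0//; last first.
  apply/measurable_EFinP; apply: measurableT_comp => //.
  by apply: measurable_funD; apply: measurable_funM.
have E x : ((expR (q * x ^+ 2 + 2 * b * x))%:E * (normal_pdf 0 1 x)%:E =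
   (s * expR (2 * b ^+ 2 / (1 - 2 * q)))%:E * (normal_pdf m s x)%:E)%E.
  rewrite -!EFinM; congr EFin.
  rewrite !normal_pdfE ?gt_eqF//= /normal_fun subr0 expr1n.
  have -> : normal_peak s = s^-1 * normal_peak 1.
    rewrite /normal_peak expr1n mul1r -invfM; congr (_^-1).
    by rewrite -mulrnAr sqrtrM ?sqr_ge0// sqrtr_sqr gtr0_norm.
  rewrite mulrCA -expRD.
  rewrite [RHS](_ : _ = s / s * normal_peak 1 *
     (expR (2 * b ^+ 2 / (1 - 2 * q)) * expR (- (x - m) ^+ 2 / (s ^+ 2 *+ 2)))); last ring.
  rewrite divff ?gt_eqF// mul1r -expRD; congr (_ * expR _).
  rewrite s2 /m -mulr_natr; field.
  by rewrite gt_eqF// subr_gt0 mulrC -ltr_pdivlMr// mul1r.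
under eq_integral do rewrite E.
rewrite ge0_integralZl//; last 3 first.
- by apply/measurable_EFinP; exact: measurable_normal_pdf.
- by move=> x _; rewrite lee_fin normal_pdf_ge0.
- by rewrite lee_fin mulr_ge0 ?expR_ge0// ltW.
by rewrite integral_normal_pdf mule1 EFinM.
Qed.

End GaussianIntegral.

Section Independence.
Context {R : realType} {d : measure_display} {T : measurableType d}.
Variable P : probability T R.

(** Dynkin's argument, through uniqueness of finite measures on a generating
pi-system. *)
Lemma indep_setsS (A : set T) (G : set (set T)) :
  measurable A -> G `<=` measurable -> setI_closed G -> G setT ->
  (forall B, G B -> P (A `&` B) = (P A * P B)%E) ->
  forall B, <<s G >> B -> P (A `&` B) = (P A * P B)%E.
Proof.
move=> mA GT GI Gt H B GB.
have sGT : <<s G >> `<=` measurable.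
  exact: smallest_sub (@sigma_algebra_measurable _ T) GT.
pose S := g_sigma_algebraType G.
have mid : measurable_fun setT (id : T -> S).
  by move=> _ Y mY; rewrite setTI; exact: sGT.
pose mix := isMeasurableFun.Build _ _ _ _ _ mid.
pose idS : {mfun T >-> S} := HB.pack (id : T -> S) mix.
have PA0 : 0 <= fine (P A) by rewrite fine_ge0// measure_ge0.
pose m1 : {measure set S -> \bar R} := pushforward (mrestr P mA) idS.
pose m2 : {measure set S -> \bar R} := mscale (NngNum PA0) (pushforward P idS).
have m1E C : m1 mid C = P (C `&` A) by [].
have m2E C : m2 mid C = ((fine (P A))%:E * P C)%E by [].
have m12 : m1 mid B = m2 mid B.
  apply: (@measure_unique _ _ S G (fun=> setT)) => //.
  - by rewrite predeqE => x; split=> // _; exists 0%N.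
  - move=> C GC; rewrite m1E m2E setIC.
    by rewrite fineK ?fin_num_measure//; exact: H.
  - move=> _; rewrite m1E setTI.
    by rewrite (le_lt_trans (probability_le1 P mA))// ltry.
have := m12; rewrite m1E m2E setIC => ->.
by rewrite fineK ?fin_num_measure.
Qed.

(** Freezing the sub-sigma-algebra generated by [G] while integrating out an
independent Gaussian variable. *)
Lemma gauss_freeze (g : T -> R) (G : set (set T))
    (F : measurableTypeR R * g_sigma_algebraType G -> \bar R) :
  gaussian P 0 1 g -> G `<=` measurable ->
  (forall A B, measurable A -> <<s G >> B ->
     P (g @^-1` A `&` B) = (P (g @^-1` A) * P B)%E) ->
  measurable_fun setT F -> (forall z, 0 <= F z)%E ->
  (\int[P]_w F (g w, w) = \int[P]_w \int[normal_prob 0 1]_x F (x, w))%E.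
Proof.
move=> [mg gN] GT ind mF F0.
have sGT : <<s G >> `<=` measurable.
  exact: smallest_sub (@sigma_algebra_measurable _ T) GT.
pose S := g_sigma_algebraType G.
have mid : measurable_fun setT (id : T -> S).
  by move=> _ Y mY; rewrite setTI; exact: sGT.
pose mix := isMeasurableFun.Build _ _ _ _ _ mid.
pose idS : {mfun T >-> S} := HB.pack (id : T -> S) mix.
have mphi : measurable_fun setT (fun w => ((g w, w) : measurableTypeR R * S)) by exact: measurable_fun_pair.
pose mix2 := isMeasurableFun.Build _ _ _ _ _ mphi.
pose phi : {mfun T >-> (measurableTypeR R * S)%type} := HB.pack (fun w => ((g w, w) : measurableTypeR R * S)) mix2.
transitivity (\int[distribution P phi]_z F z)%E.
  by rewrite ge0_integral_distribution.
transitivity (\int[normal_prob 0 1 \x distribution P idS]_z F z)%E.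
  pose N : probability (measurableTypeR R) R := normal_prob 0 1.
  pose M : {measure set (measurableTypeR R * S) -> \bar R} := (N \x distribution P idS)%E.
  apply: (@eq_measure_integral _ _ _ _ M) => X mX _.
  apply/esym; apply: (@product_measure_unique _ _ _ _ R N (distribution P idS) (distribution P phi)) => //.
  move=> A B mA mB; rewrite /distribution /pushforward /= -gN// -ind//.
rewrite fubini_tonelli2// ge0_integral_distribution//.
- by apply: measurable_fun_fubini_tonelli_G.
- by move=> y; apply: integral_ge0 => x _.
Qed.

End Independence.

(** * Exponential moments of Gaussian quadratic forms *)

Section QuadraticStep.
Context {R : realType} {J : eqType}.
Implicit Types (Q : J -> J -> R) (x : J -> R) (s : seq J).

Definition quad Q x s : R := \sum_(i <- s) \sum_(j <- s) Q i j * x i * x j.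
Definition trq Q s : R := \sum_(i <- s) Q i i.
Definition hsq Q s : R := \sum_(i <- s) \sum_(j <- s) Q i j ^+ 2.

Lemma sum2_cons (F : J -> J -> R) a s :
  \sum_(i <- a :: s) \sum_(j <- a :: s) F i j =
  F a a + \sum_(j <- s) F a j + \sum_(i <- s) F i a +
  \sum_(i <- s) \sum_(j <- s) F i j.
Proof.
rewrite !big_cons; under [X in _ + X = _]eq_bigr do rewrite big_cons.
by rewrite big_split/= !addrA.
Qed.

Lemma sum2_prod (f h : J -> R) s :
  \sum_(i <- s) \sum_(j <- s) f i * h j = (\sum_(i <- s) f i) * (\sum_(j <- s) h j).
Proof. by rewrite mulr_suml; under [RHS]eq_bigr do rewrite mulr_sumr. Qed.

Lemma quad_cons Q x a s : (forall i j, Q i j = Q j i) ->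
  quad Q x (a :: s) =
  Q a a * x a ^+ 2 + 2 * (\sum_(j <- s) Q a j * x j) * x a + quad Q x s.
Proof.
move=> Qs; rewrite /quad sum2_cons; congr (_ + _).
rewrite -addrA; congr (_ + _); first by rewrite expr2 mulrA.
rewrite -mulrA mulr_suml mulr2n mulrDl !mul1r; congr (_ + _).
  by apply: eq_bigr => j _; rewrite mulrAC.
by apply: eq_bigr => j _; rewrite (Qs j a).
Qed.

Lemma hsq_cons Q a s : (forall i j, Q i j = Q j i) ->
  hsq Q (a :: s) = Q a a ^+ 2 + 2 * (\sum_(j <- s) Q a j ^+ 2) + hsq Q s.
Proof.
move=> Qs; rewrite /hsq sum2_cons; congr (_ + _).
rewrite -addrA; congr (_ + _); rewrite mulr2n mulrDl mul1r; congr (_ + _).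
by apply: eq_bigr => j _; rewrite (Qs j a).
Qed.

Lemma hsq_ge0 Q s : 0 <= hsq Q s.
Proof. by do 2!(apply: sumr_ge0 => ? _); rewrite sqr_ge0. Qed.

(** The form left after integrating out the coordinate [a]. *)
Definition schur (a : J) Q : J -> J -> R :=
  fun i j => Q i j + 2 / (1 - 2 * Q a a) * (Q a i * Q a j).

Lemma schur_sym a Q : (forall i j, Q i j = Q j i) ->
  forall i j, schur a Q i j = schur a Q j i.
Proof. by move=> Qs i j; rewrite /schur Qs [Q a i * _]mulrC. Qed.

Lemma sqrt_inv_expR (q : R) : q ^+ 2 <= 64^-1 ->
  (Num.sqrt (1 - 2 * q))^-1 <= expR (q + 5 * q ^+ 2).
Proof.
move=> q2; have qle : `|q| <= 8^-1.
  rewrite -(@ler_sqr _ `|q|) ?nnegrE ?invr_ge0// real_normK ?num_real//.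
  by rewrite exprVn -natrX.
have /andP[qa qb] : - 8^-1 <= q <= 8^-1 by rewrite -ler_norml.
have r0 : 0 < 1 - 2 * q by lra.
have s0 : 0 < Num.sqrt (1 - 2 * q) by rewrite sqrtr_gt0.
rewrite -[leLHS]mul1r ler_pdivrMr// -(@ler_sqr _ 1) ?nnegrE ?mulr_ge0 ?expR_ge0 ?(ltW s0)//.
rewrite expr1n exprMn sqr_sqrtr ?(ltW r0)// -expRM_natl mulr_natl.
apply: (@le_trans _ _ ((1 + (q + 5 * q ^+ 2) *+ 2) * (1 - 2 * q))); last first.
  by rewrite ler_pM2r// expR_ge1Dx.
rewrite -mulr_natl.
have : 0 <= q ^+ 2 * (6 - 20 * q) by rewrite mulr_ge0 ?sqr_ge0//; lra.
rewrite !expr2; lra.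
Qed.

(** Integrating out the coordinate [a] adds to the trace and to the squared norm of
the remaining form; the terms in [Q a a] and [Q a j] that leave the exponent pay
for both, which is what the factor 5 is for. *)
Lemma quad_step Q a s x : (forall i j, Q i j = Q j i) ->
  hsq Q (a :: s) <= 64^-1 ->
  hsq (schur a Q) s <= 64^-1 /\
  (Num.sqrt (1 - 2 * Q a a))^-1 *
    expR (2 * (\sum_(j <- s) Q a j * x j) ^+ 2 / (1 - 2 * Q a a)) *
    expR (quad Q x s - trq Q (a :: s) - 5 * hsq Q (a :: s)) <=
  expR (quad (schur a Q) x s - trq (schur a Q) s - 5 * hsq (schur a Q) s).
Proof.
move=> Qs; rewrite hsq_cons//; set q := Q a a; set v := \sum_(j <- s) _ ^+ 2.
set f := hsq Q s; set b := \sum_(j <- s) Q a j * x j => hle.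
have v0 : 0 <= v by apply: sumr_ge0 => ? _; rewrite sqr_ge0.
have f0 : 0 <= f := hsq_ge0 Q s.
have q20 : 0 <= q ^+ 2 := sqr_ge0 q.
have q2 : q ^+ 2 <= 64^-1 by lra.
have qle : `|q| <= 8^-1.
  rewrite -(@ler_sqr _ `|q|) ?nnegrE ?invr_ge0// real_normK ?num_real//.
  by rewrite exprVn -natrX.
have /andP[qa qb] : - 8^-1 <= q <= 8^-1 by rewrite -ler_norml.
have r0 : 0 < 1 - 2 * q by lra.
pose al := 2 / (1 - 2 * q).
have al0 : 0 <= al by rewrite divr_ge0// ltW.
have al3 : al <= 8 / 3 by rewrite ler_pdivrMr//; lra.
pose cr := \sum_(i <- s) \sum_(j <- s) Q i j * (Q a i * Q a j).
have cr_le : cr <= v / 8.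
  rewrite (le_trans (ler_norm _))// -(@ler_sqr _ `|cr|) ?nnegrE ?divr_ge0//.
  rewrite real_normK ?num_real//; apply: (@le_trans _ _ (f * v ^+ 2)); last first.
    rewrite expr_div_n mulrC ler_wpM2l ?sqr_ge0// -natrX; lra.
  apply: discr_le0 => //; first exact: sqr_ge0.
  move=> t; have : 0 <= \sum_(i <- s) \sum_(j <- s) (Q i j - t * (Q a i * Q a j)) ^+ 2.
    by do 2!(apply: sumr_ge0 => ? _); rewrite sqr_ge0.
  congr (_ <= _); rewrite /cr /f /hsq [v ^+ 2]expr2 /v -sum2_prod.
  rewrite !mulr_sumr -sumrB -big_split/=; apply: eq_bigr => i _.
  rewrite !mulr_sumr -sumrB -big_split/=; apply: eq_bigr => j _.
  ring.
have fE : hsq (schur a Q) s = f + 2 * al * cr + al ^+ 2 * v ^+ 2.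
  rewrite /cr /f /hsq [v ^+ 2]expr2 /v -sum2_prod.
  rewrite !mulr_sumr -!big_split/=; apply: eq_bigr => i _.
  rewrite !mulr_sumr -!big_split/=; apply: eq_bigr => j _.
  rewrite /schur -/q -/al; ring.
have fle : hsq (schur a Q) s <= f + v.
  rewrite fE -addrA lerD2l.
  have h1 : al * cr <= 8 / 3 * (v / 8).
    apply: (@le_trans _ _ (al * (v / 8))); first by rewrite ler_wpM2l.
    by rewrite ler_wpM2r// divr_ge0.
  have h2 : al ^+ 2 * v ^+ 2 <= (8 / 3) ^+ 2 * (128^-1 * v).
    apply: ler_pM; rewrite ?sqr_ge0//; first by rewrite lerXn2r// nnegrE// divr_ge0.
    by rewrite expr2 ler_wpM2r//; lra.
  by rewrite -mulrA; move: h2; rewrite [(8 / 3) ^+ 2]expr2; lra.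
split; first by lra.
have -> : quad (schur a Q) x s = quad Q x s + 2 * b ^+ 2 / (1 - 2 * q).
  have -> : 2 * b ^+ 2 / (1 - 2 * q) = al * (b * b) by rewrite /al expr2; ring.
  rewrite {1}/b -sum2_prod mulr_sumr /quad -big_split/=; apply: eq_bigr => i _.
  rewrite mulr_sumr -big_split/=; apply: eq_bigr => j _.
  rewrite /schur -/q -/al; ring.
have -> : trq (schur a Q) s = trq Q s + al * v.
  rewrite /trq /v mulr_sumr -big_split/=; apply: eq_bigr => i _.
  by rewrite /schur -/q -/al expr2.
have -> : trq Q (a :: s) = q + trq Q s by rewrite /trq big_cons.
rewrite -mulrA -expRD.
apply: (le_trans (ler_wpM2r (expR_ge0 _) (sqrt_inv_expR q2))).
rewrite -expRD ler_expR.
have : al * v <= 8 / 3 * v by rewrite ler_wpM2r.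
lra.
Qed.

End QuadraticStep.

Section GaussianFamily.
Context {R : realType} {d : measure_display} {T : measurableType d}.
Variable P : probability T R.
Context {J : eqType}.
Variable g : J -> T -> R.

(** The pi-system of cylinders over the coordinates in [S]. *)
Definition cyl (S : set J) : set (set T) :=
  [set A | exists s : seq J, exists B : J -> set R,
    [/\ uniq s, forall j, j \in s -> S j, forall j, measurable (B j) &
        A = [set w | forall j, j \in s -> B j (g j w)]]].

Definition smeas (S : set J) (f : T -> R) : Prop :=
  measurable_fun setT (f : g_sigma_algebraType (cyl S) -> R).

Hypothesis gN : forall j, gaussian P 0 1 (g j).
Hypothesis gI : mutually_independent P
  (fun j => sigma_gen setT (fun _ : unit => g j)).

Let mg j : measurable_fun setT (g j). Proof. by case: (gN j). Qed.

Lemma cyl_setT S : cyl S setT.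
Proof.
exists [::], (fun=> setT); split=> //.
by rewrite predeqE => w; split.
Qed.

Lemma cylI S : setI_closed (cyl S).
Proof.
move=> _ _ [s1 [B1 [u1 S1 mB1 ->]]] [s2 [B2 [u2 S2 mB2 ->]]].
exists (undup (s1 ++ s2)).
exists (fun j => (if j \in s1 then B1 j else setT) `&`
                 (if j \in s2 then B2 j else setT)).
split; first exact: undup_uniq.
- by move=> j; rewrite mem_undup mem_cat => /orP[/S1|/S2].
- by move=> j; apply: measurableI; case: ifP.
rewrite predeqE => w; split=> [[h1 h2] j js|h].
  by split; case: ifP => // hj; [apply: h1|apply: h2].
split=> j js.
  by have [] := h j; rewrite ?mem_undup ?mem_cat ?js// orbT.
by have [] := h j; rewrite ?mem_undup ?mem_cat ?js ?orbT.
Qed.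

Lemma cyl_measurable S : cyl S `<=` measurable.
Proof.
move=> _ [s [B [_ _ mB ->]]]; elim: s => [|a s IH].
  rewrite (_ : [set w | _] = setT)//.
  by rewrite predeqE => w; split.
rewrite (_ : [set w | _] = (g a @^-1` B a) `&` [set w | forall j, j \in s -> B j (g j w)]).
  by apply: measurableI => //; rewrite -[X in measurable X]setTI; apply: mg.
rewrite predeqE => w; split=> [h|[h1 h2] j].
  by split=> [|j js]; apply: h; rewrite inE ?eqxx ?js ?orbT.
by rewrite inE => /predU1P[->|/h2].
Qed.

Lemma cylS (S S' : set J) : S `<=` S' -> cyl S `<=` cyl S'.
Proof.
move=> SS' A [s [B [us sS mB ->]]]; exists s, B; split=> // j js.
exact/SS'/sS.
Qed.

Lemma sigma_cyl_measurable S : <<s cyl S >> `<=` measurable.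
Proof.
exact: smallest_sub (@sigma_algebra_measurable _ T) (@cyl_measurable S).
Qed.

Lemma smeasS (S S' : set J) f : S `<=` S' -> smeas S f -> smeas S' f.
Proof.
move=> SS' mf _ Y mY; have := mf measurableT Y mY; rewrite !setTI.
move: (f @^-1` Y); change (<<s cyl S >> `<=` <<s cyl S' >>).
apply: smallest_sub; first exact: smallest_sigma_algebra.
by move=> A /(cylS SS'); exact: sub_sigma_algebra.
Qed.

Lemma smeas_measurable S f : smeas S f -> measurable_fun setT f.
Proof.
move=> mf _ Y mY; have := mf measurableT Y mY; rewrite !setTI.
exact: sigma_cyl_measurable.
Qed.

Lemma smeas_coord (S : set J) j : S j -> smeas S (g j).
Proof.
move=> Sj _ Y mY; rewrite setTI; apply: sub_sigma_algebra.
exists [:: j], (fun=> Y); split=> //; first by move=> k; rewrite inE => /eqP->.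
rewrite predeqE => w; split=> [h k|]; first by rewrite inE => /eqP->.
by apply; rewrite inE.
Qed.

(** Independence over the cylinders extends to the generated sigma-algebra. *)
Lemma cyl_indep (S : set J) a : ~ S a -> forall A B, measurable A ->
  <<s cyl S >> B -> P (g a @^-1` A `&` B) = (P (g a @^-1` A) * P B)%E.
Proof.
move=> Sa A B mA; apply: indep_setsS.
- by rewrite -[X in measurable X]setTI; apply: mg.
- exact: cyl_measurable.
- exact: cylI.
- exact: cyl_setT.
move=> _ [s [C [us sS mC ->]]].
have as' : a \notin s by apply/negP => /sS.
have sg j D : measurable D -> sigma_gen setT (fun _ : unit => g j) (g j @^-1` D).
  by move=> mD; apply: sub_sigma_algebra; exists tt, D.
pose E j := if j == a then g a @^-1` A else g j @^-1` C j.
have Es j : j \in s -> E j = g j @^-1` C j.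
  by rewrite /E; case: eqP => // -> h; rewrite h in as'.
have := gI (s := a :: s) (E := E); rewrite /= as' us => /(_ isT).
have hE j : j \in a :: s -> sigma_gen setT (fun _ : unit => g j) (E j).
  by rewrite /E; case: eqP => [->|_] _; apply: sg.
have Ea : E a = g a @^-1` A by rewrite /E eqxx.
move=> /(_ hE); rewrite big_cons Ea => e1.
transitivity (P [set w | forall j, j \in a :: s -> E j w]).
  congr (P _); rewrite predeqE => w; split=> [[h1 h2] j|h].
    by rewrite inE => /predU1P[->|js]; [rewrite Ea|rewrite Es//; exact: h2].
  split=> [|j js]; last by have := h j; rewrite inE js orbT Es//; exact.
  by have := h a; rewrite inE eqxx Ea; exact.
rewrite e1; congr (_ * _)%E.
have := gI (s := s) (E := E) us; rewrite /= => <-.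
  congr (P _); rewrite predeqE => w; split=> h j js; have := h j js; rewrite Es//.
by move=> j js; apply: hE; rewrite inE js orbT.
Qed.

Lemma smeas_cst S (c : R) : smeas S (fun=> c).
Proof. exact: measurable_cst. Qed.

Lemma smeasD S f h : smeas S f -> smeas S h -> smeas S (fun w => f w + h w).
Proof. exact: measurable_funD. Qed.

Lemma smeasB S f h : smeas S f -> smeas S h -> smeas S (fun w => f w - h w).
Proof. exact: measurable_funB. Qed.

Lemma smeasM S f h : smeas S f -> smeas S h -> smeas S (fun w => f w * h w).
Proof. exact: measurable_funM. Qed.

Lemma smeasX S f k : smeas S f -> smeas S (fun w => f w ^+ k).
Proof. exact: measurable_funX. Qed.

Lemma smeas_comp S f (h : R -> R) : measurable_fun setT h -> smeas S f ->
  smeas S (fun w => h (f w)).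
Proof. by move=> mh mf; exact: (measurableT_comp mh mf). Qed.

Lemma smeasV S f : (forall w, 0 < f w) -> smeas S f -> smeas S (fun w => (f w)^-1).
Proof.
move=> f0 mf; have -> : (fun w => (f w)^-1) = (fun w => f w `^ (-1)).
  by apply/funext => w; rewrite powR_inv1// ltW.
exact: (smeas_comp (measurable_powR (-1)) mf).
Qed.

Lemma smeas_sqrt S f : smeas S f -> smeas S (fun w => Num.sqrt (f w)).
Proof.
apply: smeas_comp; apply: continuous_measurable_fun; exact: sqrt_continuous.
Qed.

Lemma smeas_sum (I : eqType) S (F : I -> T -> R) s :
  (forall i, i \in s -> smeas S (F i)) ->
  smeas S (fun w => \sum_(i <- s) F i w).
Proof.
elim: s => [|a s IH] h.
  by under eq_fun do rewrite big_nil; exact: smeas_cst.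
under eq_fun do rewrite big_cons; apply: smeasD; first by apply: h; exact: mem_head.
by apply: IH => i is_; apply: h; rewrite inE is_ orbT.
Qed.

Lemma smeas_quad S (Q : J -> J -> T -> R) s :
  (forall i j, smeas S (Q i j)) -> (forall i, i \in s -> smeas S (g i)) ->
  smeas S (fun w => quad (fun i j => Q i j w) (g^~ w) s).
Proof.
move=> mQ ms; apply: smeas_sum => i is_; apply: smeas_sum => j js.
by apply: smeasM; [apply: smeasM => //|]; apply: ms.
Qed.

Lemma smeas_hsq S (Q : J -> J -> T -> R) s :
  (forall i j, smeas S (Q i j)) -> smeas S (fun w => hsq (fun i j => Q i j w) s).
Proof.
by move=> mQ; apply: smeas_sum => i _; apply: smeas_sum => j _; exact: smeasX.
Qed.

Lemma smeas_trq S (Q : J -> J -> T -> R) s :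
  (forall i j, smeas S (Q i j)) -> smeas S (fun w => trq (fun i j => Q i j w) s).
Proof. by move=> mQ; apply: smeas_sum => i _; exact: mQ. Qed.

(** The coefficients may be random as long as they only depend on coordinates
outside [s]: these are frozen when a coordinate of [s] is integrated out, and the
induction hypothesis applies to the form [schur] that remains. *)
Lemma chaos (s : seq J) (S : set J) (Q : J -> J -> T -> R) (Z : T -> R) :
  uniq s -> (forall a, a \in s -> ~ S a) ->
  (forall i j, smeas S (Q i j)) -> (forall i j w, Q i j w = Q j i w) ->
  (forall w, hsq (fun i j => Q i j w) s <= 64^-1) ->
  smeas S Z -> (forall w, 0 <= Z w) ->
  (\int[P]_w (Z w * expR (quad (fun i j => Q i j w) (g^~ w) s
      - trq (fun i j => Q i j w) s - 5 * hsq (fun i j => Q i j w) s))%:E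
   <= \int[P]_w (Z w)%:E)%E.
Proof.
elim: s Q => [|a s IH] Q.
  move=> _ _ _ _ _ _ _; rewrite le_eqVlt; apply/orP; left; apply/eqP.
  apply: eq_integral => w _; congr EFin.
  by rewrite /quad /trq /hsq !big_nil mulr0 !subr0 expR0 mulr1.
move=> /=/andP[as' us] nS mQ Qs hQ mZ Z0.
pose S' := S `|` [set j | j \in s].
have S'a : ~ S' a by case=> [/(nS a (mem_head _ _))//|/= h]; rewrite h in as'.
have SS' : S `<=` S' by move=> j; left.
have mQ' i j : smeas S' (Q i j) by exact: smeasS (mQ i j).
have mg' j : j \in s -> smeas S' (g j) by move=> js; apply: smeas_coord; right.
pose q w := Q a a w; pose b w := \sum_(j <- s) Q a j w * g j w.
pose c w := quad (fun i j => Q i j w) (g^~ w) s - trq (fun i j => Q i j w) (a :: s)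
   - 5 * hsq (fun i j => Q i j w) (a :: s).
have mq : smeas S q by exact: mQ.
have mb : smeas S' b by apply: smeas_sum => j js; apply: smeasM => //; exact: mg'.
have mc : smeas S' c.
  apply: smeasB; [apply: smeasB|apply: smeasM; first exact: smeas_cst].
  - exact: smeas_quad.
  - exact: smeas_trq.
  - exact: smeas_hsq.
have q12 w : q w < 2^-1.
  have : q w ^+ 2 <= 64^-1.
    apply: le_trans (hQ w); rewrite hsq_cons// /q -addrA lerDl addr_ge0 ?hsq_ge0//.
    by rewrite mulr_ge0// sumr_ge0// => j _; exact: sqr_ge0.
  by have := sqr_ge0 (q w - 8^-1); rewrite !expr2; lra.
have r0 w : 0 < 1 - 2 * q w by have := q12 w; lra.
pose F (z : measurableTypeR R * g_sigma_algebraType (cyl S')) : \bar R :=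
  (Z z.2 * expR (c z.2) * expR (q z.2 * z.1 ^+ 2 + 2 * b z.2 * z.1))%:E.
have mZ' : smeas S' Z := smeasS SS' mZ.
have mq' : smeas S' q := smeasS SS' mq.
have mF : measurable_fun setT F.
  have m2 (f : T -> R) : smeas S' f -> measurable_fun setT
      (fun z : measurableTypeR R * g_sigma_algebraType (cyl S') => f z.2).
    by move=> mf; exact: (measurableT_comp mf measurable_snd).
  have m1 : measurable_fun setT
      (fun z : measurableTypeR R * g_sigma_algebraType (cyl S') => z.1 : R).
    exact: measurable_fst.
  apply/measurable_EFinP; apply: measurable_funM.
    apply: measurable_funM; first exact: m2.
    by apply: (measurableT_comp (@measurable_expR R)); exact: m2.
  apply: (measurableT_comp (@measurable_expR R)); apply: measurable_funD.
    by apply: measurable_funM; [exact: m2|exact: measurable_funX].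
  by apply: measurable_funM => //; apply: measurable_funM => //; exact: m2.
have F0 z : (0 <= F z)%E by rewrite lee_fin !mulr_ge0 ?expR_ge0.
have := gauss_freeze (gN a) (@cyl_measurable S') (cyl_indep S'a) mF F0.
have -> : (\int[P]_w F (g a w, w))%E = (\int[P]_w (Z w * expR (
    quad (fun i j => Q i j w) (g^~ w) (a :: s) - trq (fun i j => Q i j w) (a :: s)
    - 5 * hsq (fun i j => Q i j w) (a :: s)))%:E)%E.
  apply: eq_integral => w _; rewrite /F/=; congr EFin.
  rewrite -mulrA -expRD quad_cons// /c /q /b; congr (_ * expR _); ring.
move=> ->.
apply: (@le_trans _ _ (\int[P]_w (Z w * expR (
    quad (schur a (fun i j => Q i j w)) (g^~ w) s
    - trq (schur a (fun i j => Q i j w)) s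
    - 5 * hsq (schur a (fun i j => Q i j w)) s))%:E)%E); last first.
  apply: (IH (fun i j w => schur a (fun i j => Q i j w) i j)) => //.
  - by move=> j js; apply: nS; rewrite inE js orbT.
  - move=> i j; apply: smeasD; first exact: mQ.
    apply: smeasM; last exact: smeasM.
    apply: smeasM; first exact: smeas_cst.
    apply: smeasV; first exact: r0.
    by apply: smeasB; [exact: smeas_cst|apply: smeasM => //; exact: smeas_cst].
  - by move=> i j w; exact: schur_sym.
  - by move=> w; exact: (quad_step (g^~ w) (fun i j => Qs i j w) (hQ w)).1.
have mschur i j : smeas S (fun w => schur a (fun i j => Q i j w) i j).
  apply: smeasD; first exact: mQ.
  apply: smeasM; last exact: smeasM.
  apply: smeasM; first exact: smeas_cst.
  apply: smeasV; first exact: r0.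
  by apply: smeasB; [exact: smeas_cst|apply: smeasM => //; exact: smeas_cst].
pose H w := Z w * ((Num.sqrt (1 - 2 * q w))^-1 *
    expR (2 * b w ^+ 2 / (1 - 2 * q w)) * expR (c w)).
have HE w : (\int[normal_prob 0 1]_x F (x, w) = (H w)%:E)%E.
  rewrite /F/=; under eq_integral do rewrite EFinM.
  rewrite ge0_integralZl//.
  - rewrite normal_quadratic_mgf// -!EFinM; congr EFin; rewrite /H; ring.
  - apply/measurable_EFinP; apply: measurableT_comp => //.
    by apply: measurable_funD; apply: measurable_funM.
  - by rewrite lee_fin mulr_ge0// expR_ge0.
have mr' : smeas S' (fun w => 1 - 2 * q w).
  by apply: smeasB; [exact: smeas_cst|apply: smeasM => //; exact: smeas_cst].
have mexp f : smeas S' f -> smeas S' (fun w => expR (f w)).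
  by apply: smeas_comp; exact: measurable_expR.
have mH : smeas S' H.
  apply: smeasM => //; apply: smeasM; last exact: mexp.
  apply: smeasM.
    by apply: smeasV; [move=> w; rewrite sqrtr_gt0|exact: smeas_sqrt].
  apply: mexp; apply: smeasM; last exact: smeasV.
  by apply: smeasM; [exact: smeas_cst|exact: smeasX].
under eq_integral do rewrite HE.
apply: ge0_le_integral => //.
- by move=> w _; rewrite lee_fin /H !mulr_ge0 ?expR_ge0// invr_ge0 sqrtr_ge0.
- by apply/measurable_EFinP; exact: smeas_measurable mH.
- apply/measurable_EFinP; apply: (@smeas_measurable S'); apply: smeasM => //.
  have ms' i j : smeas S' (fun w => schur a (fun i j => Q i j w) i j).
    exact: smeasS SS' (mschur i j).
  apply: mexp; apply: smeasB; last apply: smeasM; last 2 first.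
  + exact: smeas_cst.
  + exact: (smeas_hsq _ ms').
  apply: smeasB; last exact: (smeas_trq _ ms').
  exact: (smeas_quad ms').
move=> w _; rewrite lee_fin /H ler_wpM2l//.
exact: (quad_step (g^~ w) (fun i j => Qs i j w) (hQ w)).2.
Qed.

End GaussianFamily.

(** * Continuous functions of finitely many random variables *)

Section SeqCont.
Context {R : realType}.

Definition seqcont (I : Type) (phi : (I -> R) -> R) : Prop :=
  forall (u_ : nat -> I -> R) (u : I -> R),
    (forall i, u_ ^~ i @ \oo --> u i) -> phi \o u_ @ \oo --> phi u.

Definition grid (m : nat) (x : R) : R := (Num.floor (x * m.+1%:R))%:~R / m.+1%:R.

Lemma cvg_grid (x : R) : grid ^~ x @ \oo --> x.
Proof.
apply/cvgrPdist_le => e e0; near=> m.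
have m0 : 0 < m.+1%:R :> R by [].
have /andP[fle flt] := floor_itv (x * m.+1%:R).
rewrite /grid ger0_norm; last by rewrite subr_ge0 ler_pdivrMr.
have -> : x - (Num.floor (x * m.+1%:R))%:~R / m.+1%:R =
    (x * m.+1%:R - (Num.floor (x * m.+1%:R))%:~R) / m.+1%:R.
  by field; rewrite addrC natr1 pnatr_eq0.
rewrite ler_pdivrMr//; apply: (@le_trans _ _ 1).
  by rewrite lerBlDl ltW// -[1]/(1%:~R) -intrD.
rewrite mulrC -ler_pdivrMr// mul1r.
near: m; exists (Num.truncn e^-1).+1 => // k /= ke.
rewrite (@le_trans _ _ k%:R)//; last by rewrite ler_nat.
apply: (@le_trans _ _ (Num.truncn e^-1).+1%:R); last by rewrite ler_nat.
have ei0 : 0 <= e^-1 by rewrite invr_ge0 ltW.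
by have /andP[_ /ltW] := truncn_itv ei0.
Unshelve. all: by end_near. Qed.

(** Values on a lattice are taken on countably many measurable cells, and
refining the lattice converges. *)
Lemma seqcont_measurable d (X : measurableType d) (I : finType)
    (f : I -> X -> R) (phi : (I -> R) -> R) :
  (forall i, measurable_fun setT (f i)) -> seqcont phi ->
  measurable_fun setT (fun x => phi (f^~ x)).
Proof.
move=> mf cphi.
apply: (@measurable_fun_cvg _ _ _ _ (fun m x => phi (fun i => grid m (f i x)))) => //.
  move=> m _ Y mY; rewrite setTI.
  pose cell (z : {ffun I -> int}) := \big[setI/setT]_i
     [set x | z i = Num.floor (f i x * m.+1%:R)].
  rewrite (_ : _ @^-1` _ = \bigcup_k
    (if (unpickle k : option {ffun I -> int}) is Some z then
       if `[< Y (phi (fun i => (z i)%:~R / m.+1%:R)) >] then cell z else set0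
     else set0)).
    apply: bigcupT_measurable => k; case: unpickle => // z; case: ifP => // _.
    apply: bigsetI_measurable => i _.
    rewrite (_ : [set x | _] = f i @^-1` `[(z i)%:~R / m.+1%:R, (z i + 1)%:~R / m.+1%:R[).
      by rewrite -[X in measurable X]setTI; apply: mf => //; exact: measurable_itv.
    rewrite predeqE => x; rewrite /= in_itv/= ler_pdivrMr// ltr_pdivlMr//.
    split=> [->|h]; first exact: floor_itv.
    by apply/esym/floor_def.
  have cellP z x : cell z x <-> forall i, z i = Num.floor (f i x * m.+1%:R).
    rewrite /cell; split=> [h i|h]; last first.
      by elim/big_rec: _ => // i A _ Ax; split=> //; exact: h.
    by move: h; rewrite (bigD1 i)//= => -[].
  rewrite predeqE => x; split=> [Yx|[k _]].
    exists (pickle [ffun i => Num.floor (f i x * m.+1%:R)]) => //.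
    rewrite pickleK; case: asboolP => [_|]; first by apply/cellP => i; rewrite ffunE.
    by case; rewrite /=; under eq_fun do rewrite ffunE.
  case: unpickle => // z; case: asboolP => // Yz /cellP zx.
  by rewrite /=; under eq_fun do rewrite /grid -zx.
by move=> x _; apply: cphi => i; exact: cvg_grid.
Qed.

End SeqCont.

(** * Quadratic forms in linear images of Gaussian samples *)

Section GaussianSample.
Context {R : realType} {d : measure_display} {T : measurableType d}.
Variable P : probability T R.

Lemma fnorm2_mull_le L M p (c : R) (B : 'M[R]_(L, M)) (X : 'M[R]_(L, p)) :
  psd (c *: 1%:M - B *m B^T) -> fnorm2 (B^T *m X) <= c * fnorm2 X.
Proof.
move=> psdc.
have psdX : psd (X *m X^T).
  by have := psd_conj X (psd1 p); rewrite mulmx1.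
have := psd_fdot psdc psdX; rewrite fdotBl fdotZl subr_ge0 => h.
have -> : fnorm2 X = fdot 1%:M (X *m X^T).
  by rewrite -fdot_mulr mul1mx.
apply: le_trans h.
by rewrite /fnorm2 fdot_mull trmxK mulmxA fdotC fdot_mulr.
Qed.

Lemma smeas_seqcont (J : eqType) (I : finType) (g : J -> T -> R) S
    (f : I -> T -> R) (phi : (I -> R) -> R) :
  (forall i, smeas g S (f i)) -> seqcont phi ->
  smeas g S (fun w => phi (f^~ w)).
Proof.
exact: (@seqcont_measurable R _ (g_sigma_algebraType (cyl g S)) I f phi).
Qed.

(** The blocks are integrated one after the other: the exponential of those that
remain is a weight measurable with respect to the other coordinates. *)
Lemma chaos_blocks (J I : eqType) (g : J -> T -> R) (blk : I -> seq J)
    (S : set J) (Q : I -> J -> J -> T -> R) (r : seq I) :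
  (forall j, gaussian P 0 1 (g j)) ->
  mutually_independent P (fun j => sigma_gen setT (fun _ : unit => g j)) ->
  uniq r -> (forall i, uniq (blk i)) ->
  (forall i k j, j \in blk i -> j \in blk k -> i = k) ->
  (forall i j, i \in r -> j \in blk i -> ~ S j) ->
  (forall i j k, smeas g S (Q i j k)) ->
  (forall i j k w, Q i j k w = Q i k j w) ->
  (forall i w, hsq (fun j k => Q i j k w) (blk i) <= 64^-1) ->
  (\int[P]_w (expR (\sum_(i <- r)
     (quad (fun j k => Q i j k w) (g^~ w) (blk i)
      - trq (fun j k => Q i j k w) (blk i)
      - 5 * hsq (fun j k => Q i j k w) (blk i))))%:E <= 1)%E.
Proof.
move=> gN gI ur ub bd bS mQ Qs hQ; elim: r ur bS => [_ _|i r IH /=/andP[ir ur] bS].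
  under eq_integral do rewrite big_nil expR0.
  by rewrite integral_cst// mul1e probability_le1.
have bSr k j : k \in r -> j \in blk k -> ~ S j.
  by move=> kr; apply: bS; rewrite inE kr orbT.
apply: le_trans (IH ur bSr).
pose Z w := expR (\sum_(i <- r) (quad (fun j k => Q i j k w) (g^~ w) (blk i)
      - trq (fun j k => Q i j k w) (blk i)
      - 5 * hsq (fun j k => Q i j k w) (blk i))).
pose S' := S `|` [set j | exists2 k, k \in r & j \in blk k].
have SS' : S `<=` S' by move=> j; left.
have mQ' i' j k : smeas g S' (Q i' j k) by exact: smeasS (mQ i' j k).
have mZ : smeas g S' Z.
  apply: smeas_comp; first exact: measurable_expR.
  apply: smeas_sum => k kr; apply: smeasB; first apply: smeasB.
  - by apply: smeas_quad => // j jk; apply: smeas_coord; right; exists k.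
  - exact: smeas_trq.
  - by apply: smeasM; [exact: smeas_cst|exact: smeas_hsq].
have := @chaos _ _ _ P J g gN gI (blk i) S' (Q i) Z (ub i).
have nS j : j \in blk i -> ~ S' j.
  move=> ji [/(bS i j (mem_head _ _) ji)//|[k kr jk]].
  by move: ir; rewrite (bd i k j ji jk) kr.
move=> /(_ nS (mQ' i) (Qs i) (hQ i) mZ (fun w => expR_ge0 _)).
apply: le_trans; rewrite le_eqVlt; apply/orP; left; apply/eqP.
by apply: eq_integral => w _; rewrite big_cons expRD mulrC.
Qed.

(** [y] is a sample of [n] independent centred Gaussian vectors, the covariance
matrix of the [i]-th one being [V i]. *)
Definition gauss_sample n L (y : 'I_n -> 'I_L -> T -> R) (V : 'I_n -> 'M[R]_L) : Prop :=
  exists M (g : 'I_n * 'I_M -> T -> R) (B : 'I_n -> 'M[R]_(L, M)),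
  [/\ forall j, gaussian P 0 1 (g j),
      mutually_independent P (fun j => sigma_gen setT (fun _ : unit => g j)),
      forall i k w, y i k w = \sum_a B i k a * g (i, a) w &
      forall i, V i = B i *m (B i)^T].

Definition obs n L (y : 'I_n -> 'I_L -> T -> R) i w : 'rV[R]_L := \row_k y i k w.

Definition hide_in n L (I2 : {pred 'I_n}) (y : 'I_n -> 'I_L -> T -> R) w :
    'I_n * 'I_L -> R :=
  fun ik => if ik.1 \in I2 then 0 else y ik.1 ik.2 w.

(** In the coordinates [g] the sum is a centred quadratic form, with one block for
each observation in [I2] and coefficients that only depend on the others; the
squared norm of a block is at most [(2 tau S)^2]. *)
Lemma gauss_sample_exp n L (y : 'I_n -> 'I_L -> T -> R) V (I2 : {pred 'I_n})
    (phi : ('I_n * 'I_L -> R) -> 'M[R]_L) (S tau : R) :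
  gauss_sample y V -> 0 <= S -> (forall i, psd ((2 * S) *: 1%:M - V i)) ->
  (forall k k', seqcont (fun u => phi u k k')) ->
  (forall u, (phi u)^T = phi u) -> (forall u, fnorm2 (phi u) <= 1) ->
  `|tau| * (2 * S) <= 8^-1 ->
  (\int[P]_w (expR (\sum_(i in I2) tau *
     (qform (phi (hide_in I2 y w)) (obs y i w)
      - fdot (phi (hide_in I2 y w)) (V i))))%:E
   <= (expR (20 * (tau * S) ^+ 2 * #|I2|%:R))%:E)%E.
Proof.
move=> [M [g [B [gN gI yE VE]]]] S0 VS cphi phiT phi1 tauS.
pose S1 := [set j : 'I_n * 'I_M | j.1 \notin I2].
pose D w := phi (hide_in I2 y w).
pose Q i (j k : 'I_n * 'I_M) w := tau * ((B i)^T *m D w *m B i) j.2 k.2.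
pose blk (i : 'I_n) := [seq (i, a) | a <- enum 'I_M].
have mD k k' : smeas g S1 (fun w => D w k k').
  apply: (@smeas_seqcont _ _ g S1 (fun ik w => hide_in I2 y w ik)
    (fun u => phi u k k')) => // -[i l].
  have -> : (hide_in I2 y)^~ (i, l) = if i \in I2 then fun=> 0 else y i l.
    by apply/funext => w; rewrite /hide_in/=; case: ifP.
  case: ifPn => [_|iI2]; first exact: smeas_cst.
  have -> : y i l = fun w => \sum_a B i l a * g (i, a) w by apply/funext => w.
  apply: smeas_sum => a _.
  by apply: smeasM; [exact: smeas_cst|exact: smeas_coord].
have mQ i j k : smeas g S1 (Q i j k).
  apply: smeasM; first exact: smeas_cst.
  under eq_fun do rewrite mxE; apply: smeas_sum => a _.
  apply: smeasM; last exact: smeas_cst.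
  under eq_fun do rewrite mxE; apply: smeas_sum => b _.
  by apply: smeasM; first exact: smeas_cst.
have GT w i : ((B i)^T *m D w *m B i)^T = (B i)^T *m D w *m B i.
  by rewrite !trmx_mul trmxK phiT mulmxA.
have sumblk (i : 'I_n) (F : 'I_n * 'I_M -> R) :
  \sum_(j <- blk i) F j = \sum_a F (i, a).
  by rewrite big_map big_enum.
have quadE i w : quad (fun j k => Q i j k w) (g^~ w) (blk i) =
    tau * qform (D w) (obs y i w).
  pose gv : 'rV[R]_M := \row_a g (i, a) w.
  have oE : obs y i w = gv *m (B i)^T.
    apply/rowP => k; rewrite !mxE yE; apply: eq_bigr => a _.
    by rewrite !mxE mulrC.
  have -> : qform (D w) (obs y i w) = qform ((B i)^T *m D w *m B i) gv.
    by rewrite /qform /bform oE !trmx_mul trmxK !mulmxA.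
  rewrite qform_fdot fdotE mulr_sumr /quad sumblk; apply: eq_bigr => a _.
  rewrite mulr_sumr sumblk; apply: eq_bigr => b _.
  rewrite /Q/= [(gv^T *m gv) a b]mxE big_ord_recl big_ord0 addr0 !mxE; ring.
have trE i w : trq (fun j k => Q i j k w) (blk i) = tau * fdot (D w) (V i).
  rewrite /trq sumblk -mulr_sumr; congr (_ * _).
  by rewrite VE -fdot_mulr /fdot mxtrace_mulC mulmxA.
have hE i w : hsq (fun j k => Q i j k w) (blk i) <= (tau * (2 * S)) ^+ 2.
  have -> : hsq (fun j k => Q i j k w) (blk i) =
      tau ^+ 2 * fnorm2 ((B i)^T *m (D w *m B i)).
    rewrite /hsq sumblk fnorm2E mulr_sumr; apply: eq_bigr => a _.
    rewrite sumblk mulr_sumr; apply: eq_bigr => b _.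
    by rewrite /Q mulmxA exprMn.
  rewrite exprMn ler_wpM2l ?sqr_ge0//.
  have VSi : psd ((2 * S) *: 1%:M - B i *m (B i)^T) by rewrite -VE.
  apply: (le_trans (fnorm2_mull_le _ VSi)).
  rewrite expr2 ler_wpM2l ?mulr_ge0//.
  rewrite -fnorm2_tr trmx_mul (le_trans (fnorm2_mull_le _ VSi))//.
  by rewrite fnorm2_tr ler_piMr ?mulr_ge0// phi1.
have hE8 i w : hsq (fun j k => Q i j k w) (blk i) <= 64^-1.
  apply: (le_trans (hE i w)); rewrite -real_normK ?num_real//.
  have -> : 64^-1 = 8^-1 ^+ 2 :> R by rewrite exprVn -natrX.
  rewrite lerXn2r ?nnegrE ?invr_ge0//.
  by rewrite normrM (ger0_norm (mulr_ge0 _ S0)).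
have Qs i j k w : Q i j k w = Q i k j w.
  by rewrite /Q -[in LHS]GT mxE.
have bE i (j : 'I_n * 'I_M) : j \in blk i -> j.1 = i by move=> /mapP[a _ ->].
have := @chaos_blocks _ _ g blk S1 Q (enum I2) gN gI (enum_uniq _).
have ub i : uniq (blk i) by rewrite map_inj_uniq ?enum_uniq// => a b [].
have bd i k j : j \in blk i -> j \in blk k -> i = k by move=> /bE <- /bE <-.
have bS i j : i \in enum I2 -> j \in blk i -> ~ S1 j.
  by rewrite mem_enum => iI2 /bE ji; rewrite /S1/= ji iI2.
move=> /(_ ub bd bS mQ Qs hE8) le1.
pose X w := \sum_(i <- enum I2) (quad (fun j k => Q i j k w) (g^~ w) (blk i)
      - trq (fun j k => Q i j k w) (blk i)
      - 5 * hsq (fun j k => Q i j k w) (blk i)).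
set C := expR (20 * _ * _).
have mX : measurable_fun setT X.
  apply: (@smeas_measurable _ _ _ P _ _ gN setT); apply: smeas_sum => k _.
  have mQT j l : smeas g setT (Q k j l) by exact: smeasS (mQ k j l).
  apply: smeasB; first apply: smeasB.
  - by apply: smeas_quad => // j _; exact: smeas_coord.
  - exact: smeas_trq.
  - by apply: smeasM; [exact: smeas_cst|exact: smeas_hsq].
have C0 : 0 <= C by exact: expR_ge0.
apply: (@le_trans _ _ (\int[P]_w (C%:E * (expR (X w))%:E))%E); last first.
  rewrite ge0_integralZl//.
  - by rewrite -[leRHS]mule1 lee_wpmul2l.
  - by apply/measurable_EFinP; exact: measurableT_comp.
have XE w : \sum_(i in I2) tau * (qform (phi (hide_in I2 y w)) (obs y i w)
      - fdot (phi (hide_in I2 y w)) (V i)) =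
    X w + \sum_(i <- enum I2) 5 * hsq (fun j k => Q i j k w) (blk i).
  rewrite /X -big_split/= big_enum/=; apply: eq_bigr => i _.
  by rewrite subrK quadE trE -mulrBr.
apply: ge0_le_integral => //.
- apply/measurable_EFinP; apply: measurableT_comp => //.
  under eq_fun do rewrite XE.
  apply: measurable_funD => //.
  apply: (@smeas_measurable _ _ _ P _ _ gN setT); apply: smeas_sum => k _.
  have mQT j l : smeas g setT (Q k j l) by exact: smeasS (mQ k j l).
  by apply: smeasM; [exact: smeas_cst|exact: smeas_hsq].
- apply: measurable_funeM; apply/measurable_EFinP; exact: measurableT_comp.
move=> w _; rewrite -EFinM lee_fin XE addrC expRD ler_wpM2r ?expR_ge0// ler_expR.
rewrite big_enum/=.
apply: (@le_trans _ _ (\sum_(i in I2) 20 * (tau * S) ^+ 2)).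
  apply: ler_sum => i _; have := hE i w; rewrite !exprMn; nra.
by rewrite sumr_const mulr_natr.
Qed.

End GaussianSample.

(** * Passing to mean-square limits *)

Section Limits.
Context {R : realType} {d : measure_display} {T : measurableType d}.
Variable P : probability T R.

Lemma nneseries_term_cvg (u : R^nat) : (forall k, 0 <= u k) ->
  (\sum_(k <oo) (u k)%:E < +oo)%E -> u @ \oo --> 0.
Proof.
move=> u0 su.
have tail := @nneseries_tail_cvg R (EFin \o u) xpredT su (fun k _ => u0 k).
have : (EFin \o u) @ \oo --> 0%E.
  apply: (@squeeze_cvge _ _ _ _ (fun=> 0%E) _ _ _ 0%E _ tail); last exact: cvg_cst.
  apply: nearW => k; rewrite /= lee_fin u0/=.
  have := @nneseries_lim_ge R (EFin \o u) xpredT k k.+1 (fun n _ _ => u0 n).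
  by rewrite big_nat1.
by move=> /fine_cvg.
Qed.

(** Along a subsequence with summable integrals the sum is integrable, hence
almost everywhere finite. *)
Lemma L1_ae_subseq (Z : nat -> T -> R) :
  (forall N, measurable_fun setT (Z N)) -> (forall N w, 0 <= Z N w) ->
  (\int[P]_w (Z N w)%:E)%E @[N --> \oo] --> 0%E ->
  exists2 nu : nat -> nat, (forall k, (k <= nu k)%N) &
    {ae P, forall w, Z (nu k) w @[k --> \oo] --> 0}.
Proof.
move=> mZ Z0 cZ.
have ex k : exists N, (k <= N)%N /\
    (\int[P]_w (Z N w)%:E <= (1 / (2 ^ k.+1)%:R)%:E)%E.
  have : \forall N \near \oo, (\int[P]_w (Z N w)%:E < (1 / (2 ^ k.+1)%:R)%:E)%E.
    apply: (cZ [set y | (y < (1 / (2 ^ k.+1)%:R)%:E)%E]); apply: open_ereal_lt'.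
    by rewrite lte_fin divr_gt0// ltr0n expn_gt0.
  move=> [N0 _ hN0]; exists (maxn k N0); split; first exact: leq_maxl.
  by apply: ltW; apply: hN0; rewrite /= leq_maxr.
have [nu hnu] := choice ex.
exists nu => [k|]; first by case: (hnu k).
pose F w := (\sum_(k <oo) (Z (nu k) w)%:E)%E.
have mZE k : measurable_fun setT (fun w => (Z (nu k) w)%:E) by exact/measurable_EFinP.
have F0 w : (0 <= F w)%E by apply: nneseries_ge0 => k _ _; rewrite lee_fin.
have mF : measurable_fun setT F.
  by apply: (@ge0_emeasurable_sum _ _ _ setT (fun k w => (Z (nu k) w)%:E) xpredT) => // k w _ _;
    rewrite lee_fin.
have intF : (\int[P]_w F w < +oo)%E.
  rewrite /F (@integral_nneseries _ _ _ P setT measurableT (fun k w => (Z (nu k) w)%:E))//; last first.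
    by move=> k w _; rewrite lee_fin.
  apply: (@le_lt_trans _ _ 1%:E); last exact: ltry.
  apply: le_trans (@epsilon_trick0 R 1 xpredT ler01).
  apply: lee_nneseries => k _; last by case: (hnu k).
  by move=> _; apply: integral_ge0 => w _; rewrite lee_fin.
have iF : P.-integrable setT F.
  apply/integrableP; split=> //.
  by under eq_integral do rewrite (gee0_abs (F0 _)).
have := integrable_ae measurableT iF.
apply: filterS => w /(_ I) Fw; apply: nneseries_term_cvg => //.
by rewrite ltey_eq; apply/orP; left.
Qed.

Lemma cvg_sum_fun (I : Type) (r : seq I) (f : I -> nat -> R) (l : I -> R) :
  (forall i, f i @ \oo --> l i) ->
  (fun m => \sum_(i <- r) f i m) @ \oo --> \sum_(i <- r) l i.
Proof.
move=> cf; elim: r => [|i r IH].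
  by under eq_fun do rewrite big_nil; rewrite big_nil; exact: cvg_cst.
by under eq_fun do rewrite big_cons; rewrite big_cons; apply: cvgD.
Qed.

(** Fatou's lemma; the bound for the approximating samples only asks that their
covariances be eventually below [2 S]. *)
Lemma gauss_limit_exp n L (y_ : nat -> 'I_n -> 'I_L -> T -> R)
    (V_ : nat -> 'I_n -> 'M[R]_L) (Y : 'I_n -> 'I_L -> T -> R)
    (V : 'I_n -> 'M[R]_L) (I2 : {pred 'I_n})
    (phi : ('I_n * 'I_L -> R) -> 'M[R]_L) (S tau : R) :
  (forall N, gauss_sample P (y_ N) (V_ N)) ->
  (forall i k k', V_ N i k k' @[N --> \oo] --> V i k k') ->
  (forall i k, measurable_fun setT (Y i k)) ->
  {ae P, forall w, forall i k, y_ N i k w @[N --> \oo] --> Y i k w} ->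
  0 < S -> (forall i, psd (S *: 1%:M - V i)) ->
  (forall k k', seqcont (fun u => phi u k k')) ->
  (forall u, (phi u)^T = phi u) -> (forall u, fnorm2 (phi u) <= 1) ->
  `|tau| * (2 * S) <= 8^-1 ->
  (\int[P]_w (expR (\sum_(i in I2) tau *
     (qform (phi (hide_in I2 Y w)) (obs Y i w)
      - fdot (phi (hide_in I2 Y w)) (V i))))%:E
   <= (expR (20 * (tau * S) ^+ 2 * #|I2|%:R))%:E)%E.
Proof.
move=> gs cV mY cY S0 VS cphi phiT phi1 tauS.
set C := (expR _)%:E.
pose F (y : 'I_n -> 'I_L -> T -> R) (U : 'I_n -> 'M[R]_L) w := expR (\sum_(i in I2) tau *
     (qform (phi (hide_in I2 y w)) (obs y i w) - fdot (phi (hide_in I2 y w)) (U i))).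
have qE (D : 'M[R]_L) (y : 'I_n -> 'I_L -> T -> R) i w :
    qform D (obs y i w) = \sum_k \sum_k' D k k' * (y i k w * y i k' w).
  rewrite qform_fdot fdotE; do 2!(apply: eq_bigr => ? _).
  by rewrite !mxE big_ord_recl big_ord0 addr0 !mxE.
have mF y U : (forall i k, measurable_fun setT (y i k)) -> measurable_fun setT (F y U).
  move=> my; have mD k k' : measurable_fun setT (fun w => phi (hide_in I2 y w) k k').
    apply: (@seqcont_measurable R _ T _ (fun ik w => hide_in I2 y w ik)
      (fun u => phi u k k')) => // -[i l].
    have -> : (hide_in I2 y)^~ (i, l) = if i \in I2 then fun=> 0 else y i l.
      by apply/funext => w; rewrite /hide_in/=; case: ifP.
    by case: ifP.
  pose X i w := tau * (qform (phi (hide_in I2 y w)) (obs y i w) -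
    fdot (phi (hide_in I2 y w)) (U i)).
  have mX i : measurable_fun setT (X i).
    apply: measurable_funM => //; apply: measurable_funB.
      rewrite (_ : (fun w => _) = (fun w => \sum_k \sum_k'
        phi (hide_in I2 y w) k k' * (y i k w * y i k' w))); last first.
        by apply/funext => w; rewrite qE.
      do 2!(apply: measurable_sum => ?).
      by apply: measurable_funM => //; exact: measurable_funM.
    rewrite (_ : (fun w => _) = (fun w => \sum_k \sum_k'
        phi (hide_in I2 y w) k k' * U i k k')); last first.
      by apply/funext => w; rewrite fdotE.
    by do 2!(apply: measurable_sum => ?); exact: measurable_funM.
  apply: (@measurableT_comp _ _ _ _ _ _ expR) => //.
  rewrite (_ : (fun w => _) = (fun w => \sum_i if i \in I2 then X i w else 0)).
    by apply: measurable_sum => i; case: (i \in I2).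
  by apply/funext => w; rewrite big_mkcond.
have my_ N i k : measurable_fun setT (y_ N i k).
  have [M [g [B [gN _ yE _]]]] := gs N.
  have -> : y_ N i k = fun w => \sum_a B i k a * g (i, a) w by apply/funext => w.
  apply: measurable_sum => a; apply: measurable_funM => //.
  by case: (gN (i, a)).
have cF : {ae P, forall w, (F (y_ N) (V_ N) w)%:E @[N --> \oo] --> (F Y V w)%:E}.
  apply: filterS cY => w cw.
  have cD k k' : phi (hide_in I2 (y_ N) w) k k' @[N --> \oo] --> phi (hide_in I2 Y w) k k'.
    apply: (cphi k k' (fun N => hide_in I2 (y_ N) w)) => -[i l].
    by rewrite /hide_in/=; case: ifP => _; [exact: cvg_cst|exact: cw].
  apply: cvg_EFin; first exact: nearW.
  suff cX : (fun N => \sum_(i in I2) tau *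
     (qform (phi (hide_in I2 (y_ N) w)) (obs (y_ N) i w)
      - fdot (phi (hide_in I2 (y_ N) w)) (V_ N i))) @ \oo -->
      \sum_(i in I2) tau * (qform (phi (hide_in I2 Y w)) (obs Y i w)
      - fdot (phi (hide_in I2 Y w)) (V i)).
    exact: (cvg_comp _ _ cX (@continuous_expR R _)).
  rewrite big_mkcond/= [X in X @ _](_ : _ = (fun N => \sum_i if i \in I2 then tau *
     (qform (phi (hide_in I2 (y_ N) w)) (obs (y_ N) i w)
      - fdot (phi (hide_in I2 (y_ N) w)) (V_ N i)) else 0)); last first.
    by apply/funext => N; rewrite big_mkcond.
  apply: cvg_sum_fun => i; case: (i \in I2); last exact: cvg_cst.
  apply: cvgM; first exact: cvg_cst.
  apply: cvgB.
    rewrite qE [X in X @ _](_ : _ = (fun N => \sum_k \sum_k'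
        phi (hide_in I2 (y_ N) w) k k' * (y_ N i k w * y_ N i k' w))); last first.
      by apply/funext => N; rewrite qE.
    by do 2!(apply: cvg_sum_fun => ?); apply: cvgM => //; apply: cvgM; exact: cw.
  rewrite fdotE [X in X @ _](_ : _ = (fun N => \sum_k \sum_k'
        phi (hide_in I2 (y_ N) w) k k' * V_ N i k k')); last first.
    by apply/funext => N; rewrite fdotE.
  by do 2!(apply: cvg_sum_fun => ?); apply: cvgM.
(* The covariances converge entrywise, so [V_ N <= V + S <= 2 S] eventually. *)
have VS2 : \forall N \near \oo, forall i, psd ((2 * S) *: 1%:M - V_ N i).
  have : (fun N => \sum_i fnorm2 (V_ N i - V i)) @ \oo --> \sum_(i < n) 0.
    apply: cvg_sum_fun => i; rewrite -[X in _ --> X](_ : \sum_(k < L) \sum_(k' < L) 0 = 0).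
      rewrite [X in X @ _](_ : _ = (fun N => \sum_k \sum_k'
          (V_ N i k k' - V i k k') * (V_ N i k k' - V i k k'))); last first.
        apply/funext => N; rewrite fnorm2E; do 2!(apply: eq_bigr => ? _).
        by rewrite !mxE expr2.
      apply: cvg_sum_fun => k; apply: cvg_sum_fun => k'.
      rewrite -[X in _ --> X](mulr0 0).
      have c0 : V_ N i k k' - V i k k' @[N --> \oo] --> 0.
        by rewrite -[X in _ --> X](subrr (V i k k')); apply: cvgB => //; exact: cvg_cst.
      exact: cvgM.
    by rewrite big1// => k _; rewrite big1.
  rewrite big1// => /cvgrPdist_le/(_ (S ^+ 2) (exprn_gt0 2 S0)) h.
  near=> N => i; have : `|0 - \sum_i fnorm2 (V_ N i - V i)| <= S ^+ 2 by near: N.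
  rewrite sub0r normrN ger0_norm; last by apply: sumr_ge0 => k _; exact: fnorm2_ge0.
  rewrite (bigD1 i)//= => hle.
  have {hle} : fnorm (V_ N i - V i) <= S.
    rewrite -(@ler_sqr _ (fnorm _)) ?nnegrE ?fnorm_ge0 ?(ltW S0)// sqr_fnorm.
    apply: le_trans hle; rewrite lerDl; apply: sumr_ge0 => k _; exact: fnorm2_ge0.
  move=> hle; split=> [|v].
    have [M [g [B [_ _ _ VE]]]] := gs N.
    by rewrite linearB/= scale_trmx trmx1 VE trmx_mul trmxK.
  have -> : qform ((2 * S) *: 1%:M - V_ N i) v =
     S * fnorm2 v + qform (S *: 1%:M - V i) v - qform (V_ N i - V i) v.
    rewrite !qform_fdot !fdotBl !fdotZl -!qform_fdot qform1; ring.
  have h1 := (VS i).2 v.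
  have h2 : qform (V_ N i - V i) v <= S * fnorm2 v.
    rewrite qform_fdot (le_trans (ler_norm _))// (le_trans (ler_fdot _ _))//.
    have -> : fnorm (v^T *m v) = fnorm2 v.
      by rewrite /fnorm /fnorm2 fdot_outer -expr2 sqrtr_sqr ger0_norm// fnorm2_ge0.
    by rewrite ler_wpM2r// fnorm2_ge0.
  by lra.
have bnd : \forall N \near \oo, (\int[P]_w (F (y_ N) (V_ N) w)%:E <= C)%E.
  apply: filterS VS2 => N VSN.
  exact: (gauss_sample_exp I2 (gs N) (ltW S0) VSN cphi phiT phi1 tauS).
have mFE N : measurable_fun setT (fun w => (F (y_ N) (V_ N) w)%:E).
  by apply/measurable_EFinP; exact: mF.
have fat := @fatou _ T R P setT measurableT (fun N w => (F (y_ N) (V_ N) w)%:E)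
  mFE (fun N w _ => expR_ge0 _).
 apply: (@le_trans _ _ (\int[P]_w limn_einf (fun N => (F (y_ N) (V_ N) w)%:E))%E).
  rewrite le_eqVlt; apply/orP; left; apply/eqP; apply: ae_eq_integral => //.
  - by apply/measurable_EFinP; exact: mF.
  - apply: (emeasurable_fun_cvg (fun m w => einfs (fun N => (F (y_ N) (V_ N) w)%:E) m)).
      by move=> m; apply: measurable_fun_einfs => N; apply/measurable_EFinP; exact: mF.
    by move=> w _; rewrite limn_einf_lim; exact: is_cvg_einfs.
  - by apply: filterS cF => w cFw _; rewrite (cvg_limn_einf_sup cFw).1.
apply: (le_trans fat); rewrite limn_einf_lim; apply: lime_le.
  exact: is_cvg_einfs.
apply: nearW => m; case: bnd => N0 _ hN0.
apply: (@le_trans _ _ (\int[P]_w (F (y_ (maxn m N0)) (V_ (maxn m N0)) w)%:E)%E).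
  by apply: ereal_inf_lbound; exists (maxn m N0) => //=; exact: leq_maxl.
by apply: hN0; rewrite /= leq_maxr.
Unshelve. all: by end_near.
Qed.

End Limits.

(** * Square-integrable functions *)

Section L2.
Context d (T : measurableType d) {R : realType}.
Variables (mu : {measure set T -> \bar R}) (D : set T).
Hypothesis mD : measurable D.
Implicit Types f g : T -> R.

Definition L2 f : Prop :=
  measurable_fun D f /\ mu.-integrable D (fun t => (f t ^+ 2)%:E).

Definition dot f g : R := \int[mu]_(t in D) (f t * g t).

Lemma L2_integrableM f g : L2 f -> L2 g -> mu.-integrable D (EFin \o (f \* g)).
Proof.
move=> [mf if2] [mg ig2].
have ifg := integrableD mD if2 ig2.
apply: (le_integrable mD _ _ ifg).
  by apply/measurable_EFinP; exact: measurable_funM.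
move=> x _; rewrite /= lee_fin normrM [leRHS]ger0_norm; last by rewrite addr_ge0 ?sqr_ge0.
rewrite -(real_normK (num_real (f x))) -(real_normK (num_real (g x))).
have := sqr_ge0 (`|f x| - `|g x|); have := sqr_ge0 (`|f x| + `|g x|).
rewrite !expr2; lra.
Qed.

Lemma L2D f g : L2 f -> L2 g -> L2 (fun t => f t + g t).
Proof.
move=> lf lg; split; first by apply: measurable_funD; [case: lf|case: lg].
have ifg := L2_integrableM lf lg; case: lf => mf if2; case: lg => mg ig2.
have := integrableD mD (integrableD mD if2 ig2) (integrableZl mD 2 ifg).
apply: eq_integrable => // x _; rewrite /= -EFinM -!EFinD; congr EFin; ring.
Qed.

Lemma L2Z c f : L2 f -> L2 (fun t => c * f t).
Proof.
move=> [mf if2]; split; first exact: measurable_funM.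
have := integrableZl mD (c ^+ 2) if2.
by apply: eq_integrable => // x _; rewrite /= -EFinM exprMn.
Qed.

Lemma L2_0 : L2 (fun=> 0).
Proof.
split=> //; under eq_fun do rewrite expr0n; exact: integrable0.
Qed.

Lemma L2B f g : L2 f -> L2 g -> L2 (fun t => f t - g t).
Proof.
move=> lf lg; have := L2D lf (L2Z (- 1) lg).
by under eq_fun do rewrite mulN1r.
Qed.

Lemma L2_sum (I : eqType) (r : seq I) (F : I -> T -> R) :
  (forall i, i \in r -> L2 (F i)) -> L2 (fun t => \sum_(i <- r) F i t).
Proof.
elim: r => [|a r IH] h.
  by under eq_fun do rewrite big_nil; exact: L2_0.
under eq_fun do rewrite big_cons; apply: L2D; first by apply: h; exact: mem_head.
by apply: IH => i ir; apply: h; rewrite inE ir orbT.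
Qed.

Lemma L2_comb (I : finType) (c : I -> R) (F : I -> T -> R) :
  (forall i, L2 (F i)) -> L2 (fun t => \sum_i c i * F i t).
Proof. by move=> LF; apply: L2_sum => i _; exact: L2Z. Qed.

Lemma dotC f g : dot f g = dot g f.
Proof. by apply: eq_Rintegral => x _; rewrite mulrC. Qed.

Lemma dotDl f g h : L2 f -> L2 g -> L2 h ->
  dot (fun t => f t + g t) h = dot f h + dot g h.
Proof.
move=> lf lg lh; rewrite /dot -RintegralD//; try exact: L2_integrableM.
by apply: eq_Rintegral => x _; rewrite mulrDl.
Qed.

Lemma dotZl c f g : L2 f -> L2 g -> dot (fun t => c * f t) g = c * dot f g.
Proof.
move=> lf lg; rewrite /dot -RintegralZl//; last exact: L2_integrableM.
by apply: eq_Rintegral => x _; rewrite mulrA.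
Qed.

Lemma dotBl f g h : L2 f -> L2 g -> L2 h ->
  dot (fun t => f t - g t) h = dot f h - dot g h.
Proof.
move=> lf lg lh; rewrite /dot -RintegralB//; try exact: L2_integrableM.
by apply: eq_Rintegral => x _; rewrite mulrBl.
Qed.

Lemma dotBr f g h : L2 f -> L2 g -> L2 h ->
  dot h (fun t => f t - g t) = dot h f - dot h g.
Proof. by move=> lf lg lh; rewrite !(dotC h) dotBl. Qed.

Lemma dot0l g : dot (fun=> 0) g = 0.
Proof.
rewrite /dot; under eq_Rintegral do rewrite mul0r.
by rewrite /Rintegral integral0.
Qed.

Lemma dot_suml (I : eqType) (r : seq I) (F : I -> T -> R) g :
  (forall i, i \in r -> L2 (F i)) -> L2 g ->
  dot (fun t => \sum_(i <- r) F i t) g = \sum_(i <- r) dot (F i) g.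
Proof.
move=> + lg; elim: r => [|a r IH] h.
  by under eq_fun do rewrite big_nil; rewrite dot0l big_nil.
have hr i : i \in r -> L2 (F i) by move=> ir; apply: h; rewrite inE ir orbT.
under eq_fun do rewrite big_cons.
rewrite dotDl ?big_cons ?IH//; last exact: L2_sum.
by apply: h; exact: mem_head.
Qed.

Lemma dot_combl (I : finType) (c : I -> R) (F : I -> T -> R) g :
  (forall i, L2 (F i)) -> L2 g ->
  dot (fun t => \sum_i c i * F i t) g = \sum_i c i * dot (F i) g.
Proof.
move=> LF Lg; rewrite dot_suml// => [|i _]; last exact: L2Z.
by apply: eq_bigr => i _; rewrite dotZl.
Qed.

Lemma dot_ge0 f : 0 <= dot f f.
Proof. by apply: Rintegral_ge0 => x _; rewrite -expr2 sqr_ge0. Qed.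

Lemma dot_CS f g : L2 f -> L2 g -> dot f g ^+ 2 <= dot f f * dot g g.
Proof.
move=> lf lg; apply: discr_le0; rewrite ?dot_ge0// => t.
have := dot_ge0 (fun x => f x - t * g x).
have ltg := L2Z t lg.
rewrite dotBl ?dotBr//; try exact: L2B.
rewrite ![dot f (fun x => t * g x)]dotC !dotZl// (dotC g (fun x => t * g x)) dotZl//.
rewrite (dotC g f); congr (_ <= _); ring.
Qed.

Lemma dot_ae f g h : measurable_fun D f -> measurable_fun D g -> measurable_fun D h ->
  {ae mu, forall x, D x -> f x = g x} -> dot f h = dot g h.
Proof.
move=> mf mg mh fg; congr fine; apply: ae_eq_integral => //.
- by apply/measurable_EFinP; exact: measurable_funM.
- by apply/measurable_EFinP; exact: measurable_funM.
- by apply: filterS fg => x fgx Dx; rewrite fgx.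
Qed.

Lemma L2_ae f g : measurable_fun D g -> {ae mu, forall x, D x -> f x = g x} ->
  L2 f -> L2 g.
Proof.
move=> mg fg [mf /integrableP[_ if2]]; split=> //; apply/integrableP; split.
  by apply/measurable_EFinP; exact: measurable_funX.
rewrite (le_lt_trans _ if2)// le_eqVlt; apply/orP; left; apply/eqP.
apply: ae_eq_integral => //.
- by apply: measurableT_comp => //; apply/measurable_EFinP; exact: measurable_funX.
- by apply: measurableT_comp => //; apply/measurable_EFinP; exact: measurable_funX.
- by apply: filterS fg => x fgx Dx; rewrite fgx.
Qed.

End L2.

(** * Tensor products on the unit square *)

Section Tensor.
Context {R : realType}.
Notation leb := (@leb1 R).
Notation UI := (@unitI R).
Implicit Types f g h : R -> R.

Lemma measurable_unitI : measurable (UI : set (measurableTypeR R)).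
Proof. exact: measurable_itv. Qed.

Lemma measurable_unitSq :
  measurable (@unitSq R : set (measurableTypeR R * measurableTypeR R)).
Proof. by apply: measurableX; exact: measurable_unitI. Qed.


Lemma isL2W f : isL2 f -> L2 leb UI f. Proof. by []. Qed.

Lemma isL2sqW F : isL2sq F -> L2 (@leb2 R) (@unitSq R) F. Proof. by []. Qed.

Lemma tensor_patch f g : (tensor f g) \_ (@unitSq R) = tensor (f \_ UI) (g \_ UI).
Proof.
apply/funext => -[x y]; rewrite /tensor !patchE/= /unitSq.
by rewrite in_setX; case: (x \in UI); case: (y \in UI) => //=; rewrite ?mulr0 ?mul0r.
Qed.

Lemma measurable_tensor f g : measurable_fun UI f -> measurable_fun UI g ->
  measurable_fun (@unitSq R) (tensor f g).
Proof.
have mI := measurable_unitI; have mS := measurable_unitSq.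
move=> /(measurable_restrictT _ mI) mf /(measurable_restrictT _ mI) mg.
apply/(measurable_restrictT _ mS); rewrite tensor_patch.
apply: measurable_funM.
  exact: (measurableT_comp mf measurable_fst).
exact: (measurableT_comp mg measurable_snd).
Qed.

(** Fubini on the restrictions to the unit interval extended by zero. *)
Lemma integral_tensor f g : leb.-integrable UI (EFin \o f) ->
  leb.-integrable UI (EFin \o g) ->
  (@leb2 R).-integrable (@unitSq R) (EFin \o tensor f g) /\
  \int[@leb2 R]_(z in @unitSq R) tensor f g z =
    \int[leb]_(t in UI) f t * \int[leb]_(t in UI) g t.
Proof.
move=> intf intg.
have mI := measurable_unitI; have mS := measurable_unitSq.
pose f' := f \_ UI; pose g' := g \_ UI.
have intf' : leb.-integrable setT (EFin \o f').
  by rewrite /f' -restrict_EFin; apply/integrable_restrict; rewrite ?setTI.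
have intg' : leb.-integrable setT (EFin \o g').
  by rewrite /g' -restrict_EFin; apply/integrable_restrict; rewrite ?setTI.
have mf' : measurable_fun setT f' by apply/measurable_EFinP; exact: measurable_int intf'.
have mg' : measurable_fun setT g' by apply/measurable_EFinP; exact: measurable_int intg'.
have tE := tensor_patch f g; rewrite -/f' -/g' in tE.
have mt : measurable_fun setT (tensor f' g').
  apply: measurable_funM.
    exact: (measurableT_comp mf' measurable_fst).
  exact: (measurableT_comp mg' measurable_snd).
have intt : (@leb2 R).-integrable setT (EFin \o tensor f' g').
  apply/integrableP; split; first exact/measurable_EFinP.
  have mabs : measurable_fun setT (fun z : R * R => `|(EFin \o tensor f' g') z|%E).
    by apply: measurableT_comp => //; exact/measurable_EFinP.
  rewrite (fubini_tonelli1 (m1 := leb) (m2 := leb) _ mabs)// /fubini_F/=.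
  have [_ If'] := integrableP _ _ _ intf'; have [_ Ig'] := integrableP _ _ _ intg'.
  rewrite [ltLHS](_ : _ = \int[leb]_x (`|(f' x)%:E| * \int[leb]_y `|(g' y)%:E|))%E; last first.
    apply: eq_integral => x _; rewrite -ge0_integralZl//.
    - by apply: eq_integral => y _; rewrite /tensor/= normrM EFinM.
    - by apply: measurableT_comp => //; exact/measurable_EFinP.
  rewrite ge0_integralZr//.
  - by rewrite lte_mul_pinfty// ?integral_ge0// ge0_fin_numE ?integral_ge0.
  - by apply: measurableT_comp => //; exact/measurable_EFinP.
  - by apply: integral_ge0.
split.
  have := intt; rewrite -tE => h.
  have : (@leb2 R).-integrable setT ((EFin \o tensor f g) \_ (@unitSq R)).
    by rewrite restrict_EFin.
  by move/integrable_restrict; rewrite setTI; apply.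
rewrite Rintegral_mkcond tE [in RHS]Rintegral_mkcond [X in _ * X]Rintegral_mkcond.
rewrite -/f' -/g' /Rintegral.
have -> : (\int[@leb2 R]_z (tensor f' g' z)%:E = \int[leb]_x \int[leb]_y (tensor f' g' (x, y))%:E)%E.
  by rewrite -(fubini1 intt).
have -> : (\int[leb]_x \int[leb]_y (tensor f' g' (x, y))%:E =
    \int[leb]_x ((f' x)%:E * \int[leb]_y (g' y)%:E))%E.
  apply: eq_integral => x _; rewrite -integralZl//.
have fing : (\int[leb]_y (g' y)%:E)%E \is a fin_num by exact: integrable_fin_num.
by rewrite -(fineK fing) integralZr// fineM// integrable_fin_num.
Qed.

Lemma isL2_tensor f g : isL2 f -> isL2 g -> isL2sq (tensor f g).
Proof.
move=> [mf if2] [mg ig2]; split.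
  exact: measurable_tensor.
have [h _] := integral_tensor if2 ig2.
by apply: eq_integrable h => //; [exact: measurable_unitSq|move=> z _; rewrite /= /tensor exprMn].
Qed.

Lemma ipsq_tensor f g f1 g1 : isL2 f -> isL2 g -> isL2 f1 -> isL2 g1 ->
  ipsq (tensor f g) (tensor f1 g1) = ip f f1 * ip g g1.
Proof.
move=> lf lg lf1 lg1.
have [_ <-] := integral_tensor
   (L2_integrableM measurable_unitI (isL2W lf) (isL2W lf1))
   (L2_integrableM measurable_unitI (isL2W lg) (isL2W lg1)).
by apply: eq_Rintegral => z _; rewrite /tensor/= mulrACA.
Qed.

End Tensor.

Section Inner.
Context {R : realType}.
Implicit Types f g h : R -> R.
Let mI := @measurable_unitI R.
Let mS := @measurable_unitSq R.

Lemma ipC f g : ip f g = ip g f.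
Proof. exact: dotC. Qed.

Lemma ip_ge0 f : 0 <= ip f f.
Proof. exact: dot_ge0. Qed.

Lemma ip_CS f g : isL2 f -> isL2 g -> ip f g ^+ 2 <= ip f f * ip g g.
Proof. exact: (dot_CS mI). Qed.

Lemma isL2B f g : isL2 f -> isL2 g -> isL2 (fun t => f t - g t).
Proof. exact: (L2B mI). Qed.

Lemma isL2_comb (I : finType) (c : I -> R) (F : I -> R -> R) :
  (forall i, isL2 (F i)) -> isL2 (fun t => \sum_i c i * F i t).
Proof. exact: (L2_comb mI). Qed.

Lemma ip_combl (I : finType) (c : I -> R) (F : I -> R -> R) g :
  (forall i, isL2 (F i)) -> isL2 g ->
  ip (fun t => \sum_i c i * F i t) g = \sum_i c i * ip (F i) g.
Proof. exact: (dot_combl mI). Qed.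

Lemma ipBl f g h : isL2 f -> isL2 g -> isL2 h ->
  ip (fun t => f t - g t) h = ip f h - ip g h.
Proof. exact: (dotBl mI). Qed.

Lemma sqr_norm2 f : norm2 f ^+ 2 = ip f f.
Proof. by rewrite sqr_sqrtr// ip_ge0. Qed.

Lemma ip_le_norm2 f g : isL2 f -> isL2 g -> `|ip f g| <= norm2 f * norm2 g.
Proof.
by move=> lf lg; rewrite -sqrtr_sqr -sqrtrM ?ip_ge0// ler_wsqrtr// ip_CS.
Qed.

Lemma isL2sq_comb (I : finType) (c : I -> R) (F : I -> R * R -> R) :
  (forall i, isL2sq (F i)) -> isL2sq (fun t => \sum_i c i * F i t).
Proof. exact: (L2_comb mS). Qed.

Lemma isL2sqB F G : isL2sq F -> isL2sq G -> @isL2sq R (fun t => F t - G t).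
Proof. exact: (L2B mS). Qed.

Lemma ipsqC F G : @ipsq R F G = ipsq G F.
Proof. exact: dotC. Qed.

Lemma ipsqBl F G H : isL2sq F -> isL2sq G -> isL2sq H ->
  @ipsq R (fun t => F t - G t) H = ipsq F H - ipsq G H.
Proof. exact: (dotBl mS). Qed.

Lemma ipsq_combl (I : finType) (c : I -> R) (F : I -> R * R -> R) G :
  (forall i, isL2sq (F i)) -> isL2sq G ->
  ipsq (fun t => \sum_i c i * F i t) G = \sum_i c i * ipsq (F i) G.
Proof. exact: (dot_combl mS). Qed.

Lemma sqr_normsq2 F : @normsq2 R F ^+ 2 = ipsq F F.
Proof. by rewrite sqr_sqrtr// dot_ge0. Qed.

Lemma ipsq_ae F G H : isL2sq F -> isL2sq G -> isL2sq H -> eqsq F G ->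
  @ipsq R F H = ipsq G H.
Proof. by move=> [mF _] [mG _] [mH _] FG; exact: (dot_ae mS). Qed.

End Inner.

(** * Kernels as matrices of coefficients *)

Section KernelCoefficients.
Context {R : realType}.
Variable e : nat -> R -> R.
Hypothesis oe : Defs.orthonormal e.

Let Le k : isL2 (e k). Proof. by case: oe. Qed.
Let ee j k : ip (e j) (e k) = (j == k)%:R. Proof. by case: oe. Qed.

Lemma ker_of_mxE l (A : 'M[R]_l) :
  ker_of_mx e A = fun z => \sum_(p : 'I_l * 'I_l) A p.1 p.2 * tensor (e p.1) (e p.2) z.
Proof. by apply/funext => z; rewrite /ker_of_mx pair_bigA. Qed.

Lemma isL2sq_ker l (A : 'M[R]_l) : isL2sq (ker_of_mx e A).
Proof. by rewrite ker_of_mxE; apply: isL2sq_comb => p; exact: isL2_tensor. Qed.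

Lemma ipsq_ker_tensor l (A : 'M[R]_l) f g : isL2 f -> isL2 g ->
  ipsq (ker_of_mx e A) (tensor f g) = \sum_j \sum_k A j k * (ip f (e j) * ip g (e k)).
Proof.
move=> lf lg; rewrite ker_of_mxE ipsq_combl; last 2 first.
- by move=> p; exact: isL2_tensor.
- exact: isL2_tensor.
rewrite pair_bigA; apply: eq_bigr => p _.
by rewrite ipsq_tensor// !(ipC (e _)).
Qed.

Lemma ipsq_ker l (A B : 'M[R]_l) : ipsq (ker_of_mx e A) (ker_of_mx e B) = fdot A B.
Proof.
rewrite ipsqC [ker_of_mx e B]ker_of_mxE ipsq_combl; last 2 first.
- by move=> p; exact: isL2_tensor.
- exact: isL2sq_ker.
rewrite fdotE pair_bigA; apply: eq_bigr => -[j k] _ /=.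
rewrite ipsqC ipsq_ker_tensor// (bigD1 j)//= (bigD1 k)//= !ee !eqxx !mulr1.
rewrite big1 => [|k' k'k]; last first.
  by rewrite ee (_ : _ == _ = false) ?mulr0// eq_sym; exact/negbTE.
rewrite big1 => [|j' j'j]; last first.
  rewrite big1// => k' _; rewrite ee (_ : _ == _ = false) ?mul0r ?mulr0//.
  by rewrite eq_sym; exact/negbTE.
by rewrite !addr0 mulrC.
Qed.

Lemma ker_of_mxB l (A B : 'M[R]_l) z :
  ker_of_mx e (A - B) z = ker_of_mx e A z - ker_of_mx e B z.
Proof.
rewrite /ker_of_mx -sumrB; apply: eq_bigr => j _.
by rewrite -sumrB; apply: eq_bigr => k _; rewrite !mxE mulrBl.
Qed.

Lemma ker_of_mxZ l c (A : 'M[R]_l) z : ker_of_mx e (c *: A) z = c * ker_of_mx e A z.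
Proof.
rewrite /ker_of_mx mulr_sumr; apply: eq_bigr => j _.
by rewrite mulr_sumr; apply: eq_bigr => k _; rewrite !mxE mulrA.
Qed.

Lemma ker_of_mx_sum l (I : finType) (Q : pred I) (A : I -> 'M[R]_l) z :
  ker_of_mx e (\sum_(i | Q i) A i) z = \sum_(i | Q i) ker_of_mx e (A i) z.
Proof.
rewrite /ker_of_mx [RHS]exchange_big/=; apply: eq_bigr => j _.
rewrite [RHS]exchange_big/=; apply: eq_bigr => k _.
by rewrite summxE mulr_suml.
Qed.

Lemma ker_of_mx_outer l (u : 'rV[R]_l) z :
  ker_of_mx e (u^T *m u) z =
  tensor (fun t => \sum_(k < l) u 0 k * e k t) (fun t => \sum_(k < l) u 0 k * e k t) z.
Proof.
rewrite /ker_of_mx /tensor mulr_suml; apply: eq_bigr => j _.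
rewrite mulr_sumr; apply: eq_bigr => k _.
by rewrite !mxE big_ord_recl big_ord0 addr0 !mxE /tensor; ring.
Qed.

Lemma ker_of_mx1 l z : ker_of_mx e (1%:M : 'M[R]_l) z = Iker e l z.
Proof.
apply: eq_bigr => j _; rewrite (bigD1 j)//= mxE eqxx mul1r big1 ?addr0// => k kj.
by rewrite mxE eq_sym (negbTE kj) mul0r.
Qed.

(** ** Empirical covariances *)

Section Empirical.
Variable n : nat.
Implicit Type y : 'I_n -> nat -> R.

Definition yrow l y i : 'rV[R]_l := \row_k y i k.

Definition empmx l (Q : pred 'I_n) y : 'M[R]_l :=
  (2 / n%:R) *: \sum_(i | Q i) ((yrow l y i)^T *m yrow l y i).

Lemma ker_empmx l (Q : pred 'I_n) y z :
  ker_of_mx e (empmx l Q y) z =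
  2 / n%:R * \sum_(i | Q i) tensor (xdot e l y i) (xdot e l y i) z.
Proof.
rewrite ker_of_mxZ ker_of_mx_sum; congr (_ * _); apply: eq_bigr => i _.
rewrite ker_of_mx_outer; congr (_ * _); rewrite /xdot; apply: eq_bigr => k _;
  by rewrite mxE.
Qed.

Definition first_half : pred 'I_n := fun i => (i < n./2)%N.
Definition second_half : pred 'I_n := fun i => (n./2 <= i)%N.

Lemma ker_Rhalf l y sigma z :
  Rhalf e l y z - sigma ^+ 2 * Iker e l z =
  ker_of_mx e (empmx l first_half y - sigma ^+ 2 *: 1%:M) z.
Proof. by rewrite ker_of_mxB ker_of_mxZ ker_of_mx1 ker_empmx. Qed.

Lemma ker_Rtilde l y sigma z :
  Rtilde e l y z - sigma ^+ 2 * Iker e l z =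
  ker_of_mx e (empmx l second_half y - sigma ^+ 2 *: 1%:M) z.
Proof. by rewrite ker_of_mxB ker_of_mxZ ker_of_mx1 ker_empmx. Qed.

Lemma normsq2_ker l (A : 'M[R]_l) : normsq2 (ker_of_mx e A) ^+ 2 = fnorm2 A.
Proof. by rewrite sqr_normsq2 ipsq_ker. Qed.

Lemma nuclear_objectiveE sigma mu l y (A : 'M[R]_l) : psd A ->
  nuclear_objective e sigma mu y A =
  fnorm2 (empmx l first_half y - sigma ^+ 2 *: 1%:M - A) + mu * \tr A.
Proof.
move=> psdA; rewrite /nuclear_objective -normsq2_ker.
congr (normsq2 _ ^+ 2 + mu * _); last exact: nuclear_sum_trace.
by apply/funext => z; rewrite [RHS]ker_of_mxB -ker_Rhalf addrAC.
Qed.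

(** On the cone the nuclear norm is the trace, and the kernel norms are Frobenius
norms of coefficients. *)
Lemma nuclear_argmin_prox sigma mu l y (A : 'M[R]_l) :
  nuclear_argmin e sigma mu y A ->
  is_prox mu (empmx l first_half y - sigma ^+ 2 *: 1%:M) A.
Proof.
move=> [AT A0 minA]; have psdA : psd A by [].
split=> // B psdB; have := minA B psdB.1 psdB.2.
by rewrite !nuclear_objectiveE.
Qed.

Lemma aggregation_objectiveE sigma y (A : forall l, 'M[R]_l) l :
  aggregation_objective e sigma y A l =
  fnorm2 (A l) - 2 * fdot (A l) (empmx l second_half y - sigma ^+ 2 *: 1%:M).
Proof.
rewrite /aggregation_objective normsq2_ker -ipsq_ker.
by congr (_ - 2 * ipsq _ _); apply/funext => z; rewrite ker_Rtilde.
Qed.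

End Empirical.

(** ** The loss against a finite-rank kernel *)

Section Loss.
Variables (m : nat) (lam : 'I_m -> R) (phi : 'I_m -> R -> R) (K : R * R -> R).
Hypothesis Krep : spectral_rep lam phi K.

Let LK : isL2sq K. Proof. by case: Krep. Qed.
Let Lphi j : isL2 (phi j). Proof. by case: Krep => _ _ []. Qed.
Let phiphi j k : ip (phi j) (phi k) = (j == k)%:R. Proof. by case: Krep => _ _ []. Qed.
Let Kc z := \sum_(j < m) lam j * tensor (phi j) (phi j) z.
Let LKc : isL2sq Kc.
Proof. by apply: isL2sq_comb => j; exact: isL2_tensor. Qed.

Lemma ipsq_rep F : isL2sq F ->
  ipsq K F = \sum_j lam j * ipsq (tensor (phi j) (phi j)) F.
Proof.
move=> LF; case: Krep => _ _ _ KE; rewrite (ipsq_ae LK LKc LF KE).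
by rewrite ipsq_combl// => j; exact: isL2_tensor.
Qed.

Definition coefmx l : 'M[R]_l :=
  \matrix_(j, k) \sum_p lam p * (ip (phi p) (e j) * ip (phi p) (e k)).

Lemma ipsq_coefmx l (A : 'M[R]_l) : ipsq K (ker_of_mx e A) = fdot (coefmx l) A.
Proof.
rewrite (ipsq_rep (isL2sq_ker A)) fdotE.
under eq_bigr do rewrite ipsqC ipsq_ker_tensor// mulr_sumr.
rewrite exchange_big/=; apply: eq_bigr => j _.
under eq_bigr do rewrite mulr_sumr.
rewrite exchange_big/=; apply: eq_bigr => k _.
by rewrite mxE mulr_suml; apply: eq_bigr => p _; ring.
Qed.

Lemma ipsq_KK : ipsq K K = \sum_p lam p ^+ 2.
Proof.
rewrite (ipsq_rep LK); apply: eq_bigr => j _; rewrite ipsqC ipsq_rep; last exact: isL2_tensor.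
rewrite (bigD1 j)//= ipsq_tensor// !phiphi eqxx !mulr1 big1 ?addr0 ?expr2// => k kj.
by rewrite ipsq_tensor// !phiphi (negbTE kj) !mulr0.
Qed.

Definition bias l : R := \sum_p lam p ^+ 2 - fnorm2 (coefmx l).

(** The kernel of the compression is the orthogonal projection of [K], so this is
Pythagoras. *)
Lemma loss_split l (A : 'M[R]_l) :
  normsq2 (fun z => ker_of_mx e A z - K z) ^+ 2 = fnorm2 (A - coefmx l) + bias l.
Proof.
have LA := isL2sq_ker A.
rewrite sqr_normsq2 ipsqBl//; last exact: isL2sqB.
rewrite !(ipsqC _ (fun z => _ - _)) !ipsqBl// ipsq_KK ipsq_ker.
rewrite (ipsqC (ker_of_mx e A)) !ipsq_coefmx /bias fnorm2B /fnorm2 (fdotC A); ring.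
Qed.

Lemma bias_ge0 l : 0 <= bias l.
Proof.
have := loss_split (coefmx l); rewrite subrr /fnorm2 fdot0l add0r => <-.
exact: sqr_ge0.
Qed.

(** A kernel of the class is the kernel of a matrix; its distance to [K] is zero
and dominates the bias. *)
Lemma bias_in_S l : in_S e l K -> bias l = 0.
Proof.
move=> [A _ KA]; apply/eqP; rewrite eq_le bias_ge0 andbT.
apply: (@le_trans _ _ (normsq2 (fun z => ker_of_mx e A z - K z) ^+ 2)).
  by rewrite loss_split lerDr fnorm2_ge0.
have LA := isL2sq_ker A.
rewrite sqr_normsq2 ipsqBl//; last exact: isL2sqB.
by rewrite (ipsq_ae LK LA _ KA) ?subrr//; exact: isL2sqB.
Qed.

Lemma coefmxE l : coefmx l = \sum_p lam p *:
  ((\row_(k < l) ip (phi p) (e k))^T *m \row_(k < l) ip (phi p) (e k)).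
Proof.
apply/matrixP => j k; rewrite mxE summxE; apply: eq_bigr => p _.
by rewrite !mxE big_ord_recl big_ord0 addr0 !mxE.
Qed.

Lemma coefmx_psd l : psd (coefmx l).
Proof.
rewrite coefmxE; elim/big_ind: _ => [|A B|p _]; [exact: psd0|exact: psdD|].
by apply: psdZ; [case: Krep => _ /(_ p)/ltW|exact: psd_outer].
Qed.

(** The rows of the coefficient matrix are spanned by the [m] coefficient vectors of
the eigenfunctions. *)
Lemma coefmx_support l : exists P : 'M[R]_l,
  [/\ proj P, \tr P <= (minn m l)%:R & coefmx l *m P = coefmx l].
Proof.
have [ml|lm] := leqP m l; last first.
  exists 1%:M; split; [exact: proj1|by rewrite mxtrace1|by rewrite mulmx1].
pose us := [seq \row_(k < l) ip (phi p) (e k) | p <- enum 'I_m].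
have [P [pP trP Pus]] := proj_span us.
exists P; split=> //; first by rewrite (le_trans trP)// size_map size_enum_ord.
rewrite coefmxE mulmx_suml; apply: eq_bigr => p _.
rewrite -scalemxAl -mulmxA Pus//.
by apply/mapP; exists p => //; rewrite mem_enum.
Qed.

(** [tail l p] is the squared distance from [phi p] to the span of the first
[l] basis functions. *)
Definition tail l (p : 'I_m) : R := 1 - \sum_(k < l) ip (phi p) (e k) ^+ 2.

(** Expanding the squared norms over pairs of eigenfunctions, the off-diagonal
terms only increase [fnorm2 (coefmx l)], and [1 - (1 - x)^2 <= 2 x]. *)
Lemma bias_tail l : bias l <= 2 * \sum_p lam p ^+ 2 * tail l p.
Proof.
have fE : fnorm2 (coefmx l) = \sum_p \sum_q lam p * lam q *
    (\sum_(k < l) ip (phi p) (e k) * ip (phi q) (e k)) ^+ 2.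
  rewrite /fnorm2 {1}coefmxE.
  have sumE (B : 'M[R]_l) (F : 'I_m -> 'M[R]_l) : fdot (\sum_p F p) B = \sum_p fdot (F p) B.
    by elim/big_rec2: _ => [|p x A _ <-]; rewrite ?fdot0l ?fdotDl.
  rewrite sumE; apply: eq_bigr => p _; rewrite fdotC coefmxE sumE.
  apply: eq_bigr => q _; rewrite fdotZl fdotZr fdot_outer -expr2.
  rewrite mulrA [lam q * _]mulrC fdotE big_ord_recl big_ord0 addr0; congr (_ * _ ^+ 2).
  by apply: eq_bigr => k _; rewrite !mxE mulrC.
have lam0 p : 0 <= lam p by case: Krep => _ /(_ p)/ltW.
rewrite /bias fE -sumrB mulr_sumr; apply: ler_sum => p _.
rewrite (bigD1 p)//= opprD addrA -expr2.
apply: (@le_trans _ _ (lam p ^+ 2 - lam p ^+ 2 * (1 - tail l p) ^+ 2)).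
  rewrite -[leRHS]subr0 lerB//; last first.
    by apply: sumr_ge0 => q _; rewrite mulr_ge0 ?sqr_ge0// mulr_ge0 ?lam0.
  have -> : \sum_(k < l) ip (phi p) (e k) * ip (phi p) (e k) = 1 - tail l p.
    by rewrite /tail opprB addrC subrK; apply: eq_bigr => k _; rewrite expr2.
  by [].
have := mulr_ge0 (sqr_ge0 (lam p)) (sqr_ge0 (tail l p)).
move: (lam p ^+ 2) (tail l p) => x t; rewrite !expr2; lra.
Qed.

End Loss.

End KernelCoefficients.

(** * Integral operators of finite rank *)

Section IntegralOperator.
Context {R : realType}.
Notation leb := (@leb1 R).
Notation UI := (@unitI R : set (measurableTypeR R)).
Implicit Types f g h : R -> R.
Let mI := @measurable_unitI R.
Let mS := @measurable_unitSq R.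

(** A null set of the square has null sections over almost every point. *)
Lemma ae_sections (F G : R * R -> R) : eqsq F G ->
  {ae leb, forall t, UI t -> {ae leb, forall u, UI u -> F (t, u) = G (t, u)}}.
Proof.
move=> [N [mN N0 FG]].
have : (\int[leb]_t `|leb (xsection N t)| = 0)%E.
  by rewrite -[RHS]N0; apply: eq_integral => t _; rewrite gee0_abs.
have mx : measurable_fun setT (leb \o xsection N) by exact: measurable_fun_xsection.
move/(ae_eq_integral_abs leb measurableT mx).
apply: filterS => t /(_ I) /= Nt tI; exists (xsection N t); split=> //.
  exact: measurable_xsection.
move=> u /= /not_implyP[uI FGu]; rewrite /xsection/= inE; apply: FG => /=.
by apply/not_implyP; split.
Qed.

Section FiniteRank.
Variables (m : nat) (lam : 'I_m -> R) (phi : 'I_m -> R -> R) (K : R * R -> R).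
Hypothesis Krep : spectral_rep lam phi K.

Let LK : isL2sq K. Proof. by case: Krep. Qed.
Let Lphi j : isL2 (phi j). Proof. by case: Krep => _ _ []. Qed.
Let phiphi j k : ip (phi j) (phi k) = (j == k)%:R. Proof. by case: Krep => _ _ []. Qed.
Let lam0 j : 0 < lam j. Proof. by case: Krep => _ /(_ j). Qed.

Definition rank_op f t := \sum_j (lam j * ip (phi j) f) * phi j t.

Lemma isL2_rank_op f : isL2 (rank_op f).
Proof. exact: isL2_comb. Qed.

Lemma measurable_section t : UI t -> measurable_fun UI (fun u => K (t, u)).
Proof.
move=> tI; case: LK => mK _.
have := (measurable_restrictT _ mS).1 mK => mKr.
apply/(measurable_restrictT _ mI).
rewrite (_ : _ \_ _ = (K \_ (@unitSq R)) \o pair t).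
  exact: (measurableT_comp mKr (pair1_measurable t)).
apply/funext => u; rewrite /= !patchE /unitSq in_setX/=.
by rewrite [t \in _]mem_set.
Qed.

Lemma integral_op_ae f : isL2 f ->
  {ae leb, forall t, UI t -> integral_op K f t = rank_op f t}.
Proof.
move=> Lf; case: Krep => _ _ _ /ae_sections; apply: filterS => t + tI.
move=> /(_ tI) Kt; rewrite /integral_op.
pose Kc u := \sum_j (lam j * phi j t) * phi j u.
have LKc : isL2 Kc by exact: isL2_comb.
rewrite (_ : rank_op f t = ip Kc f).
  congr fine; apply: ae_eq_integral => //.
  - apply/measurable_EFinP; apply: measurable_funM; first exact: measurable_section.
    by case: Lf.
  - apply/measurable_EFinP; apply: measurable_funM; [by case: LKc|by case: Lf].
  apply: filterS Kt => u Ktu uI; rewrite Ktu//; congr (EFin (_ * _)).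
  by rewrite /Kc; apply: eq_bigr => j _; rewrite /tensor/= mulrA.
rewrite ip_combl//; apply: eq_bigr => j _; ring.
Qed.

(** The sections of a measurable kernel are measurable, but measurability in the
other variable comes from Fubini, which needs an integrable kernel. *)
Lemma measurable_integral_op f : isL2 f -> measurable_fun UI (integral_op K f).
Proof.
move=> Lf; pose G := (K \* tensor (fun=> 1) f) \_ (@unitSq R).
have L1 : isL2 (fun=> 1 : R).
  split=> //; apply/(@integrableP _ _ _ leb); split=> //.
  under eq_integral do rewrite expr1n abse1.
  rewrite integral_cst//= mul1e /leb1 lebesgue_measure_itv/= lte_fin ltr01.
  by rewrite -EFinB subr0 ltry.
have iG : (@leb2 R).-integrable setT (EFin \o G).
  rewrite /G -restrict_EFin; apply/integrable_restrict => //; rewrite setTI.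
  exact: (L2_integrableM mS (isL2sqW LK) (isL2sqW (isL2_tensor L1 Lf))).
have mF := measurable_fubini_F (m1 := leb) (m2 := leb) iG.
have : measurable_fun UI (fine \o fubini_F leb (EFin \o G)).
  by apply: measurable_funS (measurableT_comp _ mF) => //; exact: measurable_fine.
apply: eq_measurable_fun => t; rewrite inE => tI.
rewrite /= /fubini_F /integral_op [RHS]Rintegral_mkcond; congr fine.
apply: eq_integral => u _; congr EFin; rewrite /G !patchE /unitSq in_setX/= [t \in _]mem_set//=.
by case: ifP => // _; rewrite /tensor/= mul1r.
Qed.

Lemma isL2_integral_op f : isL2 f -> isL2 (integral_op K f).
Proof.
move=> Lf; have ae := integral_op_ae Lf; have mop := measurable_integral_op Lf.
apply: (L2_ae mI mop _ (isL2W (isL2_rank_op f))).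
by apply: filterS ae => t h tI; rewrite h.
Qed.

Lemma ip_integral_op f g : isL2 f -> isL2 g ->
  ip (integral_op K f) g = \sum_j lam j * (ip (phi j) f * ip (phi j) g).
Proof.
move=> Lf Lg.
have -> : ip (integral_op K f) g = ip (rank_op f) g.
  apply: (dot_ae mI _ _ _ (integral_op_ae Lf)).
  - exact: measurable_integral_op.
  - by case: (isL2_rank_op f).
  - by case: Lg.
by rewrite ip_combl//; apply: eq_bigr => j _; rewrite mulrA.
Qed.

(** Test the operator norm on the eigenfunction. *)
Lemma eigenvalue_le (lmax : R) : (opnorm K <= lmax%:E)%E -> forall j, lam j <= lmax.
Proof.
move=> Kl j; have Lop := isL2_integral_op (Lphi j).
have n1 : norm2 (phi j) = 1 by rewrite /norm2 phiphi eqxx sqrtr1.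
have : norm2 (integral_op K (phi j)) <= lmax.
  rewrite -lee_fin (le_trans _ Kl)//; apply: ereal_sup_ubound.
  by exists (phi j) => //=; split=> //; rewrite n1.
apply: le_trans.
have := ip_le_norm2 Lop (Lphi j); rewrite n1 mulr1; apply: le_trans.
rewrite ip_integral_op// (bigD1 j)//= phiphi eqxx !mulr1 big1 ?addr0.
  by rewrite ger0_norm// ltW.
by move=> k kj; rewrite phiphi (negbTE kj) !mulr0.
Qed.

End FiniteRank.
End IntegralOperator.

(** * Parseval's identity and smoothness *)

Section Parseval.
Context {R : realType}.
Variable e : nat -> R -> R.
Hypothesis be : orthonormal_basis e.
Implicit Types f : R -> R.

Let Le k : isL2 (e k). Proof. by case: be => -[]. Qed.
Let ee j k : ip (e j) (e k) = (j == k)%:R. Proof. by case: be => -[]. Qed.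

Lemma sqr_dist_span f N : isL2 f ->
  norm2 (fun t => f t - \sum_(k < N) ip f (e k) * e k t) ^+ 2 =
  ip f f - \sum_(k < N) ip f (e k) ^+ 2.
Proof.
move=> Lf; have [g gdef] : exists g, g = fun t => \sum_(k < N) ip f (e k) * e k t.
  by eexists.
have Lg : isL2 g by rewrite gdef; apply: isL2_comb => k.
rewrite sqr_norm2 (_ : (fun t => _) = (fun t => f t - g t)); last by rewrite gdef.
rewrite ipBl//; last exact: isL2B.
rewrite !(ipC _ (fun t => f t - g t)) !ipBl//.
have gE h : isL2 h -> ip g h = \sum_(k < N) ip f (e k) * ip (e k) h.
  by move=> Lh; rewrite gdef ip_combl.
have gf : ip g f = \sum_(k < N) ip f (e k) ^+ 2.
  by rewrite gE//; apply: eq_bigr => k _; rewrite (ipC (e k)) expr2.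
have gg : ip g g = \sum_(k < N) ip f (e k) ^+ 2.
  rewrite gE//; apply: eq_bigr => k _; rewrite (ipC (e k)) gE// (bigD1 k)//= ee eqxx mulr1.
  rewrite big1 ?addr0 ?expr2// => j jk; rewrite ee (_ : _ == _ = false) ?mulr0//.
  exact/negbTE.
by rewrite (ipC f g) gf gg; ring.
Qed.

(** The distance to the spans tends to zero. *)
Lemma parseval f : isL2 f ->
  \sum_(k < N) ip f (e k) ^+ 2 @[N --> \oo] --> ip f f.
Proof.
move=> Lf; have := be.2 f Lf => h.
have h2 : norm2 (fun t => f t - \sum_(k < N) ip f (e k) * e k t) ^+ 2 @[N --> \oo] --> 0.
  by rewrite -[X in _ --> X](mulr0 0); under eq_fun do rewrite expr2; exact: cvgM.
rewrite -[X in _ --> X](subr0 (ip f f)).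
have -> : (fun N => \sum_(k < N) ip f (e k) ^+ 2) = (fun N => ip f f -
    norm2 (fun t => f t - \sum_(k < N) ip f (e k) * e k t) ^+ 2).
  by apply/funext => N; rewrite sqr_dist_span// opprB addrC subrK.
by apply: cvgB => //; exact: cvg_cst.
Qed.

Lemma poweR_half_le (S : \bar R) (c : R) :
  (0 <= S)%E -> (S `^ 2^-1 <= c%:E)%E -> (S <= (c ^+ 2)%:E)%E.
Proof.
case: S => [r| |]//; last by rewrite poweRyr ?invr_eq0// => _; rewrite leye_eq.
rewrite lee_fin => r0; rewrite poweR_EFin !lee_fin powR12_sqrt// => h.
rewrite -(sqr_sqrtr r0) lerXn2r ?nnegrE ?sqrtr_ge0//.
by apply: le_trans h; exact: sqrtr_ge0.
Qed.

(** Beyond the index [l] the weights are at least [(l+1)^(2s)]. *)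
Lemma weighted_tail (s c : R) (b : nat -> R) (l N : nat) : 0 <= s ->
  (forall k, 0 <= b k) ->
  (forall M, \sum_(k < M) (k.+1%:R `^ (2 * s)) * b k <= c) ->
  \sum_(l <= k < N) b k <= c * l.+1%:R `^ (- (2 * s)).
Proof.
move=> s0 b0 H.
have w0 : 0 < l.+1%:R `^ (2 * s) :> R by rewrite powR_gt0.
rewrite powRN ler_pdivlMr// mulrC mulr_sumr.
have [lN|Nl] := leqP l N; last first.
  rewrite big_geq 1?ltnW//; have := H 0%N; rewrite big_ord0//.
apply: le_trans (H N); rewrite -(big_mkord xpredT (fun k => k.+1%:R `^ (2 * s) * b k)).
rewrite [leRHS](big_cat_nat (n := l))//= -[leLHS]add0r lerD//.
  by apply: sumr_ge0 => k _; rewrite mulr_ge0// powR_ge0.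
rewrite !big_nat; apply: ler_sum => k /andP[lk _].
rewrite ler_wpM2r// ge0_ler_powR ?nnegrE ?mulr_ge0// ler_nat ltnS//.
Qed.

Lemma snorm_tail (s c : R) f l : 0 <= s -> isL2 f -> (snorm e s f <= c%:E)%E ->
  ip f f - \sum_(k < l) ip f (e k) ^+ 2 <= c ^+ 2 * l.+1%:R `^ (- (2 * s)).
Proof.
move=> s0 Lf fc.
have ser : (\sum_(0 <= k <oo) ((k.+1%:R `^ (2 * s)) * ip f (e k) ^+ 2)%:E <= (c ^+ 2)%:E)%E.
  apply: poweR_half_le => //; apply: nneseries_ge0 => k _ _.
  by rewrite lee_fin mulr_ge0 ?powR_ge0 ?sqr_ge0.
have part M : \sum_(k < M) (k.+1%:R `^ (2 * s)) * ip f (e k) ^+ 2 <= c ^+ 2.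
  rewrite -lee_fin (le_trans _ ser)// -sumEFin -(big_mkord xpredT
    (fun k => ((k.+1%:R `^ (2 * s)) * ip f (e k) ^+ 2)%:E)).
  apply: nneseries_lim_ge => k _ _.
  by rewrite lee_fin mulr_ge0 ?powR_ge0 ?sqr_ge0.
have cv : \sum_(k < N) ip f (e k) ^+ 2 - \sum_(k < l) ip f (e k) ^+ 2 @[N --> \oo] -->
    ip f f - \sum_(k < l) ip f (e k) ^+ 2.
  by apply: cvgB; [exact: parseval|exact: cvg_cst].
rewrite -(cvg_lim _ cv)//; apply: limr_le; first exact: cvgP cv.
near=> N.
have lN : (l <= N)%N by near: N; exact: nbhs_infty_ge.
rewrite -(big_mkord xpredT (fun k => ip f (e k) ^+ 2)) (big_cat_nat (n := l))//=.
rewrite big_mkord addrAC subrr add0r.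
apply: weighted_tail => // k; exact: sqr_ge0.
Unshelve. all: by end_near. Qed.

Section Rep.
Variables (m : nat) (lam : 'I_m -> R) (phi : 'I_m -> R -> R) (K : R * R -> R).
Hypothesis Krep : spectral_rep lam phi K.

Let Lphi j : isL2 (phi j). Proof. by case: Krep => _ _ []. Qed.
Let phiphi j k : ip (phi j) (phi k) = (j == k)%:R. Proof. by case: Krep => _ _ []. Qed.

Lemma snormsq_tail (s rho : R) l : 0 <= s -> (snormsq e s K <= rho%:E)%E ->
  \sum_p lam p ^+ 2 * tail e phi l p <= rho ^+ 2 * l.+1%:R `^ (- (2 * s)).
Proof.
move=> s0 Kr.
pose f k := rank_op lam phi (e k).
have Lf k : isL2 (f k) by exact: (isL2_rank_op Krep).
have ipE k k' : ip (integral_op K (e k)) (e k') = ip (f k) (e k').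
  rewrite (ip_integral_op Krep)// ip_combl//.
  by apply: eq_bigr => j _; rewrite mulrA.
have ffE k : ip (f k) (f k) = \sum_p lam p ^+ 2 * ip (phi p) (e k) ^+ 2.
  rewrite ip_combl//; apply: eq_bigr => p _; rewrite (ipC _ (f k)) ip_combl// (bigD1 p)//=.
  rewrite phiphi eqxx mulr1 big1 ?addr0 => [|q qp]; first by ring.
  by rewrite phiphi (negbTE qp) mulr0.
pose w k : R := k.+1%:R `^ (2 * s).
have w0 k : 0 <= w k by exact: powR_ge0.
have inner0 k : (0 <= \sum_(0 <= k' <oo) (w k * ip (integral_op K (e k)) (e k') ^+ 2)%:E)%E.
  by apply: nneseries_ge0 => k' _ _; rewrite lee_fin mulr_ge0 ?sqr_ge0.
have ser : (\sum_(0 <= k <oo) \sum_(0 <= k' <oo)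
    (w k * ip (integral_op K (e k)) (e k') ^+ 2)%:E <= (rho ^+ 2)%:E)%E.
  by apply: poweR_half_le => //; exact: nneseries_ge0.
have innerE k : (\sum_(0 <= k' <oo) (w k * ip (integral_op K (e k)) (e k') ^+ 2)%:E =
    (w k * ip (f k) (f k))%:E)%E.
  apply/cvg_lim => //; under eq_fun do rewrite sumEFin.
  apply: cvg_EFin; first exact: nearW.
  rewrite /comp/=; under eq_fun do rewrite -mulr_sumr big_mkord.
  apply: cvgM; first exact: cvg_cst.
  by under eq_fun do under eq_bigr do rewrite ipE; exact: parseval.
have part M : \sum_(k < M) w k * ip (f k) (f k) <= rho ^+ 2.
  rewrite -lee_fin (le_trans _ ser)// -sumEFin.
  rewrite -(big_mkord xpredT (fun k => (w k * ip (f k) (f k))%:E)).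
  under eq_bigr do rewrite -innerE.
  by apply: nneseries_lim_ge => k _ _.
have cv : \sum_p lam p ^+ 2 * (\sum_(k < N) ip (phi p) (e k) ^+ 2
     - \sum_(k < l) ip (phi p) (e k) ^+ 2) @[N --> \oo] -->
    \sum_p lam p ^+ 2 * tail e phi l p.
  apply: cvg_sum_fun => p; apply: cvgM; first exact: cvg_cst.
  rewrite /tail; apply: cvgB; last exact: cvg_cst.
  by have := parseval (Lphi p); rewrite phiphi eqxx.
rewrite -(cvg_lim _ cv)//; apply: limr_le; first exact: cvgP cv.
near=> N.
have lN : (l <= N)%N by near: N; exact: nbhs_infty_ge.
apply: (le_trans _ (weighted_tail l N s0 (fun k => ip_ge0 (f k)) part)).
under eq_bigr => p _.
  rewrite -(big_mkord xpredT (fun k => ip (phi p) (e k) ^+ 2)) (big_cat_nat (n := l))//=.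
  rewrite big_mkord addrAC subrr add0r.
  rewrite mulr_sumr; over.
rewrite exchange_big/=; under [leRHS]eq_bigr do rewrite ffE.
by [].
Unshelve. all: by end_near. Qed.

Lemma bessel_rep (f : R -> R) : isL2 f -> \sum_p ip (phi p) f ^+ 2 <= ip f f.
Proof.
move=> Lf; have [g gdef] : exists g, g = fun t => \sum_p ip (phi p) f * phi p t.
  by eexists.
have Lg : isL2 g by rewrite gdef; apply: isL2_comb => k.
have : 0 <= ip (fun t => f t - g t) (fun t => f t - g t) by exact: ip_ge0.
rewrite ipBl//; last exact: isL2B.
rewrite !(ipC _ (fun t => f t - g t)) !ipBl//.
have gE h : isL2 h -> ip g h = \sum_p ip (phi p) f * ip (phi p) h.
  by move=> Lh; rewrite gdef ip_combl.
have gf : ip g f = \sum_p ip (phi p) f ^+ 2.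
  by rewrite gE//; apply: eq_bigr => k _; rewrite expr2.
have gg : ip g g = \sum_p ip (phi p) f ^+ 2.
  rewrite gE//; apply: eq_bigr => k _; rewrite (ipC _ g) gE// (bigD1 k)//= phiphi eqxx mulr1.
  by rewrite big1 ?addr0 ?expr2// => j jk; rewrite phiphi (negbTE jk) mulr0.
rewrite (ipC f g) gf gg; lra.
Qed.

(** The covariance operator is dominated by [lmax], hence so are the
compressions of its matrix. *)
Lemma coefmx_le (lmax : R) l : 0 <= lmax -> (forall p, lam p <= lmax) ->
  psd (lmax *: 1%:M - coefmx e lam phi l).
Proof.
move=> lmax0 le; split=> [|v].
  by rewrite linearB/= scale_trmx trmx1 (coefmx_psd e Krep l).1.
pose f t := \sum_(k < l) v 0 k * e k t.
have Lf : isL2 f by apply: isL2_comb => k.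
have ff : ip f f = fnorm2 v.
  rewrite fnorm2E big_ord_recl big_ord0 addr0 ip_combl//; apply: eq_bigr => k _.
  rewrite ipC ip_combl// (bigD1 k)//= ee eqxx mulr1 big1 ?addr0 ?expr2// => j jk.
  by rewrite ee (_ : _ == _ = false) ?mulr0//; exact/negbTE.
have lam0 p : 0 <= lam p by case: Krep => _ /(_ p)/ltW.
have -> : qform (lmax *: 1%:M - coefmx e lam phi l) v =
    lmax * ip f f - \sum_p lam p * ip (phi p) f ^+ 2.
  rewrite qform_fdot fdotBl fdotZl -!qform_fdot qform1 ff; congr (_ - _).
  rewrite coefmxE qform_fdot.
  have sumE (B : 'M[R]_l) (F : 'I_m -> 'M[R]_l) : fdot (\sum_p F p) B = \sum_p fdot (F p) B.
    by elim/big_rec2: _ => [|p x A _ <-]; rewrite ?fdot0l ?fdotDl.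
  rewrite sumE; apply: eq_bigr => p _; rewrite fdotZl fdot_outer -expr2.
  congr (_ * _ ^+ 2); rewrite ipC ip_combl// fdotE big_ord_recl big_ord0 addr0.
  by apply: eq_bigr => k _; rewrite mxE mulrC ipC.
rewrite subr_ge0; apply: (@le_trans _ _ (\sum_p lmax * ip (phi p) f ^+ 2)).
  by apply: ler_sum => p _; rewrite ler_wpM2r ?sqr_ge0.
by rewrite -mulr_sumr ler_wpM2l ?bessel_rep.
Qed.

End Rep.
End Parseval.

(** * Gaussian coordinates of the white noise model *)

Section Scaling.
Context {R : realType}.
Notation mu := (@lebesgue_measure R).

(** Lebesgue measure is determined by its values on intervals. *)
Lemma ge0_integral_scale (s : R) (f : R -> \bar R) : 0 < s ->
  (forall x, 0 <= f x)%E -> measurable_fun setT f ->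
  (\int[mu]_x f x = s%:E * \int[mu]_x f (s * x)%R)%E.
Proof.
move=> s0 f0 mf.
have mh : measurable_fun setT (fun x : measurableTypeR R => (s * x : measurableTypeR R)).
  exact: measurable_funM.
pose mix := isMeasurableFun.Build _ _ _ _ _ mh.
pose h : {mfun measurableTypeR R >-> measurableTypeR R} :=
  HB.pack (fun x : measurableTypeR R => (s * x : measurableTypeR R)) mix.
pose nu_ : {measure set (measurableTypeR R) -> \bar R} :=
  mscale (NngNum (ltW s0)) (pushforward mu h).
pose nu := nu_ mh.
have nuE A : measurable A -> mu A = nu A.
  apply: lebesgue_measure_unique => _ [[a b] _ <-].
  rewrite /nu/= /mscale/= /pushforward/=.
  rewrite (_ : _ @^-1` _ = [set` `]a / s, b / s]]); last first.
    apply/seteqP; split => x /=; rewrite !in_itv/=;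
      by rewrite ltr_pdivrMr// ler_pdivlMr// mulrC.
  rewrite !lebesgue_measure_itv/= !lte_fin ltr_pM2r ?invr_gt0//.
  case: ifP => _; last by rewrite mule0.
  rewrite -!EFinD -EFinM; congr EFin; field; exact: lt0r_neq0.
rewrite (@eq_measure_integral _ _ _ _ nu)//; last by move=> A mA _; exact: nuE.
by rewrite ge0_integral_mscale// ge0_integral_pushforward.
Qed.

Lemma gauss_exponent_scale (s x : R) : 0 < s ->
  - (s * x) ^+ 2 / (s ^+ 2 *+ 2) = - x ^+ 2 / 2.
Proof. by move=> s0; field; rewrite gt_eqF. Qed.

Lemma normal_prob_scale (s : R) (A : set R) : 0 < s -> measurable A ->
  normal_prob 0 s A = normal_prob 0 1 [set x | A (s * x)].
Proof.
move=> s0 mA; rewrite /normal_prob integral_mkcond [RHS]integral_mkcond.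
rewrite (ge0_integral_scale s0); last 2 first.
- by move=> x; rewrite patchE; case: ifP => // _; rewrite lee_fin normal_pdf_ge0.
- apply/(measurable_restrictT _ _).1 => //; apply: measurable_funTS.
  by apply/measurable_EFinP; exact: measurable_normal_pdf.
have E x : (((fun x => (normal_pdf 0 s x)%:E) \_ A) (s * x)%R * s%:E =
    ((fun x => (normal_pdf 0 1 x)%:E) \_ [set x | A (s * x)%R]) x)%E.
  rewrite !patchE; rewrite (_ : (x \in [set x | A (s * x)]) = (s * x \in A)); last first.
    by apply/idP/idP; rewrite !inE.
  case: ifP => _; last by rewrite mul0e.
  rewrite -EFinM !normal_pdfE ?gt_eqF//; congr EFin.
  rewrite /normal_fun !subr0 expr1n mulrAC; congr (_ * expR _).
    rewrite /normal_peak expr1n mul1r -[X in Num.sqrt X]mulrnAr sqrtrM ?sqr_ge0// sqrtr_sqr gtr0_norm//.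
    by rewrite invfM mulrAC mulVf ?mul1r// gt_eqF.
  exact: gauss_exponent_scale.
rewrite muleC -ge0_integralZr//.
- by apply: eq_integral => x _; rewrite E.
- have mrs : measurable_fun setT ((fun x => (normal_pdf 0 s x)%:E) \_ A).
    apply/(measurable_restrictT _ _).1 => //; apply: measurable_funTS.
    by apply/measurable_EFinP; exact: measurable_normal_pdf.
  by apply: (measurableT_comp mrs); exact: measurable_funM.
- by move=> x _; rewrite patchE; case: ifP => // _; rewrite lee_fin normal_pdf_ge0.
- by rewrite lee_fin ltW.
Qed.

End Scaling.

Section StepFunctions.
Context {R : realType}.
Notation leb := (@leb1 R).
Notation UI := (@unitI R : set (measurableTypeR R)).
Implicit Types (g : @step_fun R) (F f : R -> R).
Let mI := @measurable_unitI R.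

Section Grid.
Variable ts : seq R.
Hypothesis ts_sorted : sorted <%R ts.
Let t q := nth 0 ts q.
Let M := (size ts).-1.

Let tmono i j : (i < size ts)%N -> (j < size ts)%N -> (t i <= t j) = (i <= j)%N.
Proof. by move=> iM jM; rewrite (lt_sorted_leq_nth _ ts_sorted). Qed.

Let qM (q : 'I_M) : (q.+1 < size ts)%N.
Proof. by rewrite -ltn_predRL; exact: ltn_ord. Qed.

Lemma grid_lt (q : 'I_M) : t q < t q.+1.
Proof. by rewrite ltNge tmono ?ltnn// ltnW. Qed.

(** Every cell of the grid is either inside or outside the interval. *)
Lemma grid_telescope F a b : a \in ts -> b \in ts -> a <= b ->
  F b - F a = \sum_(q < M) ((a <= t q) && (t q.+1 <= b))%:R * (F (t q.+1) - F (t q)).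
Proof.
move=> ats bts; have [i ai] : exists i, i = index a ts by eexists.
have [j bj] : exists j, j = index b ts by eexists.
have iM : (i < size ts)%N by rewrite ai index_mem.
have jM : (j < size ts)%N by rewrite bj index_mem.
have -> : a = t i by rewrite /t ai nth_index.
have -> : b = t j by rewrite /t bj nth_index.
rewrite tmono// => ij.
rewrite -(@telescope_sumr _ i j (fun q => F (t q)))//.
rewrite (big_nat_widen _ _ M); last by rewrite /M; case: (size ts) jM.
rewrite (big_nat_widenl _ 0%N)// big_mkord/= big_mkcond/=.
apply: eq_bigr => q _; rewrite !tmono ?(ltnW (qM q))//.
by rewrite andbC; case: ifP => _; rewrite ?mul1r ?mul0r.
Qed.

Lemma grid_indic (q : 'I_M) a b x : a \in ts -> b \in ts -> t q < x <= t q.+1 ->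
  \1_(`]a, b]) x = ((a <= t q) && (t q.+1 <= b))%:R :> R.
Proof.
move=> ats bts /andP[qx xq].
rewrite indicE; congr (nat_of_bool _)%:R.
rewrite mem_setE in_itv/=.
have [i ai] : exists i, i = index a ts by eexists.
have [j bj] : exists j, j = index b ts by eexists.
have iM : (i < size ts)%N by rewrite ai index_mem.
have jM : (j < size ts)%N by rewrite bj index_mem.
have -> : a = t i by rewrite /t ai nth_index.
have -> : b = t j by rewrite /t bj nth_index.
have qM' := ltnW (qM q).
congr andb; apply/idP/idP => h.
- by rewrite tmono// -ltnS ltnNge -tmono// -ltNge (lt_le_trans h).
- exact: le_lt_trans qx.
- by rewrite tmono// ltnNge -tmono// -ltNge (lt_le_trans qx).
- exact: le_trans h.
Qed.

Variable g : @step_fun R.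
Hypothesis g_ts : forall j, (j <= steps g)%N -> knot g j \in ts.
Hypothesis g_mono : forall j, (j < steps g)%N -> knot g j <= knot g j.+1.

Lemma step_val_cell (q : 'I_M) x : t q < x <= t q.+1 -> step_val g x = step_val g (t q.+1).
Proof.
move=> xq; apply: eq_bigr => j _.
have [j1 j2] : knot g j \in ts /\ knot g j.+1 \in ts by split; apply: g_ts => //; exact: ltnW.
by rewrite !(@grid_indic q)// lexx andbT grid_lt.
Qed.

(** Applied to the primitive of a function this gives inner products, and applied
to the paths of the noise it gives stochastic integrals. *)
Lemma step_sum_grid F :
  \sum_(j < steps g) height g j * (F (knot g j.+1) - F (knot g j)) =
  \sum_(q < M) step_val g (t q.+1) * (F (t q.+1) - F (t q)).
Proof.
under [RHS]eq_bigr do rewrite mulr_suml.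
rewrite exchange_big/=; apply: eq_bigr => j _.
have [j1 j2] : knot g j \in ts /\ knot g j.+1 \in ts by split; apply: g_ts => //; exact: ltnW.
rewrite grid_telescope// ?g_mono// mulr_sumr; apply: eq_bigr => q _.
by rewrite (@grid_indic q) ?lexx ?grid_lt// mulrA.
Qed.

End Grid.

Definition prim f x : R := \int[leb]_(u in [set` `[0, x]]) f u.

Lemma isL2_indic a b : isL2 (\1_(`]a, b]) : R -> R).
Proof.
split; first by apply/measurable_funTS/measurable_indic; exact: measurable_itv.
have -> : (fun x => ((\1_(`]a, b]) x : R) ^+ 2)%:E) = EFin \o (\1_(`]a, b]) : R -> R).
  by apply/funext => x; rewrite /= indicE; case: (x \in _); rewrite ?expr1n ?expr0n.
by apply: (@integrableS _ _ _ leb setT) => //; exact: integrable_indic_itv.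
Qed.

Lemma isL2_step g : isL2 (step_val g).
Proof. by apply: isL2_comb => j; exact: isL2_indic. Qed.

Lemma isL2_integrable f : isL2 f -> leb.-integrable UI (EFin \o f).
Proof.
move=> Lf; have := L2_integrableM mI (isL2W Lf) (isL2W (isL2_indic (-1) 1)).
apply: eq_integrable => // x; rewrite inE /unitI/= in_itv/= => /andP[x0 x1].
rewrite indicE mem_set/= ?mulr1// in_itv/= x1 andbT; lra.
Qed.

Lemma ip_indic_prim f a b : isL2 f -> 0 <= a -> a <= b -> b <= 1 ->
  ip (\1_(`]a, b])) f = prim f b - prim f a.
Proof.
move=> Lf a0 ab b1; rewrite /prim Rintegral_itvB ?bnd_simp//; last first.
  apply: integrableS (isL2_integrable Lf) => //.
  by move=> x; rewrite /unitI/= !in_itv/= => /andP[-> /le_trans->].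
rewrite /ip /Rintegral; congr fine.
rewrite (_ : (fun x => ((\1_(`]a, b]) x : R) * f x)%:E) = (EFin \o f) \_ `]a, b]); last first.
  by apply/funext => x; rewrite patchE indicE/=; case: ifP; rewrite ?mul1r ?mul0r.
rewrite -integral_mkcondr; congr (integral _ _ _).
apply/seteqP; split => x /=; first by case.
move=> h; split=> //; move: h; rewrite /unitI/= !in_itv/= => /andP[ax xb].
by rewrite (le_trans xb b1) (le_trans a0 (ltW ax)).
Qed.

Lemma prim_step_cell g (a b c : R) : 0 <= a -> a <= b -> b <= 1 ->
  (forall x, a < x <= b -> step_val g x = c) ->
  prim (step_val g) b - prim (step_val g) a = c * (b - a).
Proof.
move=> a0 ab b1 gc; rewrite /prim Rintegral_itvB ?bnd_simp//; last first.
  apply: integrableS (isL2_integrable (isL2_step g)) => //.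
  by move=> x; rewrite /unitI/= !in_itv/= => /andP[-> /le_trans->].
rewrite (_ : \int[lebesgue_measure]_(x in `]a, b]) step_val g x = \int[leb]_(x in `]a, b]) c).
  rewrite Rintegral_cst//=; congr (_ * _); rewrite lebesgue_measure_itv/= lte_fin.
  by case: ltgtP ab => //= -> _; rewrite subrr.
by apply: eq_Rintegral => x; rewrite inE/= in_itv/= => /gc.
Qed.

Lemma step_knot_mono g i j : step_valid g -> (i <= j <= steps g)%N -> knot g i <= knot g j.
Proof.
move=> [k0 km k1]; elim: j => [|j IH] /andP[ij jN]; first by move: ij; rewrite leqn0 => /eqP->.
move: ij; rewrite leq_eqVlt => /predU1P[->//|ij].
by rewrite (le_trans (IH _)) ?km// -ltnS ij ltnW.
Qed.

Lemma step_knot01 g j : step_valid g -> (j <= steps g)%N -> 0 <= knot g j <= 1.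
Proof.
move=> gv jN; have mono := step_knot_mono gv; case: gv => k0 _ k1.
by rewrite (le_trans k0) ?mono//= (le_trans _ k1)// mono// jN leqnn.
Qed.

Lemma ip_step_prim g f : step_valid g -> isL2 f ->
  ip (step_val g) f = \sum_(j < steps g) height g j * (prim f (knot g j.+1) - prim f (knot g j)).
Proof.
move=> gv Lf; rewrite ip_combl// => [|j]; last exact: isL2_indic.
apply: eq_bigr => j _; rewrite ip_indic_prim//.
- by have /andP[] := step_knot01 gv (ltnW (ltn_ord j)).
- by case: gv => _ km _; exact: km.
- by have /andP[] := step_knot01 gv (ltn_ord j).
Qed.

Lemma ip_step_step (ts : seq R) g g' : sorted <%R ts ->
  (forall x, x \in ts -> 0 <= x <= 1) -> step_valid g -> step_valid g' ->
  (forall j, (j <= steps g)%N -> knot g j \in ts) ->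
  (forall j, (j <= steps g')%N -> knot g' j \in ts) ->
  ip (step_val g) (step_val g') = \sum_(q < (size ts).-1)
    step_val g (nth 0 ts q.+1) * step_val g' (nth 0 ts q.+1) * (nth 0 ts q.+1 - nth 0 ts q).
Proof.
move=> ss ts01 gv gv' gts gts'; rewrite (ip_step_prim gv (isL2_step g')).
case: gv gv' => [_ km _] [_ km' _].
rewrite (step_sum_grid ss gts km); apply: eq_bigr => q _.
have qs : (q.+1 < size ts)%N by rewrite -ltn_predRL; exact: ltn_ord.
rewrite -mulrA; congr (_ * _); apply: prim_step_cell.
- by have /andP[] := ts01 _ (mem_nth 0 (ltnW qs)).
- exact: ltW (grid_lt ss q).
- by have /andP[] := ts01 _ (mem_nth 0 qs).
- by move=> x xq; apply: (step_val_cell ss gts').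
Qed.

Definition common_grid (I : finType) (gs : I -> @step_fun R) : seq R :=
  sort <=%R (undup [seq knot (gs k) j | k <- enum I, j <- iota 0 (steps (gs k)).+1]).

Lemma common_grid_sorted (I : finType) (gs : I -> @step_fun R) :
  sorted <%R (common_grid gs).
Proof. by rewrite sort_lt_sorted undup_uniq. Qed.

Lemma mem_common_grid (I : finType) (gs : I -> @step_fun R) k j :
  (j <= steps (gs k))%N -> knot (gs k) j \in common_grid gs.
Proof.
move=> jk; rewrite mem_sort mem_undup; apply/allpairsPdep; exists k, j.
by rewrite mem_enum mem_iota.
Qed.

Lemma common_grid01 (I : finType) (gs : I -> @step_fun R) :
  (forall k, step_valid (gs k)) -> forall x, x \in common_grid gs -> 0 <= x <= 1.
Proof.
move=> gv x; rewrite mem_sort mem_undup => /allpairsPdep[k [j [_]]].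
by rewrite mem_iota/= add0n ltnS => jk ->; exact: step_knot01.
Qed.

End StepFunctions.

Section Coordinates.
Context {R : realType} {d : measure_display} {T : measurableType d}.
Variable P : probability T R.

(** Events that are not constrained are replaced by the whole space. *)
Lemma mutually_independent_full (J : finType) (G : J -> set (set T)) :
  (forall j, G j setT) ->
  (forall E : J -> set T, (forall j, G j (E j)) ->
     P [set w | forall j, E j w] = (\prod_j P (E j))%E) ->
  mutually_independent P G.
Proof.
move=> GT GI s E us sE; pose E' j := if j \in s then E j else setT.
rewrite (_ : [set w | _] = [set w | forall j, E' j w]); last first.
  apply/seteqP; split => w /= h j; first by rewrite /E'; case: ifPn => // /h.
  by move=> js; have := h j; rewrite /E' js.
rewrite GI => [|j]; last by rewrite /E'; case: ifPn => // /sE.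
rewrite (big_uniq _ us) [RHS]big_mkcond/=; apply: eq_bigr => j _.
by rewrite /E'; case: ifP => // _; rewrite probability_setT.
Qed.

Lemma mutually_independent_all (J : finType) (G : J -> set (set T)) :
  mutually_independent P G -> forall E : J -> set T, (forall j, G j (E j)) ->
     P [set w | forall j, E j w] = (\prod_j P (E j))%E.
Proof.
move=> GI E GE; have := GI (enum J) E (enum_uniq _) (fun j _ => GE j).
rewrite big_enum/= => <-; congr (P _); apply/seteqP; split => w /= h j //.
by apply: h; rewrite mem_enum.
Qed.

Section SigmaGen.
Variables (I : Type) (D : set I) (X : I -> T -> R).
Let G := [set A | exists i, exists2 B : set R, D i /\ measurable B & A = (X i @^-1` B)].

Lemma sigma_genT : sigma_gen D X setT.
Proof. exact: (@measurableT _ (g_sigma_algebraType G)). Qed.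

Lemma sigma_gen_sub (f : T -> R) :
  measurable_fun setT (f : g_sigma_algebraType G -> R) ->
  sigma_gen setT (fun _ : unit => f) `<=` sigma_gen D X.
Proof.
move=> mf; apply: smallest_sub; first exact: smallest_sigma_algebra.
move=> _ [_ [B [_ mB] ->]].
by rewrite -[X in _ X]setTI; exact: mf.
Qed.

Lemma sigma_gen_coord i : D i -> measurable_fun setT (X i : g_sigma_algebraType G -> R).
Proof.
move=> Di _ B mB; rewrite setTI; apply: sub_sigma_algebra.
by exists i, B.
Qed.

Lemma sigma_gen_bigcap (J : finType) (E : J -> set T) :
  (forall j, sigma_gen D X (E j)) -> sigma_gen D X [set w | forall j, E j w].
Proof.
move=> GE; rewrite (_ : [set w | _] = \bigcap_(j in [set: J]) E j); last first.
  by apply/seteqP; split => w /= h j //; exact: h.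
apply: (@fin_bigcap_measurable _ (g_sigma_algebraType G)) => // j _.
exact: GE.
Qed.

End SigmaGen.

Lemma sigma_gen_scale (f g : T -> R) (c : R) : (forall w, f w = c * g w) ->
  sigma_gen setT (fun _ : unit => f) `<=` sigma_gen setT (fun _ : unit => g).
Proof.
move=> fg; apply: sigma_gen_sub; rewrite (_ : f = fun w => c * g w); last exact/funext.
by apply: measurable_funM => //; exact: (@sigma_gen_coord unit setT (fun _ => g) tt).
Qed.

Lemma gaussian_standardize s (Z : T -> R) : 0 < s -> gaussian P 0 s Z ->
  gaussian P 0 1 (fun w => s^-1 * Z w).
Proof.
move=> s0 [mZ NZ]; split; first exact: measurable_funM.
move=> B mB; pose A := [set x | B (s^-1 * x)].
have mA : measurable A.
  have : measurable_fun setT (fun x : R => s^-1 * x) by exact: measurable_funM.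
  by move=> /(_ measurableT _ mB); rewrite setTI.
rewrite -[X in P X]/(Z @^-1` A) NZ// normal_prob_scale//; congr (normal_prob _ _ _).
by apply/seteqP; split => x; rewrite /A/= mulrA mulVf ?mul1r// gt_eqF.
Qed.

End Coordinates.

Section WhiteNoise.
Context {R : realType} {d : measure_display} {T : measurableType d}.
Variables (P : probability T R) (n m : nat).
Variables (W : 'I_n -> R -> T -> R) (xi : 'I_n -> 'I_m -> T -> R).
Hypothesis W_brownian : forall i, brownian P (W i).
Hypothesis xi_gauss : forall i j, gaussian P 0 1 (xi i j).
Hypothesis indep : mutually_independent P
  (fun a : ('I_n * 'I_m) + 'I_n =>
     match a with
     | inl (i, j) => sigma_gen setT (fun _ : unit => xi i j)
     | inr i => sigma_gen unitI (W i)
     end).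
Variable ts : seq R.
Hypothesis ts_sorted : sorted <%R ts.
Hypothesis ts01 : forall x, x \in ts -> 0 <= x <= 1.
Let t q := nth 0 ts q.
Let M := (size ts).-1.

Let t01 q : 0 <= t q <= 1.
Proof.
have [qs|qs] := ltnP q (size ts); first exact/ts01/mem_nth.
by rewrite /t nth_default// lexx ler01.
Qed.

Let tlt (q : 'I_M) : t q < t q.+1. Proof. exact: grid_lt. Qed.

Definition white_coord (j : 'I_n * 'I_(m + M)) w :=
  match fintype.split j.2 with
  | inl p => xi j.1 p w
  | inr q => (Num.sqrt (t q.+1 - t q))^-1 * (W j.1 (t q.+1) w - W j.1 (t q) w)
  end.

Lemma white_coord_gaussian j : gaussian P 0 1 (white_coord j).
Proof.
rewrite /white_coord; case: (fintype.split j.2) => [p|q]; first exact: xi_gauss.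
apply: gaussian_standardize; first by rewrite sqrtr_gt0 subr_gt0.
have [_ _ inc _ _] := W_brownian j.1.
by apply: inc => //; [have /andP[] := t01 q|have /andP[] := t01 q.+1].
Qed.

(** Independence between the copies and between noise and signal comes from
the model; inside one copy the increments of the Brownian motion over
disjoint cells are independent. *)
Lemma white_coord_indep :
  mutually_independent P (fun j => sigma_gen setT (fun _ : unit => white_coord j)).
Proof.
apply: mutually_independent_full => [j|E GE]; first exact: sigma_genT.
pose E1 (i : 'I_n) (p : 'I_m) := E (i, lshift M p).
pose E2 (i : 'I_n) (q : 'I_M) := E (i, rshift m q).
have G1 i p : sigma_gen setT (fun _ : unit => xi i p) (E1 i p).
  have := GE (i, lshift M p); rewrite (_ : white_coord _ = xi i p)//.
  by apply/funext => w; rewrite /white_coord/= (unsplitK (inl p)).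
have G2 i (q : 'I_M) : sigma_gen setT (fun _ : unit => fun w => W i (t q.+1) w - W i (t q) w) (E2 i q).
  have := GE (i, rshift m q).
  apply: (@sigma_gen_scale _ _ _ _ _ (Num.sqrt (t q.+1 - t q))^-1) => w.
  by rewrite /white_coord/= (unsplitK (inr q)).
have G2W i : sigma_gen unitI (W i) [set w | forall q, E2 i q w].
  apply: sigma_gen_bigcap => q; apply: sigma_gen_sub (G2 i q).
  by apply: measurable_funB; apply: sigma_gen_coord; rewrite /unitI/= in_itv/= t01.
have P2 i : P [set w | forall q, E2 i q w] = (\prod_q P (E2 i q))%E.
  have [_ _ _ ind _] := W_brownian i.
  apply: (mutually_independent_all (ind M t _ _ _)) => //.
  - by have /andP[] := t01 0.
  - by move=> j jM; have := tlt (Ordinal jM) => /ltW.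
  - by have /andP[] := t01 M.
pose F (a : ('I_n * 'I_m) + 'I_n) := match a with
  | inl (i, p) => E1 i p | inr i => [set w | forall q, E2 i q w] end.
have := mutually_independent_all indep (E := F).
rewrite (_ : [set w | forall j, F j w] = [set w | forall j, E j w]); last first.
  apply/seteqP; split => w /= h.
    move=> [i a]; rewrite -(fintype.splitK a); case: (fintype.split a) => [p|q] /=.
      exact: (h (inl (i, p))).
    exact: (h (inr i) q).
  by move=> [[i p]|i]; [exact: h|move=> q; exact: h].
move=> -> => [|[[i p]|i]]; [|exact: G1|exact: G2W].
rewrite big_sumType/= (eq_bigr (fun q => P (E1 q.1 q.2))); last by move=> [].
rewrite [RHS](eq_bigr (fun q => P (E (q.1, q.2)))); last by move=> [].
rewrite -(pair_bigA _ (fun i p => P (E1 i p)))/=.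
rewrite -big_split/= -(pair_bigA _ (fun i a => P (E (i, a))))/=.
apply: eq_bigr => i _; rewrite big_split_ord/=; congr (_ * _)%E.
exact: P2.
Qed.

End WhiteNoise.

(** * The observed coordinates as limits of Gaussian samples *)

Section InnerLimits.
Context {R : realType}.
Notation leb := (@leb1 R).
Implicit Types f g : R -> R.

Lemma cvg_ipl (u : nat -> R -> R) f h : (forall N, isL2 (u N)) -> isL2 f -> isL2 h ->
  norm2 (fun t => f t - u N t) @[N --> \oo] --> 0 ->
  ip (u N) h @[N --> \oo] --> ip f h.
Proof.
move=> Lu Lf Lh cu; apply/cvgrPdist_le => eps eps0.
have c0 : norm2 (fun t => f t - u N t) * norm2 h @[N --> \oo] --> 0.
  by rewrite -[X in _ --> X](mul0r (norm2 h)); apply: cvgM => //; exact: cvg_cst.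
move/cvgrPdist_le/(_ _ eps0): c0; apply: filterS => N; rewrite sub0r normrN.
rewrite ger0_norm ?mulr_ge0 ?sqrtr_ge0// => /(le_trans _); apply.
by rewrite -ipBl//; apply: ip_le_norm2 => //; exact: isL2B.
Qed.

Lemma cvg_ip (u v : nat -> R -> R) f h : (forall N, isL2 (u N)) -> (forall N, isL2 (v N)) ->
  isL2 f -> isL2 h ->
  norm2 (fun t => f t - u N t) @[N --> \oo] --> 0 ->
  norm2 (fun t => h t - v N t) @[N --> \oo] --> 0 ->
  ip (u N) (v N) @[N --> \oo] --> ip f h.
Proof.
move=> Lu Lv Lf Lh cu cv.
have E N : ip (u N) (v N) =
    ip (fun t => f t - u N t) (fun t => h t - v N t) - ip f h + ip (u N) h + ip (v N) f.
  rewrite ipBl//; last exact: isL2B.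
  rewrite !(ipC _ (fun t => h t - v N t)) !ipBl//.
  rewrite (ipC h f) (ipC h (u N)) (ipC (v N) (u N)); ring.
rewrite (funext E).
rewrite -[X in _ --> X](_ : 0 - ip f h + ip f h + ip h f = _); last first.
  by rewrite (ipC h); ring.
apply: cvgD; last exact: cvg_ipl.
apply: cvgD; last exact: cvg_ipl.
apply: cvgB; last exact: cvg_cst.
apply/cvgrPdist_le => eps eps0.
have c0 : norm2 (fun t => f t - u N t) * norm2 (fun t => h t - v N t) @[N --> \oo] --> 0.
  by rewrite -[X in _ --> X](mul0r 0); exact: cvgM.
move/cvgrPdist_le/(_ _ eps0): c0; apply: filterS => N; rewrite !sub0r !normrN.
rewrite [X in X <= _ -> _]ger0_norm ?mulr_ge0 ?sqrtr_ge0// => /(le_trans _); apply.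
by apply: ip_le_norm2 => //; exact: isL2B.
Qed.

Lemma prim_comb (I : finType) (c : I -> R) (F : I -> R -> R) x :
  (forall i, isL2 (F i)) -> 0 <= x <= 1 ->
  prim (fun u => \sum_i c i * F i u) x = \sum_i c i * prim (F i) x.
Proof.
move=> LF /andP[x0 x1]; pose D : set (measurableTypeR R) := [set` `[0, x]].
have mD : measurable D by exact: measurable_itv.
have DI : D `<=` @unitI R.
  by move=> y; rewrite /D /unitI/= !in_itv/= => /andP[-> /le_trans->].
have LD f : isL2 f -> L2 leb D f.
  move=> [mf if2]; split; first exact: (measurable_funS measurable_unitI DI mf).
  exact: (integrableS measurable_unitI mD DI if2).
have primE f : prim f x = dot leb D f (fun=> 1).
  by apply: eq_Rintegral => u _; rewrite mulr1.
have L1 : L2 leb D (fun=> 1).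
  apply/LD; have := isL2_indic (-1) (1 : R).
  apply: (L2_ae (mu := leb) (D := @unitI R)) => //.
    exact: measurable_unitI.
  apply: aeW => y /=; rewrite /unitI/= in_itv/= indicE => /andP[y0 y1].
  by rewrite mem_set//= in_itv/= y1 andbT; lra.
rewrite primE dot_combl//; last by move=> i; exact: LD.
by apply: eq_bigr => i _; rewrite primE.
Qed.

End InnerLimits.

Lemma cvge_sum0 (R : realType) (I : Type) (r : seq I) (u : I -> nat -> \bar R) :
  (forall i, u i @ \oo --> 0%E) -> (fun N => \sum_(i <- r) u i N)%E @ \oo --> 0%E.
Proof.
move=> cu; elim: r => [|i r IH].
  by under eq_fun do rewrite big_nil; exact: cvg_cst.
rewrite (_ : (fun N => _) = (fun N => u i N + \sum_(j <- r) u j N)%E); last first.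
  by apply/funext => N; rewrite big_cons.
by rewrite -[X in _ --> X](adde0 0%E); apply: cvgeD.
Qed.

Section WhiteNoiseLimit.
Context {R : realType} {d : measure_display} {T : measurableType d}.
Variables (P : probability T R) (n m L : nat) (sigma : R).
Variables (lam : 'I_m -> R) (phi : 'I_m -> R -> R) (e : nat -> R -> R).
Variables (W : 'I_n -> R -> T -> R) (xi : 'I_n -> 'I_m -> T -> R).
Variable X : 'I_n -> R -> T -> R.
Hypothesis lam_gt0 : forall p, 0 < lam p.
Hypothesis Lphi : forall p, isL2 (phi p).
Hypothesis W_brownian : forall i, brownian P (W i).
Hypothesis xi_gauss : forall i j, gaussian P 0 1 (xi i j).
Hypothesis indep : mutually_independent P
  (fun a : ('I_n * 'I_m) + 'I_n =>
     match a with
     | inl (i, j) => sigma_gen setT (fun _ : unit => xi i j)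
     | inr i => sigma_gen unitI (W i)
     end).
Hypothesis mX : forall i t, 0 <= t <= 1 -> measurable_fun setT (X i t).
Hypothesis XE : forall i, {ae P, forall w, forall t, 0 <= t <= 1 ->
  X i t w = X i 0 w + \int[leb1]_(u in [set` `[0, t]]) signal lam phi (xi i) u w
            + sigma * W i t w}.

Definition white_integral (g : @step_fun R) i w : R :=
  \sum_p Num.sqrt (lam p) * xi i p w * ip (step_val g) (phi p)
  + sigma * \sum_(j < steps g) height g j * (W i (knot g j.+1) w - W i (knot g j) w).

Lemma step_integral_white g i : step_valid g ->
  {ae P, forall w, step_integral g (X i) w = white_integral g i w}.
Proof.
move=> gv; have [k0 km k1] := gv; apply: filterS (XE i) => w Xw.
have k01 j : (j <= steps g)%N -> 0 <= knot g j <= 1 by exact: step_knot01.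
have sigE x : 0 <= x <= 1 ->
    \int[leb1]_(u in [set` `[0, x]]) signal lam phi (xi i) u w =
    \sum_p Num.sqrt (lam p) * xi i p w * prim (phi p) x.
  by move=> x01; rewrite -prim_comb.
rewrite /white_integral /step_integral mulr_sumr.
under [X in _ = X + _]eq_bigr do rewrite ip_step_prim// mulr_sumr.
rewrite exchange_big/= -big_split/=; apply: eq_bigr => j _.
rewrite (Xw (knot g j.+1)) ?(Xw (knot g j)) ?k01//; last exact: ltnW.
rewrite !sigE ?k01//; last exact: ltnW.
set S1 := \sum_p _ * prim _ (knot g j.+1); set S0 := \sum_p _ * prim _ (knot g j).
rewrite (_ : \sum_p _ = height g j * (S1 - S0)); first by ring.
by rewrite -sumrB mulr_sumr; apply: eq_bigr => p _; ring.
Qed.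

(** On a grid containing all the knots, the integrals of step functions are
linear in the amplitudes of the signal and the increments of the noise. *)
Lemma white_integral_gauss_sample (gs : 'I_n * 'I_L -> @step_fun R) :
  (forall j, step_valid (gs j)) ->
  gauss_sample P (fun i k => white_integral (gs (i, k)) i)
    (fun i => \matrix_(k, k') (\sum_p lam p * (ip (step_val (gs (i, k))) (phi p) *
                                               ip (step_val (gs (i, k'))) (phi p))
       + sigma ^+ 2 * ip (step_val (gs (i, k))) (step_val (gs (i, k'))))).
Proof.
move=> gv; have [ts tsE] : exists ts, ts = common_grid gs by eexists.
have ss : sorted <%R ts by rewrite tsE; exact: common_grid_sorted.
have ts01 x : x \in ts -> 0 <= x <= 1 by rewrite tsE; exact: common_grid01.
have gts k j : (j <= steps (gs k))%N -> knot (gs k) j \in ts.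
  by rewrite tsE; exact: mem_common_grid.
pose dt q := nth 0 ts q.+1 - nth 0 ts q.
have dt0 (q : 'I_(size ts).-1) : 0 < dt q by rewrite subr_gt0; exact: grid_lt.
exists (m + (size ts).-1)%N, (white_coord W xi (ts := ts)).
exists (fun i => \matrix_(k, a) match fintype.split a with
  | inl p => Num.sqrt (lam p) * ip (step_val (gs (i, k))) (phi p)
  | inr q => sigma * step_val (gs (i, k)) (nth 0 ts q.+1) * Num.sqrt (dt q) end).
split.
- by move=> j; exact: white_coord_gaussian.
- exact: white_coord_indep.
- move=> i k w; rewrite big_split_ord/= /white_integral; congr (_ + _).
    apply: eq_bigr => p _; rewrite mxE /white_coord/= (unsplitK (inl p)); ring.
  have [_ km _] := gv (i, k).
  rewrite (step_sum_grid ss (gts (i, k)) km (fun x => W i x w)) mulr_sumr.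
  apply: eq_bigr => q _; rewrite mxE /white_coord/= (unsplitK (inr q)).
  rewrite -/(dt q) -!mulrA; do 2 congr (_ * _).
  by rewrite mulVKf// gt_eqF// sqrtr_gt0.
move=> i; apply/matrixP => k k'; rewrite !mxE big_split_ord/=; congr (_ + _).
  apply: eq_bigr => p _; rewrite !mxE (unsplitK (inl p)).
  by rewrite mulrACA -expr2 sqr_sqrtr// ltW.
rewrite (ip_step_step ss ts01 (gv _) (gv _) (gts _) (gts _)) mulr_sumr; apply: eq_bigr => q _.
rewrite !mxE (unsplitK (inr q)) -/(dt q) -{1}(sqr_sqrtr (ltW (dt0 q))); ring.
Qed.

Variable Y : 'I_n -> nat -> T -> R.
Hypothesis Y_int : forall i k, stoch_integral P (X i) (e k) (Y i k).
Hypothesis Le : forall k, isL2 (e k).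

(** The squared errors of all the coordinates are added before extracting a
subsequence, so that it is the same for all of them. *)
Lemma white_limit : exists (y_ : nat -> 'I_n -> 'I_L -> T -> R)
    (V_ : nat -> 'I_n -> 'M[R]_L),
  [/\ forall N, gauss_sample P (y_ N) (V_ N),
      forall i k k', V_ N i k k' @[N --> \oo] -->
        \sum_p lam p * (ip (phi p) (e k) * ip (phi p) (e k')) + sigma ^+ 2 * ip (e k) (e k')
    & {ae P, forall w, forall i k, y_ N i k w @[N --> \oo] --> Y i k w}].
Proof.
have [gs gsP] := choice (fun ik : 'I_n * 'I_L => (Y_int ik.1 ik.2).2).
pose y_ N i k := white_integral (gs (i, k) N) i.
pose sv N i k := step_val (gs (i, k) N).
pose V_ N i : 'M[R]_L := \matrix_(k, k') (\sum_p lam p * (ip (sv N i k) (phi p) * ip (sv N i k') (phi p))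
       + sigma ^+ 2 * ip (sv N i k) (sv N i k')).
have gv ik N : step_valid (gs ik N) by case: (gsP ik).
have gsy N : gauss_sample P (y_ N) (V_ N).
  exact: (white_integral_gauss_sample (gs := fun ik => gs ik N)).
have my_ N i k : measurable_fun setT (y_ N i k).
  have [M [g [B [gN _ yE _]]]] := gsy N.
  have -> : y_ N i k = fun w => \sum_a B i k a * g (i, a) w by apply/funext => w.
  apply: measurable_sum => a; apply: measurable_funM => //.
  by case: (gN (i, a)).
have mY i k : measurable_fun setT (Y i k) by case: (Y_int i k).
pose Z N w := \sum_(ik : 'I_n * 'I_L) (Y ik.1 ik.2 w - y_ N ik.1 ik.2 w) ^+ 2.
have mZ N : measurable_fun setT (Z N).
  by apply: measurable_sum => ik; apply: measurable_funX; exact: measurable_funB.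
have Z0 N w : 0 <= Z N w by apply: sumr_ge0 => ik _; exact: sqr_ge0.
have cZ : (\int[P]_w (Z N w)%:E)%E @[N --> \oo] --> 0%E.
  have ZE N : (\int[P]_w (Z N w)%:E =
      \sum_(ik : 'I_n * 'I_L) 'E_P[(fun w => (Y ik.1 ik.2 w - step_integral (gs ik N) (X ik.1) w) ^+ 2)%R])%E.
    rewrite /Z; under eq_integral do rewrite -sumEFin.
    rewrite ge0_integral_sum//.
    - apply: eq_bigr => ik _; rewrite unlock; apply: ae_eq_integral => //.
      + apply/measurable_EFinP; apply: measurable_funX; exact: measurable_funB.
      + apply/measurable_EFinP; apply: measurable_funX; apply: measurable_funB => //.
        apply: measurable_sum => j; apply: measurable_funM => //.
        by apply: measurable_funB; apply: mX; apply: step_knot01 => //; exact: ltnW.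
      + apply: filterS (step_integral_white ik.1 (gv ik N)) => w Ew _.
        by rewrite Ew; case: (ik).
    - by move=> ik; apply/measurable_EFinP; apply: measurable_funX; exact: measurable_funB.
    - by move=> ik w _; rewrite lee_fin sqr_ge0.
  by rewrite (funext ZE); apply: cvge_sum0 => ik; case: (gsP ik).
have [nu nuk aeZ] := L1_ae_subseq mZ Z0 cZ.
have cnu : nu @ \oo --> \oo.
  apply/cvgnyPge => A; near=> k; apply: leq_trans (nuk k); near: k.
  exact: nbhs_infty_ge.
exists (fun N => y_ (nu N)), (fun N => V_ (nu N)); split.
- by [].
- move=> i k k'; apply: (cvg_comp nu (fun N => V_ N i k k') cnu).
  have csv (k1 : 'I_L) : norm2 (fun t => e k1 t - sv N i k1 t) @[N --> \oo] --> 0.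
    by case: (gsP (i, k1)).
  rewrite (_ : (fun N => V_ N i k k') = (fun N =>
      \sum_p lam p * (ip (sv N i k) (phi p) * ip (sv N i k') (phi p)) +
      sigma ^+ 2 * ip (sv N i k) (sv N i k'))); last by apply/funext => N; rewrite mxE.
  apply: cvgD.
    apply: cvg_sum_fun => p; apply: cvgM; first exact: cvg_cst.
    rewrite !(ipC (phi p)).
    by apply: cvgM; apply: cvg_ipl => // N; exact: isL2_step.
  apply: cvgM; first exact: cvg_cst.
  by apply: cvg_ip => // N; exact: isL2_step.
- apply: filterS aeZ => w /cvgrPdist_le cw i k.
  apply/cvgrPdist_le => eps eps0.
  have := cw _ (exprn_gt0 2 eps0); apply: filterS => N.
  rewrite sub0r normrN ger0_norm// => Zle.
  rewrite -ler_sqr ?nnegrE ?(ltW eps0)// real_normK ?num_real//; apply: le_trans Zle.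
  by rewrite /Z (bigD1 (i, k))//= lerDl sumr_ge0// => ik _; exact: sqr_ge0.
Unshelve. all: by end_near. Qed.

End WhiteNoiseLimit.

(** * Exponential moments of the noise *)

Section NoiseExp.
Context {R : realType} {d : measure_display} {T : measurableType d}.
Variables (P : probability T R) (n : nat) (sigma lmax : R) (e : nat -> R -> R).
Hypothesis be : orthonormal_basis e.
Variables (K : R * R -> R) (m : nat) (lam : 'I_m -> R) (phi : 'I_m -> R -> R).
Hypothesis Krep : spectral_rep lam phi K.

Let oe : Defs.orthonormal e. Proof. by case: be. Qed.

(** The coefficients are inner products with [K], whatever its representation. *)
Lemma coefmx_unique m' (lam' : 'I_m' -> R) (phi' : 'I_m' -> R -> R) l :
  spectral_rep lam' phi' K -> coefmx e lam' phi' l = coefmx e lam phi l.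
Proof.
move=> Krep'; apply/matrixP => j k.
have E (A : 'M[R]_l) : A j k = fdot A (delta_mx j k).
  rewrite fdotE (bigD1 j)//= (bigD1 k)//= mxE !eqxx mulr1 big1 ?addr0 => [|b bk].
    rewrite big1 ?addr0// => a aj; rewrite big1// => b _.
    by rewrite mxE (negbTE aj) mulr0.
  by rewrite mxE eqxx (negbTE bk) mulr0.
by rewrite !E -(ipsq_coefmx oe Krep) -(ipsq_coefmx oe Krep').
Qed.

Variables (X : 'I_n -> R -> T -> R) (Y : 'I_n -> nat -> T -> R).
Hypothesis wn : white_noise_sample P K sigma X.
Hypothesis YX : forall i k, stoch_integral P (X i) (e k) (Y i k).
Hypothesis lmax_gt0 : 0 < lmax.
Hypothesis K_lmax : (opnorm K <= lmax%:E)%E.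
Let S := lmax + sigma ^+ 2.

Let S0 : 0 < S. Proof. by rewrite ltr_wpDr// sqr_ge0. Qed.

Let Yl l i (k : 'I_l) w := Y i k w.

(** The representation of [K] that generates the data need not be the one in which
the bound is expressed. *)
Lemma observation_exp l (I2 : {pred 'I_n}) (F : ('I_n * 'I_l -> R) -> 'M[R]_l) tau :
  (forall k k', seqcont (fun u => F u k k')) ->
  (forall u, (F u)^T = F u) -> (forall u, fnorm2 (F u) <= 1) ->
  `|tau| * (2 * S) <= 8^-1 ->
  (\int[P]_w (expR (\sum_(i in I2) tau *
     (qform (F (hide_in I2 (Yl (l:=l)) w)) (obs (Yl (l:=l)) i w)
      - fdot (F (hide_in I2 (Yl (l:=l)) w)) (coefmx e lam phi l + sigma ^+ 2 *: 1%:M))))%:E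
   <= (expR (20 * (tau * S) ^+ 2 * #|I2|%:R))%:E)%E.
Proof.
move=> cF FT F1 tauS.
have [m' [lam' [phi' [W [xi [Krep' bW gxi ind [mX aeX]]]]]]] := wn.
have lam0 p : 0 < lam' p by case: Krep'.
have Lphi p : isL2 (phi' p) by case: Krep' => _ _ [].
have [y_ [V_ [gs cV cY]]] := white_limit l lam0 Lphi bW gxi ind mX aeX YX oe.1.
have mY i k : measurable_fun setT (@Yl l i k) by case: (YX i k).
have cV' i k k' : V_ N i k k' @[N --> \oo] -->
    (coefmx e lam phi l + sigma ^+ 2 *: 1%:M) k k'.
  rewrite -(coefmx_unique l Krep') !mxE; have := cV i k k'.
  by rewrite oe.2.
have VS (i : 'I_n) : psd (S *: 1%:M - (coefmx e lam phi l + sigma ^+ 2 *: 1%:M)).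
  rewrite /S scalerDl (addrC (coefmx _ _ _ _)) addrKA.
  exact: (coefmx_le be Krep l (ltW lmax_gt0) (eigenvalue_le Krep K_lmax)).
exact: (gauss_limit_exp I2 gs cV' mY cY S0 VS cF FT F1 tauS).
Qed.

Hypotheses (n2 : (2 <= n)%N) (n_even : ~~ odd n).

Definition noise l (Q : pred 'I_n) w : 'M[R]_l :=
  empmx l Q (fun i k => Y i k w) - sigma ^+ 2 *: 1%:M - coefmx e lam phi l.

(** The factor [n / 2] between the sum and the empirical mean of the half-sample
is absorbed in [theta]. *)
Lemma noise_exp l (Q : pred 'I_n) (F : ('I_n * 'I_l -> R) -> 'M[R]_l) theta :
  #|Q| = n./2 ->
  (forall k k', seqcont (fun u => F u k k')) ->
  (forall u, (F u)^T = F u) -> (forall u, fnorm2 (F u) <= 1) ->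
  `|theta| * (32 * S) <= n%:R ->
  (\int[P]_w (expR (theta * fdot (F (hide_in Q (Yl (l:=l)) w)) (noise l Q w)))%:E
   <= (expR (40 * (theta * S) ^+ 2 / n%:R))%:E)%E.
Proof.
move=> Qh cF FT F1 thS; have n0 : 0 < n%:R :> R by rewrite ltr0n (leq_trans _ n2).
have hn : (n./2)%:R = n%:R / 2 :> R.
  by rewrite -{2}(even_halfK n_even) -muln2 natrM mulfK.
pose tau := theta * (2 / n%:R).
have tauS : `|tau| * (2 * S) <= 8^-1.
  rewrite /tau normrM [`|2 / _|]ger0_norm ?divr_ge0 ?ler0n//.
  rewrite (_ : _ * _ = (`|theta| * (32 * S)) / n%:R / 8); last by field; exact: lt0r_neq0.
  by rewrite ler_pdivrMr// mulVf// ler_pdivrMr// mul1r.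
have := observation_exp Q cF FT F1 tauS.
have -> : 20 * (tau * S) ^+ 2 * #|Q|%:R = 40 * (theta * S) ^+ 2 / n%:R.
  by rewrite Qh hn /tau; field; exact: lt0r_neq0.
apply: le_trans; rewrite le_eqVlt; apply/orP; left; apply/eqP.
apply: eq_integral => w _; congr (expR _)%:E.
set D := F _; rewrite /noise -addrA -opprD fdotBr /tau -mulr_sumr sumrB.
rewrite sumr_const Qh -[_ *+ n./2]mulr_natr hn -mulrA; congr (_ * _).
rewrite /empmx fdotZr mulrBr; congr (_ - _).
  congr (_ * _).
  have sumE (B : 'I_n -> 'M[R]_l) : fdot D (\sum_(i | Q i) B i) = \sum_(i | Q i) fdot D (B i).
    by elim/big_rec2: _ => [|i x A _ <-]; rewrite ?fdotDr// fdotC fdot0l.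
  by rewrite sumE; apply: eq_bigr => i _; rewrite qform_fdot.
rewrite (addrC (coefmx e lam phi l)); field; exact: lt0r_neq0.
Qed.

Lemma noise_sym l Q w : (noise l Q w)^T = noise l Q w.
Proof.
have trB (A B : 'M[R]_l) : (A - B)^T = A^T - B^T by rewrite linearB.
rewrite /noise /empmx !trB !scale_trmx trmx1 (coefmx_psd e Krep l).1.
congr (_ *: _ - _ - _).
by rewrite linear_sum/=; apply: eq_bigr => i _; rewrite trmx_mul trmxK.
Qed.

End NoiseExp.

(** * The penalised estimator on the first half-sample *)

Section Pathwise.
Context {R : realType}.

Lemma sqr_le_expR (t : R) : 0 <= t -> t ^+ 2 <= 4 * expR t.
Proof.
move=> t0; have h := expR_ge1Dx (t / 2); have e0 := expR_ge0 (t / 2).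
have -> : expR t = expR (t / 2) ^+ 2 by rewrite expr2 -expRD -splitr.
nra.
Qed.

(** Fourth moments of the noise are thus read off its exponential moments. *)
Lemma fourth_le_expR (t : R) : t ^+ 4 <= 256 * (expR t + expR (- t)).
Proof.
wlog t0 : t / 0 <= t.
  move=> h; have [/h//|/ltW tle] := leP 0 t.
  have := h (- t); rewrite opprK oppr_ge0 exprNn -signr_odd/= expr0 mul1r addrC; exact.
have := sqr_le_expR (divr_ge0 t0 (ler0n R 2)).
have e0 := expR_ge0 (t / 2); have e1 := expR_ge0 (- t).
have -> : expR t = expR (t / 2) ^+ 2 by rewrite expr2 -expRD -splitr.
move: (expR (t / 2)) e0 => x x0 h.
have : ((t / 2) ^+ 2) ^+ 2 <= (4 * x) ^+ 2.
  by rewrite lerXn2r ?nnegrE ?sqr_ge0// mulr_ge0.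
rewrite !expr2 !exprS !expr0; lra.
Qed.

Lemma nat_le_expR (k : nat) : k%:R <= expR k%:R :> R.
Proof. by have := expR_ge1Dx (k%:R : R); lra. Qed.

(** The union bound over the net is kept as a sum of exponentials, which
dominates the indicator of the event where the noise exceeds the penalty. *)
Definition bad_event l (N : 'M[R]_l) (theta a : R) : R :=
  \sum_(v <- net l) (expR (theta * qform N v - theta * a) + expR (- theta * qform N v - theta * a)).

Lemma bad_event_ge0 l (N : 'M[R]_l) theta a : 0 <= bad_event N theta a.
Proof. by apply: sumr_ge0 => v _; rewrite addr_ge0 ?expR_ge0. Qed.

(** On the event where the form of [N] stays below [mu / 4] on the net, the fast
bound applies.  Otherwise [bad_event] is at least 1, and the crude bound is split by
[2 x^2 <= alpha x^4 + alpha^-1] in each entry. *)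
Lemma prox_error_pathwise l (K N A Q : 'M[R]_l) (mu theta alpha r : R) :
  0 <= mu -> 0 < theta -> 0 < alpha -> is_prox mu (K + N) A -> psd K -> N^T = N ->
  proj Q -> \tr Q <= r -> K *m Q = K ->
  fnorm2 (A - K) <= 4 * mu ^+ 2 * r +
    (\sum_j \sum_k alpha * N j k ^+ 4 + l%:R ^+ 2 / alpha * bad_event N theta (mu / 4)).
Proof.
move=> mu0 th0 al0 proxA psdK NT pQ trQ KQ.
have al_ge0 := ltW al0.
have S0 : 0 <= \sum_j \sum_k alpha * N j k ^+ 4.
  by do 2!(apply: sumr_ge0 => ? _); rewrite mulr_ge0// (exprM _ 2 2) sqr_ge0.
have B0 := bad_event_ge0 N theta (mu / 4).
have trQ0 : 0 <= \tr Q.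
  by rewrite -fnorm2_proj// fnorm2_ge0.
have mu2 : 0 <= mu ^+ 2 by exact: sqr_ge0.
have [good|] := boolP (all (fun v => `|qform N v| <= mu / 4) (net l)).
  have qN : forall v, `|qform N v| <= mu / 2 * fnorm2 v.
    move=> v; have := qform_net NT (t := mu / 4) (fun v vn => allP good v vn) v.
    by rewrite (_ : 2 * (mu / 4) = mu / 2)//; field.
  apply: (le_trans (prox_error_fast mu0 NT proxA psdK pQ KQ qN)).
  rewrite -[leLHS]addr0 lerD//; first by rewrite ler_wpM2l// mulr_ge0.
  by rewrite addr_ge0// mulr_ge0// divr_ge0 ?sqr_ge0.
rewrite -has_predC => /hasP[v vn]; rewrite /= -ltNge => vbad.
have B1 : 1 <= bad_event N theta (mu / 4).
  rewrite /bad_event (big_rem v)//=; apply: ler_wpDr.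
    by apply: sumr_ge0 => u _; rewrite addr_ge0 ?expR_ge0.
  move: (mu / 4) vbad => a; have [q0|q0] := leP 0 (qform N v).
    rewrite ger0_norm// => vbad; apply: ler_wpDr; first exact: expR_ge0.
    by rewrite -[leLHS]expR0 ler_expR -mulrBr; apply: mulr_ge0; rewrite ?subr_ge0; exact: ltW.
  rewrite ltr0_norm// => vbad; apply: ler_wpDl; first exact: expR_ge0.
  rewrite -[leLHS]expR0 ler_expR mulNr -mulrN -mulrBr.
  by apply: mulr_ge0; rewrite ?subr_ge0; exact: ltW.
apply: (le_trans (prox_error_crude mu0 proxA psdK pQ KQ)).
have h1 : 2 * fnorm2 N <= \sum_j \sum_k alpha * N j k ^+ 4 + l%:R ^+ 2 / alpha * bad_event N theta (mu / 4).
  apply: (@le_trans _ _ (\sum_j \sum_k (alpha * N j k ^+ 4 + 1 / alpha))).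
    rewrite fnorm2E mulr_sumr; apply: ler_sum => j _; rewrite mulr_sumr; apply: ler_sum => k _.
    rewrite -(@ler_pM2l _ alpha)// mulrDr mul1r divff ?gt_eqF// (exprM _ 2 2).
    have := sqr_ge0 (alpha * N j k ^+ 2 - 1); move: (N j k ^+ 2) => x; rewrite !expr2; lra.
  under eq_bigr do rewrite big_split/= sumr_const card_ord.
  rewrite big_split/= lerD2l sumr_const card_ord -mulrnA -[leLHS]mulr_natr mul1r natrM -expr2 mulrC.
  by rewrite ler_peMr// divr_ge0 ?sqr_ge0.
have h2 : mu ^+ 2 / 2 * \tr Q <= 4 * mu ^+ 2 * r.
  apply: (@le_trans _ _ (4 * mu ^+ 2 * \tr Q)); last by rewrite ler_wpM2l// mulr_ge0.
  by rewrite ler_wpM2r//; lra.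
by rewrite addrC lerD.
Qed.

End Pathwise.

Section FirstHalf.
Context {R : realType} {d : measure_display} {T : measurableType d}.
Variable P : probability T R.

Lemma integral_sum_le (I : eqType) (s : seq I) (f : I -> T -> R) (b : R) :
  (forall i, measurable_fun setT (f i)) -> (forall i w, 0 <= f i w) ->
  (forall i, i \in s -> (\int[P]_w (f i w)%:E <= b%:E)%E) ->
  (\int[P]_w (\sum_(i <- s) f i w)%:E <= ((size s)%:R * b)%:E)%E.
Proof.
move=> mf f0 fb; under eq_integral do rewrite -sumEFin.
rewrite ge0_integral_sum//; last 2 first.
- by move=> i; apply/measurable_EFinP.
- by move=> i w _; rewrite lee_fin.
rewrite big_seq; apply: (@le_trans _ _ (\sum_(i <- s | i \in s) b%:E)%E).
  exact: lee_sum.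
by rewrite -big_seq sumEFin big_const_seq count_predT iter_addr_0 mulr_natl.
Qed.

Lemma integral_ord_le k (f : 'I_k -> T -> R) (b : R) :
  (forall i, measurable_fun setT (f i)) -> (forall i w, 0 <= f i w) ->
  (forall i, (\int[P]_w (f i w)%:E <= b%:E)%E) ->
  (\int[P]_w (\sum_i f i w)%:E <= (k%:R * b)%:E)%E.
Proof.
move=> mf f0 fb; have := integral_sum_le mf f0 (fun i (_ : i \in index_enum 'I_k) => fb i).
by rewrite [X in size X]unlock -enumT size_enum_ord.
Qed.

Lemma integral_add_le (f g : T -> R) (a b : R) :
  measurable_fun setT f -> measurable_fun setT g ->
  (forall w, 0 <= f w) -> (forall w, 0 <= g w) ->
  (\int[P]_w (f w)%:E <= a%:E)%E -> (\int[P]_w (g w)%:E <= b%:E)%E ->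
  (\int[P]_w (f w + g w)%:E <= (a + b)%:E)%E.
Proof.
move=> mf mg f0 g0 fa gb; under eq_integral do rewrite EFinD.
rewrite ge0_integralD//; first by rewrite EFinD; exact: leeD.
- by move=> w _; rewrite lee_fin.
- exact/measurable_EFinP.
- by move=> w _; rewrite lee_fin.
- exact/measurable_EFinP.
Qed.

Lemma integral_scale_le (f : T -> R) (c a : R) :
  measurable_fun setT f -> (forall w, 0 <= f w) -> 0 <= c ->
  (\int[P]_w (f w)%:E <= a%:E)%E -> (\int[P]_w (c * f w)%:E <= (c * a)%:E)%E.
Proof.
move=> mf f0 c0 fa; under eq_integral do rewrite EFinM.
rewrite ge0_integralZl//; first by rewrite EFinM lee_wpmul2l.
- exact/measurable_EFinP.
- by move=> w _; rewrite lee_fin.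
Qed.

Lemma integral_mono_le (f g : T -> R) (a : R) :
  measurable_fun setT f -> measurable_fun setT g ->
  (forall w, 0 <= f w) -> (forall w, f w <= g w) ->
  (\int[P]_w (g w)%:E <= a%:E)%E -> (\int[P]_w (f w)%:E <= a%:E)%E.
Proof.
move=> mf mg f0 fg; apply: le_trans; apply: ge0_le_integral => //.
- by move=> w _; rewrite lee_fin.
- exact/measurable_EFinP.
- exact/measurable_EFinP.
- by move=> w _; rewrite lee_fin.
Qed.

Lemma integral_cst_le (a : R) : (\int[P]_w (a%:E) <= a%:E)%E.
Proof. by rewrite integral_cst//= probability_setT mule1. Qed.

Variables (n l : nat) (S mu r c0 : R) (N : T -> 'M[R]_l) (K Q : 'M[R]_l) (A : T -> 'M[R]_l).
Hypothesis l_gt0 : (0 < l)%N.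
Hypothesis ln : (l <= n)%N.
Hypothesis S_gt0 : 0 < S.
Hypothesis mN : forall j k, measurable_fun setT (fun w => N w j k).
Hypothesis mA : forall j k, measurable_fun setT (fun w => A w j k).
Hypothesis NT : forall w, (N w)^T = N w.
Hypothesis N_exp : forall D theta, D^T = D -> fnorm2 D <= 1 ->
  `|theta| * (32 * S) <= n%:R ->
  (\int[P]_w (expR (theta * fdot D (N w)))%:E <= (expR (40 * (theta * S) ^+ 2 / n%:R))%:E)%E.
Hypothesis A_prox : forall w, is_prox mu (K + N w) (A w).
Hypothesis psdK : psd K.
Hypothesis projQ : proj Q.
Hypothesis trQ : \tr Q <= r.
Hypothesis KQ : K *m Q = K.
Hypothesis c0E : c0 = 1408.
Hypothesis mu_ge : 2 * c0 * S * Num.sqrt (l%:R / n%:R) <= mu.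
Hypothesis mu_le : mu <= 4 * c0 * S * Num.sqrt (l%:R / n%:R).

Let c00 : 0 < c0. Proof. by rewrite c0E ltr0n. Qed.
Let n0 : 0 < n%:R :> R. Proof. by rewrite ltr0n (leq_trans l_gt0). Qed.
Let l0 : 0 < l%:R :> R. Proof. by rewrite ltr0n. Qed.
Let lnR : l%:R <= n%:R :> R. Proof. by rewrite ler_nat. Qed.

Lemma measurable_fdot D : measurable_fun setT (fun w => fdot D (N w)).
Proof.
under eq_fun do rewrite fdotE.
by do 2!(apply: measurable_sum => ?); exact: measurable_funM.
Qed.

(** An entry of a symmetric matrix is its inner product with a symmetric matrix of
norm at most 1. *)
Lemma noise_entry4 j k : (\int[P]_w (N w j k ^+ 4)%:E <=
  (512 * expR 1 * (32 * S) ^+ 4 / n%:R ^+ 2)%:E)%E.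
Proof.
pose D : 'M[R]_l := 2^-1 *: (delta_mx j k + delta_mx k j).
have DT : D^T = D by rewrite /D scale_trmx linearD/= !trmx_delta addrC.
have deltaE (B : 'M[R]_l) a b : fdot (delta_mx a b) B = B a b.
  rewrite fdotE (bigD1 a)//= (bigD1 b)//= mxE !eqxx mul1r big1 ?addr0 => [|b' bb].
    rewrite big1 ?addr0// => a' aa; rewrite big1// => b' _.
    by rewrite mxE (negbTE aa) mul0r.
  by rewrite mxE eqxx (negbTE bb) mul0r.
have DN w : fdot D (N w) = N w j k.
  by rewrite /D fdotZl fdotDl !deltaE -{2}(NT w) mxE; field.
have D1 : fnorm2 D <= 1.
  rewrite /D fnorm2Z /fnorm2 fdotDl !deltaE !mxE !eqxx.
  by rewrite (eq_sym k j); case: (j == k) => /=; rewrite ?mulr1n ?mulr0n; lra.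
pose th := Num.sqrt n%:R / (32 * S).
have th0 : 0 < th by rewrite divr_gt0 ?sqrtr_gt0// mulr_gt0.
have sn2 : Num.sqrt n%:R ^+ 2 = n%:R :> R by rewrite sqr_sqrtr ?ler0n.
have th2 : (th * S) ^+ 2 / n%:R = 1024^-1.
  by rewrite /th exprMn exprMn sn2; field; rewrite !gt_eqF.
have E1 t : `|t| = th -> (\int[P]_w (expR (t * N w j k))%:E <= (expR 1)%:E)%E.
  move=> tth; under eq_integral do rewrite -DN.
  apply: (le_trans (N_exp DT D1 _)).
    rewrite tth /th mulfVK; last by rewrite gt_eqF// mulr_gt0.
    rewrite -{2}sn2 expr2 ler_peMl ?sqrtr_ge0// -[leLHS]sqrtr1 ler_wsqrtr//.
    by rewrite ler1n (leq_trans l_gt0).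
  rewrite lee_fin ler_expR -mulrA exprMn -(real_normK (num_real t)) tth -exprMn th2; lra.
apply: (@integral_mono_le _ (fun w => 256 / th ^+ 4 * (expR (th * N w j k) + expR (- th * N w j k)))).
- by apply: measurable_funX.
- apply: measurable_funM => //; apply: measurable_funD.
    by apply: (measurableT_comp (@measurable_expR R)); exact: measurable_funM.
  by apply: (measurableT_comp (@measurable_expR R)); exact: measurable_funM.
- by move=> w; rewrite (exprM _ 2 2) sqr_ge0.
- move=> w; have := fourth_le_expR (th * N w j k).
  by rewrite exprMn mulNr [X in _ -> _ <= X]mulrAC ler_pdivlMr ?exprn_gt0// mulrC.
have -> : 512 * expR 1 * (32 * S) ^+ 4 / n%:R ^+ 2 = 256 / th ^+ 4 * (expR 1 + expR 1).
  rewrite /th expr_div_n (exprM (Num.sqrt _) 2 2) sn2; field; rewrite !gt_eqF//.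
apply: integral_scale_le.
- apply: measurable_funD.
    by apply: (measurableT_comp (@measurable_expR R)); exact: measurable_funM.
  by apply: (measurableT_comp (@measurable_expR R)); exact: measurable_funM.
- by move=> w; rewrite addr_ge0 ?expR_ge0.
- by rewrite divr_ge0// exprn_ge0// ltW.
apply: integral_add_le.
- by apply: (measurableT_comp (@measurable_expR R)); exact: measurable_funM.
- by apply: (measurableT_comp (@measurable_expR R)); exact: measurable_funM.
- by move=> w; exact: expR_ge0.
- by move=> w; exact: expR_ge0.
- by apply: E1; rewrite gtr0_norm.
- by apply: E1; rewrite normrN gtr0_norm.
Qed.

Let th := Num.sqrt (n%:R * l%:R) / (32 * S).

Let th_gt0 : 0 < th.
Proof. by rewrite divr_gt0 ?sqrtr_gt0 ?mulr_gt0. Qed.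

Lemma measurable_bad_event a : measurable_fun setT (fun w => bad_event (N w) th a).
Proof.
apply: measurable_sum => v; under eq_fun do rewrite !qform_fdot ![fdot (N _) _]fdotC.
apply: measurable_funD.
  apply: (measurableT_comp (@measurable_expR R)); apply: measurable_funB => //.
  by apply: measurable_funM => //; exact: measurable_fdot.
apply: (measurableT_comp (@measurable_expR R)); apply: measurable_funB => //.
by apply: measurable_funM => //; exact: measurable_fdot.
Qed.

(** The penalty level exceeds the fluctuations of [qform N v] by a factor that
beats the cardinality of the net. *)
Lemma bad_event_le : (\int[P]_w (bad_event (N w) th (mu / 4))%:E <= (2 * expR (- 3 * l%:R))%:E)%E.
Proof.
have snl2 : Num.sqrt (n%:R * l%:R) ^+ 2 = n%:R * l%:R :> R by rewrite sqr_sqrtr ?mulr_ge0.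
have th2 : (th * S) ^+ 2 / n%:R = l%:R / 1024.
  by rewrite /th exprMn exprMn snl2; field; rewrite !gt_eqF.
have thn : th * (32 * S) <= n%:R.
  rewrite /th mulfVK; last by rewrite gt_eqF// mulr_gt0.
  rewrite -ler_sqr ?nnegrE ?sqrtr_ge0 ?(ltW n0)// snl2 expr2.
  by rewrite ler_pM2l.
have tha : 22 * l%:R <= th * (mu / 4).
  apply: (@le_trans _ _ (th * (2 * c0 * S * Num.sqrt (l%:R / n%:R) / 4))).
    have lE : l%:R = Num.sqrt (n%:R * l%:R) * Num.sqrt (l%:R / n%:R) :> R.
      rewrite -sqrtrM ?mulr_ge0//.
      rewrite (_ : _ * _ = l%:R ^+ 2) ?sqrtr_sqr ?ger0_norm//; last first.
      by field; exact: lt0r_neq0.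
    rewrite {1}lE c0E /th le_eqVlt; apply/orP; left; apply/eqP.
    by field; exact: lt0r_neq0.
  by rewrite ler_wpM2l ?(ltW th_gt0)// ler_wpM2r.
have E1 v t : fnorm2 v <= 1 -> `|t| = th ->
    (\int[P]_w (expR (t * qform (N w) v - th * (mu / 4)))%:E <= (expR (- 21 * l%:R))%:E)%E.
  move=> v1 tth; pose D := v^T *m v.
  have DT : D^T = D by rewrite /D trmx_mul trmxK.
  have D1 : fnorm2 D <= 1.
    by rewrite /fnorm2 fdot_outer -expr2 expr_le1// fnorm2_ge0.
  have NE : (\int[P]_w (expR (t * fdot D (N w)))%:E <= (expR (40 * (t * S) ^+ 2 / n%:R))%:E)%E.
    by apply: N_exp => //; rewrite tth.
  apply: (@integral_mono_le _ (fun w => expR (- (th * (mu / 4))) * expR (t * fdot D (N w)))).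
  - apply: (measurableT_comp (@measurable_expR R)); apply: measurable_funB => //.
    apply: measurable_funM => //; under eq_fun do rewrite qform_fdot fdotC.
    exact: measurable_fdot.
  - apply: measurable_funM => //; apply: (measurableT_comp (@measurable_expR R)).
    by apply: measurable_funM => //; exact: measurable_fdot.
  - by move=> w; exact: expR_ge0.
  - by move=> w; rewrite -expRD qform_fdot fdotC addrC.
  apply: (le_trans (integral_scale_le _ _ _ NE)).
  - apply: (measurableT_comp (@measurable_expR R)).
    by apply: measurable_funM => //; exact: measurable_fdot.
  - by move=> w; exact: expR_ge0.
  - exact: expR_ge0.
  rewrite lee_fin -expRD ler_expR -[40 * _ / _]mulrA exprMn -(real_normK (num_real t)) tth -exprMn th2.
  by have := l0; lra.
have mE (t : R) v : measurable_fun setT (fun w => expR (t * qform (N w) v - th * (mu / 4))).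
  apply: (measurableT_comp (@measurable_expR R)); apply: measurable_funB => //.
  apply: measurable_funM => //; under eq_fun do rewrite qform_fdot fdotC.
  exact: measurable_fdot.
have h := @integral_sum_le _ (net l) (fun v w => expR (th * qform (N w) v - th * (mu / 4)) +
   expR (- th * qform (N w) v - th * (mu / 4))) (expR (- 21 * l%:R) + expR (- 21 * l%:R)).
apply: (le_trans (h _ _ _)).
- by move=> v; exact: measurable_funD.
- by move=> v w; rewrite addr_ge0 ?expR_ge0.
- move=> v vn; apply: integral_add_le => //; try by move=> w; exact: expR_ge0.
    by apply: E1; [exact: fnorm2_net|rewrite gtr0_norm].
  by apply: E1; [exact: fnorm2_net|rewrite normrN gtr0_norm].
rewrite lee_fin -mulr2n -[_ *+ 2]mulr_natl mulrCA ler_pM2l//.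
have -> : - 3 * l%:R = 18 * l%:R + - 21 * l%:R :> R by ring.
rewrite expRD ler_wpM2r ?expR_ge0//; apply: (le_trans (size_net l)).
have e2 : 2 <= expR 1 :> R by have := expR_ge1Dx (1 : R); lra.
have -> : 18 * l%:R = (18 * l)%:R * 1 :> R by rewrite mulr1 natrM.
by rewrite expRM_natl lerXn2r ?nnegrE ?expR_ge0.
Qed.

Definition risk_cst (c : R) : R := 64 * c ^+ 2 + 512 * 32 ^+ 4 * expR 1 + 2.

(** The parameter [alpha] balances the fourth moments of the noise against the
probability of the bad event, which is exponentially small in [l]. *)
Lemma first_half_risk : 0 <= r ->
  (\int[P]_w (fnorm2 (A w - K))%:E <=
    (risk_cst c0 * S ^+ 2 * ((r + 1) * l%:R / n%:R))%:E)%E.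
Proof.
move=> r0.
have S2 : 0 < S ^+ 2 by exact: exprn_gt0.
pose alpha := n%:R / (S ^+ 2 * l%:R).
have al0 : 0 < alpha by rewrite divr_gt0// mulr_gt0.
have mu0 : 0 <= mu.
  apply: le_trans mu_ge; apply: mulr_ge0; last exact: sqrtr_ge0.
  by apply: mulr_ge0; last exact: ltW; apply: mulr_ge0 => //; exact: ltW.
have mu2 : mu ^+ 2 <= (4 * c0) ^+ 2 * S ^+ 2 * (l%:R / n%:R).
  have -> : (4 * c0) ^+ 2 * S ^+ 2 * (l%:R / n%:R) =
      (4 * c0 * S * Num.sqrt (l%:R / n%:R)) ^+ 2.
    by rewrite !exprMn sqr_sqrtr// divr_ge0.
  by rewrite lerXn2r ?nnegrE ?(le_trans mu0).
have m4 j k : measurable_fun setT (fun w => alpha * N w j k ^+ 4).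
  by apply: measurable_funM => //; exact: measurable_funX.
have p4 j k w : 0 <= alpha * N w j k ^+ 4.
  by rewrite mulr_ge0 ?(ltW al0)// (exprM _ 2 2) sqr_ge0.
apply: (@integral_mono_le _ (fun w => 4 * mu ^+ 2 * r +
    (\sum_j \sum_k alpha * N w j k ^+ 4 + l%:R ^+ 2 / alpha * bad_event (N w) th (mu / 4)))).
- under eq_fun do rewrite fnorm2E.
  do 2!(apply: measurable_sum => ?); apply: measurable_funX.
  under eq_fun do rewrite !mxE; exact: measurable_funB.
- apply: measurable_funD => //; apply: measurable_funD.
    by do 2!(apply: measurable_sum => ?).
  by apply: measurable_funM => //; exact: measurable_bad_event.
- by move=> w; exact: fnorm2_ge0.
- by move=> w; apply: (prox_error_pathwise mu0 th_gt0 al0 (A_prox w) psdK (NT w) projQ trQ KQ).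
set E4 := 512 * expR 1 * (32 * S) ^+ 4 / n%:R ^+ 2.
apply: (@le_trans _ _ (4 * mu ^+ 2 * r + (l%:R * (l%:R * (alpha * E4)) +
    l%:R ^+ 2 / alpha * (2 * expR (- 3 * l%:R))))%:E).
  have sE : (\int[P]_w (\sum_j \sum_k alpha * N w j k ^+ 4)%:E <= (l%:R * (l%:R * (alpha * E4)))%:E)%E.
    apply: integral_ord_le => [j|j w|j].
    - by apply: measurable_sum => ?.
    - exact: sumr_ge0.
    apply: integral_ord_le => [//|//|k].
    apply: integral_scale_le => //; [exact: measurable_funX| |exact: ltW|exact: noise_entry4].
    by move=> w; rewrite (exprM _ 2 2) sqr_ge0.
  apply: integral_add_le => //.
  - apply: measurable_funD; first by do 2!(apply: measurable_sum => ?).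
    by apply: measurable_funM => //; exact: measurable_bad_event.
  - by move=> w; rewrite mulr_ge0// mulr_ge0// sqr_ge0.
  - move=> w; rewrite addr_ge0//; first by do 2!(apply: sumr_ge0 => ? _).
    by rewrite mulr_ge0 ?bad_event_ge0// divr_ge0 ?sqr_ge0// ltW.
  - exact: integral_cst_le.
  apply: integral_add_le => //.
  - by do 2!(apply: measurable_sum => ?).
  - by apply: measurable_funM => //; exact: measurable_bad_event.
  - by move=> w; do 2!(apply: sumr_ge0 => ? _).
  - by move=> w; rewrite mulr_ge0 ?bad_event_ge0// divr_ge0 ?sqr_ge0// ltW.
  apply: integral_scale_le; [exact: measurable_bad_event| | |exact: bad_event_le].
  - by move=> w; exact: bad_event_ge0.
  - by rewrite divr_ge0 ?sqr_ge0// ltW.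
rewrite lee_fin.
pose q := S ^+ 2 * (l%:R / n%:R).
have q0 : 0 < q by rewrite mulr_gt0// divr_gt0.
have h1 : 4 * mu ^+ 2 * r <= 64 * c0 ^+ 2 * q * r.
  rewrite ler_wpM2r// (_ : 64 * c0 ^+ 2 * q = 4 * ((4 * c0) ^+ 2 * S ^+ 2 * (l%:R / n%:R))).
    by rewrite ler_wpM2l.
  by rewrite /q; ring.
have h2 : l%:R * (l%:R * (alpha * E4)) = 512 * 32 ^+ 4 * expR 1 * q.
  by rewrite /alpha /E4 /q; field; rewrite !gt_eqF.
have h3 : l%:R ^+ 2 / alpha * (2 * expR (- 3 * l%:R)) <= 2 * q.
  have -> : l%:R ^+ 2 / alpha * (2 * expR (- 3 * l%:R)) = 2 * q * (l%:R ^+ 2 * expR (- 3 * l%:R)).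
    by rewrite /alpha /q; field; rewrite !gt_eqF.
  rewrite -[leRHS]mulr1; apply: ler_wpM2l; first by rewrite mulr_ge0// ltW.
  apply: (@le_trans _ _ (expR l%:R ^+ 2 * expR (- 3 * l%:R))).
    by rewrite ler_wpM2r ?expR_ge0// lerXn2r ?nnegrE ?expR_ge0// nat_le_expR.
  by rewrite expr2 -!expRD -[leRHS]expR0 ler_expR; have := l0; lra.
have -> : risk_cst c0 * S ^+ 2 * ((r + 1) * l%:R / n%:R) = risk_cst c0 * q * (r + 1).
  by rewrite /q; field; exact: lt0r_neq0.
have b0 : 0 <= 512 * 32 ^+ 4 * expR 1 :> R.
  by rewrite !mulr_ge0 ?exprn_ge0 ?ler0n ?expR_ge0.
have a0 : 0 <= 64 * c0 ^+ 2 by rewrite mulr_ge0 ?sqr_ge0.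
rewrite h2 /risk_cst; move: h1 h3 a0 b0; move: (64 * _) (512 * _ * _) => a b h1 h3 a0 b0.
apply: (le_trans (lerD h1 (lerD (lexx _) h3))); have q1 := ltW q0.
rewrite -subr_ge0 (_ : _ - _ = a * q + b * (q * r) + 2 * (q * r)); last by ring.
have qr : 0 <= q * r by exact: mulr_ge0.
by apply: addr_ge0; [apply: addr_ge0|]; apply: mulr_ge0.
Qed.

End FirstHalf.

(** * Aggregation on the second half-sample *)

Section McShane.
Context {R : realType}.

Lemma fnormD m n (A B : 'M[R]_(m, n)) : fnorm (A + B) <= fnorm A + fnorm B.
Proof.
rewrite -ler_sqr ?nnegrE ?fnorm_ge0 ?addr_ge0 ?fnorm_ge0// sqrrD !sqr_fnorm fnorm2D.
have := le_trans (ler_norm _) (ler_fdot A B); lra.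
Qed.

Lemma fnormBC m n (A B : 'M[R]_(m, n)) : fnorm (A - B) = fnorm (B - A).
Proof. by rewrite -opprB /fnorm -[- _]scaleN1r fnorm2Z expr2 mulrNN mulr1 mul1r. Qed.

Lemma fnorm_entry m n (A : 'M[R]_(m, n)) i j : `|A i j| <= fnorm A.
Proof.
by rewrite -ler_sqr ?nnegrE ?fnorm_ge0// real_normK ?num_real// sqr_fnorm fnorm2_entry.
Qed.

(** McShane's extension: the infimum over [b] of the functions
[f b + fnorm (a - b)] of [a]. *)
Lemma mcshane l (D : set 'M[R]_l) (f : 'M[R]_l -> R) :
  (forall a b, D a -> D b -> `|f a - f b| <= fnorm (a - b)) ->
  exists F : 'M[R]_l -> R,
    (forall a, D a -> F a = f a) /\ (forall a b, `|F a - F b| <= fnorm (a - b)).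
Proof.
move=> lf; have [[b0 Db0]|D0] := pselect (D !=set0); last first.
  exists (fun=> 0); split=> [a Da|a b]; first by case: D0; exists a.
  by rewrite subrr normr0 fnorm_ge0.
pose E a := [set f b + fnorm (a - b) | b in D].
have E0 a : E a !=set0 by exists (f b0 + fnorm (a - b0)), b0.
have lbE a : has_lbound (E a).
  exists (f b0 - fnorm (a - b0)) => _ [b Db <-].
  have := le_trans (ler_norm _) (lf _ _ Db0 Db).
  have := fnormD (b0 - a) (a - b); rewrite addrA subrK (fnormBC b0 a); lra.
have Fle a b : inf (E a) - fnorm (a - b) <= inf (E b).
  apply: lb_le_inf => // _ [c Dc <-].
  have : inf (E a) <= f c + fnorm (a - c) by apply: ge_inf => //; exists c.
  have := fnormD (a - b) (b - c); rewrite addrA subrK; lra.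
exists (fun a => inf (E a)); split=> [a Da|a b].
  apply/eqP; rewrite eq_le; apply/andP; split.
    apply: ge_inf => //; exists a => //.
    by rewrite subrr /fnorm /fnorm2 fdot0l sqrtr0 addr0.
  apply: lb_le_inf => // _ [b Db <-].
  by have := le_trans (ler_norm _) (lf _ _ Da Db); lra.
have := Fle a b; have := Fle b a; rewrite (fnormBC b a) ler_norml.
by move: (inf _) (inf _) (fnorm _) => x y z; lra.
Qed.

(** The estimator is only known where the minimum is attained; it extends to
a globally Lipschitz, hence continuous, function of the empirical matrix. *)
Lemma prox_extension l (mu : R) : exists F : 'M[R]_l -> 'M[R]_l,
  [/\ forall G A, is_prox mu G A -> F G = A,
      forall G, (F G)^T = F G
    & forall G G' j k, `|F G j k - F G' j k| <= fnorm (G - G')].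
Proof.
pose D : set 'M[R]_l := [set G | exists A, is_prox mu G A].
have [f fP] : exists f, forall G, D G -> is_prox mu G (f G).
  have ex G : exists A, D G -> is_prox mu G A.
    by have [[A pA]|nD] := pselect (D G); [exists A|exists 0].
  by have [f fP] := choice ex; exists f.
have lf j k a b : D a -> D b -> `|f a j k - f b j k| <= fnorm (a - b).
  move=> /fP pa /fP pb; apply: le_trans (prox_lipschitz pa pb).
  by have := fnorm_entry (f a - f b) j k; rewrite !mxE.
have [F0 F0P] := choice (fun jk : 'I_l * 'I_l => mcshane (fun a b => @lf jk.1 jk.2 a b)).
pose F G : 'M[R]_l := \matrix_(j, k) (2^-1 * (F0 (j, k) G + F0 (k, j) G)).
exists F; split.
- move=> G A pA; have DG : D G by exists A.
  have fA : f G = A.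
    apply/eqP; rewrite -subr_eq0; apply/eqP/matrixP => j k; rewrite [RHS]mxE.
    have := le_trans (fnorm_entry (f G - A) j k) (prox_lipschitz (fP _ DG) pA).
    rewrite subrr [X in _ <= X]/fnorm /fnorm2 fdot0l sqrtr0 normr_le0; exact: eqP.
  apply/matrixP => j k; rewrite mxE !(F0P _).1//= fA.
  have AT : A^T = A by case: pA => -[].
  by rewrite -{2}AT mxE; field.
- by move=> G; apply/matrixP => j k; rewrite !mxE addrC.
- move=> G G' j k; rewrite !mxE -mulrBr normrM ger0_norm ?invr_ge0//.
  have := (F0P (j, k)).2 G G'; have := (F0P (k, j)).2 G G'.
  have := ler_normD (F0 (j, k) G - F0 (j, k) G') (F0 (k, j) G - F0 (k, j) G').
  rewrite [X in `|X| <= _ -> _](_ : _ = F0 (j, k) G + F0 (k, j) G - (F0 (j, k) G' + F0 (k, j) G')).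
    lra.
  by ring.
Qed.

End McShane.

Section Padding.
Context {R : realType}.
Variables (l n : nat).
Hypothesis ln : (l <= n)%N.

Definition corner : 'M[R]_(l, n) := \matrix_(j, k) (j == k :> nat)%:R.
Definition pad (A : 'M[R]_l) : 'M[R]_n := corner^T *m A *m corner.
Definition crop (B : 'M[R]_n) : 'M[R]_l := corner *m B *m corner^T.

Lemma fdot_pad A B : fdot (pad A) B = fdot A (crop B).
Proof. by rewrite /pad fdot_mulr fdot_mull trmxK mulmxA. Qed.

Lemma cropE B j k : crop B j k = B (widen_ord ln j) (widen_ord ln k).
Proof.
have cE a b : corner a b = (a == b :> nat)%:R by rewrite mxE.
have cTE a b : corner^T b a = (a == b :> nat)%:R by rewrite mxE cE.
have ne (a : 'I_l) (b : 'I_n) : b != widen_ord ln a -> (a == b :> nat) = false.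
  by move=> ab; apply/negbTE; apply: contraNN ab => /eqP ab; apply/eqP/val_inj.
rewrite mxE (bigD1 (widen_ord ln k))//= big1 => [|k' kk]; last first.
  by rewrite cTE ne ?mulr0.
rewrite addr0 cTE eqxx mulr1 mxE (bigD1 (widen_ord ln j))//= big1 => [|k' kk]; last first.
  by rewrite cE ne ?mul0r.
by rewrite addr0 cE eqxx mul1r.
Qed.

Lemma corner_crop : crop 1%:M = 1%:M.
Proof. by apply/matrixP => j k; rewrite cropE !mxE. Qed.

Lemma crop_pad A : crop (pad A) = A.
Proof.
have E : corner *m corner^T = 1%:M by have := corner_crop; rewrite /crop mulmx1.
by rewrite /crop /pad !mulmxA E mul1mx -mulmxA E mulmx1.
Qed.

Lemma fnorm2_pad A : fnorm2 (pad A) = fnorm2 A.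
Proof. by rewrite /fnorm2 fdot_pad crop_pad. Qed.

Lemma padT A : A^T = A -> (pad A)^T = pad A.
Proof. by move=> AT; rewrite /pad !trmx_mul trmxK AT mulmxA. Qed.

End Padding.

Section Oracle.
Context {R : realType}.

Lemma aggregation_scalar (a b x E q Z : R) : q ^+ 2 = x + E ->
  x <= 2 * a + 2 * b -> a - b <= 2 * (q * Z) -> a <= 3 * b + E / 2 + 8 * Z ^+ 2.
Proof.
move=> q2 xab ab; have := sqr_ge0 (q - 4 * Z).
have -> : (q - 4 * Z) ^+ 2 = q ^+ 2 - 8 * (q * Z) + 16 * Z ^+ 2 by ring.
rewrite q2; move: (q * Z) (Z ^+ 2) ab => u v ab; lra.
Qed.

(** The comparison of the objectives gives
[|B1 - K|^2 - |B0 - K|^2 <= 2 <B1 - B0, N>].  The right-hand side is linear in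
the noise along the direction [B1 - B0], and half of [|B1 - K|^2] is absorbed on the left.
The constant [eps] keeps the normalised direction continuous where [B1 = B0]. *)
Lemma aggregation_oracle n (K N B0 B1 : 'M[R]_n) (eps : R) : 0 < eps ->
  fnorm2 B1 - 2 * fdot B1 (K + N) <= fnorm2 B0 - 2 * fdot B0 (K + N) ->
  fnorm2 (B1 - K) <= 3 * fnorm2 (B0 - K) + eps ^+ 2 / 2 +
    8 * (fdot ((Num.sqrt (fnorm2 (B1 - B0) + eps ^+ 2))^-1 *: (B1 - B0)) N) ^+ 2.
Proof.
move=> eps0; set x2 := fnorm2 (B1 - B0); set q := Num.sqrt _; rewrite fdotZl.
have e2 : 0 < eps ^+ 2 by exact: exprn_gt0.
have x20 : 0 <= x2 by exact: fnorm2_ge0.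
have q0 : 0 < q by rewrite sqrtr_gt0; lra.
have q2 : q ^+ 2 = x2 + eps ^+ 2 by rewrite sqr_sqrtr//; lra.
set Z := q^-1 * _; have ZE : fdot (B1 - B0) N = q * Z by rewrite mulVKf// gt_eqF.
have par : x2 <= 2 * fnorm2 (B1 - K) + 2 * fnorm2 (B0 - K).
  have := fnorm2_ge0 ((B1 - K) + (B0 - K)).
  rewrite /x2 -[B1 - B0](_ : (B1 - K) - (B0 - K) = _); last by rewrite opprB addrA subrK.
  rewrite fnorm2D (fnorm2B (B1 - K) (B0 - K)); lra.
rewrite !fdotDr; move: ZE; rewrite fdotBl => ZE hB.
have : fnorm2 (B1 - K) - fnorm2 (B0 - K) <= 2 * (q * Z).
  rewrite (fnorm2B B1) (fnorm2B B0) -ZE; lra.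
exact: aggregation_scalar q2 par.
Qed.

End Oracle.

(** * The oracle inequality *)

Section SeqContCalculus.
Context {R : realType} (I : Type).
Implicit Types f g : (I -> R) -> R.

Lemma seqcont_coord i : seqcont (fun u : I -> R => u i).
Proof. by move=> u_ u; exact. Qed.

Lemma seqcont_cst (c : R) : seqcont (fun _ : I -> R => c).
Proof. by move=> u_ u _; exact: cvg_cst. Qed.

Lemma seqcontD f g : seqcont f -> seqcont g -> seqcont (fun u => f u + g u).
Proof. by move=> cf cg u_ u cu; apply: cvgD; [exact: cf|exact: cg]. Qed.

Lemma seqcontB f g : seqcont f -> seqcont g -> seqcont (fun u => f u - g u).
Proof. by move=> cf cg u_ u cu; apply: cvgB; [exact: cf|exact: cg]. Qed.

Lemma seqcontM f g : seqcont f -> seqcont g -> seqcont (fun u => f u * g u).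
Proof. by move=> cf cg u_ u cu; apply: cvgM; [exact: cf|exact: cg]. Qed.

Lemma seqcont_sum (J : Type) (r : seq J) (Q : pred J) (F : J -> (I -> R) -> R) :
  (forall j, seqcont (F j)) -> seqcont (fun u => \sum_(j <- r | Q j) F j u).
Proof.
move=> cF; elim: r => [|j r IH].
  by under eq_fun do rewrite big_nil; exact: seqcont_cst.
under eq_fun do rewrite big_cons; case: (Q j) => //; exact: seqcontD.
Qed.

Lemma seqcont_inv_sqrt f : (forall u, 0 < f u) -> seqcont f ->
  seqcont (fun u => (Num.sqrt (f u))^-1).
Proof.
move=> f0 cf u_ u cu; apply: cvgV; first by rewrite gt_eqF// sqrtr_gt0.
exact: (cvg_comp _ _ (cf u_ u cu) (@sqrt_continuous R _)).
Qed.

Lemma seqcont_lipschitz l (G : (I -> R) -> 'M[R]_l) (F : 'M[R]_l -> R) :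
  (forall j k, seqcont (fun u => G u j k)) ->
  (forall a b, `|F a - F b| <= fnorm (a - b)) -> seqcont (fun u => F (G u)).
Proof.
move=> cG lF u_ u cu.
have c2 : (fun N => fnorm2 (G u - G (u_ N))) @ \oo --> 0.
  rewrite (_ : (fun N => _) = (fun N =>
      \sum_j \sum_k (G u j k - G (u_ N) j k) * (G u j k - G (u_ N) j k))); last first.
    apply/funext => N; rewrite fnorm2E; do 2!(apply: eq_bigr => ? _).
    by rewrite !mxE expr2.
  rewrite -[X in _ --> X](_ : \sum_(j < l) \sum_(k < l) 0 = 0); last first.
    by rewrite big1// => j _; rewrite big1.
  apply: cvg_sum_fun => j; apply: cvg_sum_fun => k; rewrite -[X in _ --> X](mulr0 0).
  have c0 : G u j k - G (u_ N) j k @[N --> \oo] --> 0.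
    rewrite -[X in _ --> X](subrr (G u j k)); apply: cvgB; first exact: cvg_cst.
    exact: (cG j k u_ u cu).
  exact: cvgM.
apply/cvgrPdist_le => eps eps0.
move/cvgrPdist_le/(_ _ (exprn_gt0 2 eps0)): c2; apply: filterS => N.
rewrite sub0r normrN ger0_norm ?fnorm2_ge0// -sqr_fnorm => h.
apply: (le_trans (lF _ _)).
by rewrite -ler_sqr// ?nnegrE ?fnorm_ge0// ltW.
Qed.

End SeqContCalculus.

(** Taking [a] large makes the exponential moments of a maximum over [n] variables
harmless: this is where the logarithm of [n] comes from. *)
Lemma sqr_le_expR_shift (R : realType) (x a : R) : 0 <= a ->
  x ^+ 2 <= 2 * a ^+ 2 + 8 * expR (- a) * (expR x + expR (- x)).
Proof.
move=> a0; have [xa|ax] := leP `|x| a.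
  have : x ^+ 2 <= a ^+ 2.
    by rewrite -(real_normK (num_real x)) lerXn2r ?nnegrE.
  have : 0 <= 8 * expR (- a) * (expR x + expR (- x)).
    by rewrite !mulr_ge0 ?addr_ge0 ?expR_ge0.
  have := sqr_ge0 a; move: (8 * _ * _) (x ^+ 2) (a ^+ 2) => u v z; lra.
have h1 : (`|x| - a) ^+ 2 <= 4 * expR (`|x| - a) by apply: sqr_le_expR; rewrite subr_ge0 ltW.
have h2 : expR `|x| <= expR x + expR (- x).
  have [x0|x0] := leP 0 x; first by rewrite ger0_norm// lerDl expR_ge0.
  by rewrite ltr0_norm// lerDr expR_ge0.
have h3 : x ^+ 2 <= 2 * a ^+ 2 + 2 * (`|x| - a) ^+ 2.
  rewrite -(real_normK (num_real x)); have := sqr_ge0 (`|x| - 2 * a).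
  move: (`|x|) => y; rewrite !expr2; lra.
apply: (le_trans h3); rewrite lerD2l -(mulrA 8).
have h4 := ler_wpM2l (expR_ge0 (- a)) h2.
rewrite -expRD (addrC (- a)) in h4.
move: (expR (- a) * (expR x + _)) (expR (_ - _)) (_ ^+ 2) h1 h4 => u v z; lra.
Qed.

Section Risk.
Context {R : realType} {d : measure_display} {T : measurableType d}.
Variables (P : probability T R) (n : nat) (sigma lmax c0 : R) (e : nat -> R -> R).
Hypothesis be : orthonormal_basis e.
Variables (K : R * R -> R) (m : nat) (lam : 'I_m -> R) (phi : 'I_m -> R -> R).
Hypothesis Krep : spectral_rep lam phi K.
Variables (X : 'I_n -> R -> T -> R) (Y : 'I_n -> nat -> T -> R).
Hypothesis wn : white_noise_sample P K sigma X.
Hypothesis YX : forall i k, stoch_integral P (X i) (e k) (Y i k).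
Hypothesis lmax_gt0 : 0 < lmax.
Hypothesis K_lmax : (opnorm K <= lmax%:E)%E.
Hypotheses (n2 : (2 <= n)%N) (n_even : ~~ odd n).
Variables (Ahat : forall l, T -> 'M[R]_l) (lhat : T -> nat).
Hypothesis mAhat : forall l, (1 <= l <= n)%N ->
  forall j k, measurable_fun setT (fun w => Ahat l w j k).
Hypothesis Ahat_min : forall l, (1 <= l <= n)%N ->
  forall w, nuclear_argmin e sigma (mu_pen n c0 lmax sigma l) (fun i k => Y i k w) (Ahat l w).
Hypothesis mlhat : measurable_fun setT lhat.
Hypothesis lhat_min : forall w, aggregation_argmin e sigma (fun i k => Y i k w)
  (fun l => Ahat l w) (lhat w).
Hypothesis c0E : c0 = 1408.
Let S := lmax + sigma ^+ 2.

Let oe : Defs.orthonormal e. Proof. by case: be. Qed.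
Let S0 : 0 < S. Proof. by rewrite ltr_wpDr// sqr_ge0. Qed.
Let n0 : 0 < n%:R :> R. Proof. by rewrite ltr0n (leq_trans _ n2). Qed.

Let mY i k : measurable_fun setT (Y i k). Proof. by case: (YX i k). Qed.

Let hn : (n./2)%:R = n%:R / 2 :> R.
Proof. by rewrite -{2}(even_halfK n_even) -muln2 natrM mulfK. Qed.

Let Nz l Q w := noise sigma e lam phi Y l Q w.

Lemma measurable_noise l Q j k : measurable_fun setT (fun w => Nz l Q w j k).
Proof.
rewrite /Nz /noise /empmx.
under eq_fun do rewrite !mxE summxE.
apply: measurable_funB => //; apply: measurable_funB => //.
apply: measurable_funM => //.
rewrite (_ : (fun w => _) = (fun w => \sum_(i < n) if Q i then Y i j w * Y i k w else 0)).
  apply: measurable_sum => i; case: (Q i) => //; exact: measurable_funM.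
apply/funext => w; rewrite big_mkcond/=; apply: eq_bigr => i _; case: (Q i) => //.
by rewrite !mxE big_ord_recl big_ord0 addr0 !mxE.
Qed.

Lemma card_first_half : #|@first_half n| = n./2.
Proof.
have h : (n./2 <= n)%N by rewrite -{2}(even_halfK n_even) -addnn leq_addr.
rewrite -[RHS]card_ord -[RHS]sum1_card -[LHS]sum1_card.
by rewrite (big_ord_widen n (fun=> 1%N) h).
Qed.

Lemma card_second_half : #|@second_half n| = n./2.
Proof.
have := cardC (@first_half n); rewrite card_first_half card_ord.
rewrite (@eq_card _ (predC (@first_half n)) (@second_half n)) => [h|i].
  by apply/(@addnI n./2); rewrite h addnn even_halfK.
by rewrite !inE /first_half /second_half -leqNgt.
Qed.

Lemma mu_pen_bounds l : (0 < l <= n)%N ->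
  2 * c0 * S * Num.sqrt (l%:R / n%:R) <= mu_pen n c0 lmax sigma l
    <= 4 * c0 * S * Num.sqrt (l%:R / n%:R).
Proof.
move=> /andP[l0 ln]; rewrite /mu_pen -/S /delta hn.
have [x xE] : exists x : R, x = l%:R / n%:R by eexists.
have -> : (l%:R + l%:R) / (n%:R / 2) = 4 * (l%:R / n%:R) :> R by field; exact: lt0r_neq0.
rewrite -xE; have x0 : 0 <= x by rewrite xE divr_ge0// ltW.
have x1 : x <= 1 by rewrite xE ler_pdivrMr// mul1r ler_nat.
have s4 : Num.sqrt (4 * x) = 2 * Num.sqrt x.
  by rewrite sqrtrM// (_ : 4 = 2 ^+ 2) ?sqrtr_sqr ?ger0_norm// -natrX.
rewrite s4; have sx := sqr_sqrtr x0; have sx0 := sqrtr_ge0 x.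
have sx1 : Num.sqrt x <= 1 by rewrite -sqrtr1 ler_wsqrtr.
have xs : x <= Num.sqrt x by rewrite -{1}sx expr2 ler_piMr.
have cS : 0 <= c0 * S by rewrite mulr_ge0 ?(ltW S0)// c0E ler0n.
rewrite -(mulrA 2) -(mulrA 4); move: (c0 * S) (Num.sqrt x) cS sx0 xs => a y a0 y0 xy.
rewrite -(mulrA 2) -(mulrA 4) (mulrCA 2) (mulrCA 4) !ler_wpM2l// ?le_max ?lexx//.
by rewrite ge_max; apply/andP; split; lra.
Qed.

Lemma Ahat_risk l : (0 < l <= n)%N ->
  (\int[P]_w (fnorm2 (Ahat l w - coefmx e lam phi l))%:E <=
    (risk_cst c0 * S ^+ 2 * (((minn m l)%:R + 1) * l%:R / n%:R))%:E)%E.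
Proof.
move=> /andP[l0 ln]; have l1n : (1 <= l <= n)%N by rewrite l0.
have [Q [pQ trQ KQ]] := coefmx_support e lam phi l.
have /andP[mu1 mu2] := mu_pen_bounds l1n.
apply: (@first_half_risk _ _ _ P n l S (mu_pen n c0 lmax sigma l) (minn m l)%:R c0
  (fun w => Nz l (@first_half n) w) (coefmx e lam phi l) Q (Ahat l)) => //.
- exact: measurable_noise.
- by move=> j k; exact: mAhat.
- by move=> w; exact: (noise_sym _ _ Krep).
- move=> D theta DT D1 thS.
  apply: (noise_exp be Krep wn YX lmax_gt0 K_lmax n2 n_even card_first_half (F := fun=> D)) => //.
  by move=> k k'; exact: seqcont_cst.
- move=> w; have := nuclear_argmin_prox oe (Ahat_min l1n w).
  by rewrite /Nz /noise (addrC (coefmx _ _ _ _)) subrK.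
- exact: (coefmx_psd e Krep).
Qed.

Let Kc l := coefmx e lam phi l.

Lemma crop_coefmx l (ln : (l <= n)%N) : crop l (Kc n) = Kc l.
Proof. by apply/matrixP => j k; rewrite (cropE ln) !mxE. Qed.

Lemma crop_empmx l Q y (ln : (l <= n)%N) :
  crop l (empmx n Q y - sigma ^+ 2 *: 1%:M) = empmx (n := n) l Q y - sigma ^+ 2 *: 1%:M.
Proof.
apply/matrixP => j k; rewrite (cropE ln) !mxE !summxE; congr (_ * _ - _).
by apply: eq_bigr => i _; rewrite !mxE; apply: eq_bigr => a _; rewrite !mxE.
Qed.

(** Matrices of all sizes are compared inside the [n x n] ones; padding does not
change the kernel. *)
Lemma loss_pad l (A : 'M[R]_l) : (l <= n)%N ->
  fnorm2 (A - Kc l) + bias e lam phi l = fnorm2 (pad n A - Kc n) + bias e lam phi n.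
Proof.
move=> ln; rewrite !fnorm2B fnorm2_pad// fdot_pad crop_coefmx// /bias -/(Kc l) -/(Kc n); ring.
Qed.

Lemma objective_pad w l : (l <= n)%N ->
  aggregation_objective e sigma (fun i k => Y i k w) (fun l => Ahat l w) l =
  fnorm2 (pad n (Ahat l w)) - 2 * fdot (pad n (Ahat l w)) (Kc n + Nz n (@second_half n) w).
Proof.
move=> ln; rewrite aggregation_objectiveE// fnorm2_pad// fdot_pad.
rewrite /Nz /noise -/(Kc n) (addrC (Kc n)) subrK.
by rewrite crop_empmx.
Qed.

Section Target.
Variables (l : nat) (eps : R).
Hypotheses (l0 : (0 < l)%N) (l_n : (l <= n)%N) (eps0 : 0 < eps).

Let Fx k : 'M[R]_k -> 'M[R]_k := sval (cid (prox_extension k (mu_pen n c0 lmax sigma k))).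
Arguments Fx : clear implicits.

Let FxP k : [/\ forall G A, is_prox (mu_pen n c0 lmax sigma k) G A -> Fx k G = A,
      forall G, (Fx k G)^T = Fx k G
    & forall G G' i j, `|Fx k G i j - Fx k G' i j| <= fnorm (G - G')].
Proof. by rewrite /Fx; case: cid. Qed.

(* Columns of index at least [n] are read by no estimator of size at most [n]. *)
Let dat (u : 'I_n * 'I_n -> R) i k : R :=
  if @insub _ (fun j => (j < n)%N) _ k is Some k' then u (i, k') else 0.

Let Gx k u : 'M[R]_k := empmx k (@first_half n) (dat u) - sigma ^+ 2 *: 1%:M.

Let Dx (i : 'I_n) u : 'M[R]_n := pad n (Fx i.+1 (Gx i.+1 u)) - pad n (Fx l (Gx l u)).

(* The direction of the difference of two estimators, as a continuous function of
   the data bounded by 1. *)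
Let Phi i u : 'M[R]_n := (Num.sqrt (fnorm2 (Dx i u) + eps ^+ 2))^-1 *: Dx i u.

Let Yn (i : 'I_n) (k : 'I_n) w := Y i k w.

Let hid w := hide_in (@second_half n) Yn w.

Let Gx_seqcont k a b : seqcont (fun u => Gx k u a b).
Proof.
rewrite /Gx /empmx; under eq_fun do rewrite !mxE summxE.
apply: seqcontB; last exact: seqcont_cst.
apply: seqcontM; first exact: seqcont_cst.
apply: seqcont_sum => i; under eq_fun do rewrite mxE big_ord_recl big_ord0 addr0 !mxE.
have c j : seqcont (fun u => dat u i j).
  by rewrite /dat; case: insubP => [j' _ _|_]; [exact: seqcont_coord|exact: seqcont_cst].
exact: seqcontM.
Qed.

Let pad_seqcont k a b : seqcont (fun u => pad n (Fx k (Gx k u)) a b).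
Proof.
rewrite /pad; under eq_fun do rewrite mxE.
apply: seqcont_sum => i; apply: seqcontM; last exact: seqcont_cst.
under eq_fun do rewrite mxE; apply: seqcont_sum => j; apply: seqcontM; first exact: seqcont_cst.
apply: (seqcont_lipschitz (F := fun G => Fx k G j i)); first exact: Gx_seqcont.
by move=> G G'; case: (FxP k).
Qed.

Let Dx_seqcont i a b : seqcont (fun u => Dx i u a b).
Proof.
rewrite (_ : (fun u => _) = (fun u => pad n (Fx i.+1 (Gx i.+1 u)) a b - pad n (Fx l (Gx l u)) a b)).
  by apply: seqcontB; exact: pad_seqcont.
by apply/funext => u; rewrite /Dx [LHS]mxE; congr (_ + _); rewrite [LHS]mxE.
Qed.

Let Dx_gt0 i u : 0 < fnorm2 (Dx i u) + eps ^+ 2.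
Proof. by apply: ltr_wpDl; [exact: fnorm2_ge0|exact: exprn_gt0]. Qed.

Let Phi_seqcont i a b : seqcont (fun u => Phi i u a b).
Proof.
rewrite /Phi; under eq_fun do rewrite mxE; apply: seqcontM; last exact: Dx_seqcont.
apply: seqcont_inv_sqrt => //; apply: seqcontD; last exact: seqcont_cst.
under eq_fun do rewrite fnorm2E.
by do 2!(apply: seqcont_sum => ?); under eq_fun do rewrite expr2; apply: seqcontM.
Qed.

Let Phi_sym i u : (Phi i u)^T = Phi i u.
Proof.
have FT k G : (Fx k G)^T = Fx k G by case: (FxP k).
by rewrite /Phi scale_trmx; congr (_ *: _); rewrite /Dx linearB/= !padT.
Qed.

Let Phi_le1 i u : fnorm2 (Phi i u) <= 1.
Proof.
rewrite /Phi fnorm2Z exprVn sqr_sqrtr; last exact: ltW.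
by rewrite mulrC ler_pdivrMr// mul1r lerDl sqr_ge0.
Qed.

Let Gx_data k w : (k <= n)%N ->
  Gx k (hid w) = empmx k (@first_half n) (fun i k => Y i k w) - sigma ^+ 2 *: 1%:M.
Proof.
move=> kn; rewrite /Gx /empmx; congr (_ *: _ - _); apply: eq_bigr => i fi.
have E : yrow k (dat (hid w)) i = yrow k (fun i k => Y i k w) i.
  apply/rowP => j; rewrite !mxE /dat; case: insubP => [j' _ jj|]; last first.
    by rewrite (leq_trans (ltn_ord j) kn).
  rewrite /hid /hide_in/= ifF; first by rewrite /Yn jj.
  by apply/negbTE; rewrite /in_mem/= /second_half -ltnNge.
by rewrite E.
Qed.

Let Fx_data k w : (0 < k <= n)%N -> Fx k (Gx k (hid w)) = Ahat k w.
Proof.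
move=> /andP[k0 kn]; case: (FxP k) => FA _ _; apply: FA; rewrite Gx_data//.
apply: (nuclear_argmin_prox oe); apply: Ahat_min; exact/andP.
Qed.

Let Z i w : R := fdot (Phi i (hid w)) (Nz n (@second_half n) w).

Let mZ i : measurable_fun setT (Z i).
Proof.
rewrite /Z; under eq_fun do rewrite fdotE.
do 2!(apply: measurable_sum => ?); apply: measurable_funM; last exact: measurable_noise.
apply: (@seqcont_measurable R _ T _ (fun ik w => hid w ik) (fun u => Phi i u _ _)) => // -[a k].
have -> : (hid ^~ (a, k)) = if a \in @second_half n then fun=> 0 else Y a k.
  by apply/funext => w; rewrite /hid /hide_in/= /Yn; case: ifP.
by case: ifP.
Qed.

Let L : R := 1 + ln n%:R.
Let th : R := Num.sqrt (n%:R * L) / (32 * S).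

Let L1 : 1 <= L.
Proof. by rewrite /L lerDl ln_ge0// ler1n (leq_trans _ n2). Qed.

Let L0 : 0 < L. Proof. exact: lt_le_trans L1. Qed.

Let nL : n%:R = expR (L - 1).
Proof. by rewrite /L addrAC subrr add0r lnK. Qed.

Let Ln : L <= n%:R.
Proof. by rewrite nL (le_trans _ (expR_ge1Dx _))// addrC subrK. Qed.

Let th0 : 0 < th.
Proof. by rewrite divr_gt0 ?sqrtr_gt0 ?mulr_gt0. Qed.

Let th2 : th ^+ 2 = n%:R * L / (1024 * S ^+ 2).
Proof.
rewrite /th expr_div_n sqr_sqrtr; last by rewrite mulr_ge0// ltW.
by rewrite exprMn; congr (_ / (_ * _)); rewrite -natrX.
Qed.

Let Z_exp i t : `|t| = th -> (\int[P]_w (expR (t * Z i w))%:E <= (expR L)%:E)%E.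
Proof.
move=> tth.
apply: (le_trans (noise_exp be Krep wn YX lmax_gt0 K_lmax n2 n_even card_second_half
  (F := Phi i) (theta := t) _ _ _ _)) => //.
  rewrite tth /th -/S mulfVK; last by rewrite gt_eqF// mulr_gt0.
  rewrite -ler_sqr ?nnegrE ?sqrtr_ge0 ?(ltW n0)// sqr_sqrtr; last by rewrite mulr_ge0// ltW.
  by rewrite expr2 ler_pM2l.
rewrite lee_fin ler_expR -/S exprMn -(real_normK (num_real t)) tth th2.
rewrite (_ : 40 * _ / _ = 40 / 1024 * L); last by field; rewrite !gt_eqF.
by have := L0; lra.
Qed.

Let loss w : R := fnorm2 (Ahat (lhat w) w - Kc (lhat w)) + bias e lam phi (lhat w).

Let devs w : R := \sum_i (expR (th * Z i w) + expR (- th * Z i w)).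

Let devs_le : (\int[P]_w (devs w)%:E <= (n%:R * (expR L + expR L))%:E)%E.
Proof.
have mE (t : R) i : measurable_fun setT (fun w => expR (t * Z i w)).
  by apply: (measurableT_comp (@measurable_expR R)); exact: measurable_funM.
apply: integral_ord_le => [i|i w|i].
- exact: measurable_funD.
- by rewrite addr_ge0 ?expR_ge0.
apply: integral_add_le => //; try by move=> w; exact: expR_ge0.
  by apply: Z_exp; rewrite gtr0_norm.
by apply: Z_exp; rewrite normrN gtr0_norm.
Qed.

Let pathwise w : loss w <= 3 * (fnorm2 (Ahat l w - Kc l) + bias e lam phi l) + eps ^+ 2 / 2 +
  8 * (th ^- 2 * (2 * (4 * L) ^+ 2 + 8 * expR (- (4 * L)) * devs w)).
Proof.
have [/andP[lh0 lhn] lmin] := lhat_min w.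
have [i iE] : exists i : 'I_n, i.+1 = lhat w.
  have li : ((lhat w).-1 < n)%N by rewrite prednK.
  by exists (Ordinal li); rewrite /= prednK.
have := lmin l; rewrite l0 l_n => /(_ isT); rewrite !objective_pad// => obj.
have := aggregation_oracle eps0 obj.
rewrite /loss (loss_pad _ lhn) (loss_pad _ l_n).
have ZE : Z i w = fdot ((Num.sqrt (fnorm2 (pad n (Ahat (lhat w) w) - pad n (Ahat l w)) + eps ^+ 2))^-1 *:
    (pad n (Ahat (lhat w) w) - pad n (Ahat l w))) (Nz n (@second_half n) w).
  rewrite /Z /Phi /Dx iE !Fx_data//; first by rewrite l0.
  by rewrite lh0.
rewrite -ZE => main.
have dev : (Z i w) ^+ 2 <= th ^- 2 * (2 * (4 * L) ^+ 2 + 8 * expR (- (4 * L)) * devs w).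
  rewrite mulrC ler_pdivlMr ?exprn_gt0// mulrC -exprMn.
  apply: (le_trans (sqr_le_expR_shift (th * Z i w) (a := 4 * L) _)).
    by rewrite mulr_ge0// ltW.
  rewrite lerD2l ler_wpM2l ?mulr_ge0 ?expR_ge0// /devs (bigD1 i)//= mulNr lerDl.
  by apply: sumr_ge0 => j _; rewrite addr_ge0 ?expR_ge0.
have b0 := bias_ge0 oe Krep n.
move: main dev b0; move: (fnorm2 _) (fnorm2 _) (th ^- 2 * _) (eps ^+ 2 / 2) (Z i w ^+ 2) (bias _ _ _ _).
move=> a b x y z bb; lra.
Qed.

Let mfn k (B : 'M[R]_k) : (0 < k <= n)%N -> measurable_fun setT (fun w => fnorm2 (Ahat k w - B)).
Proof.
move=> kn; under eq_fun do rewrite fnorm2E.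
do 2!(apply: measurable_sum => ?); apply: measurable_funX.
by under eq_fun do rewrite !mxE; apply: measurable_funB => //; exact: mAhat.
Qed.

Let mloss : measurable_fun setT loss.
Proof.
have -> : loss = fun w => \sum_(i < n) \1_(lhat @^-1` [set i.+1]) w *
    (fnorm2 (Ahat i.+1 w - Kc i.+1) + bias e lam phi i.+1).
  apply/funext => w; have [/andP[lh0 lhn] _] := lhat_min w.
  have li : ((lhat w).-1 < n)%N by rewrite prednK.
  rewrite (bigD1 (Ordinal li))//= big1 => [|j jn]; last first.
    rewrite indicE memNset ?mul0r//= => jw; move: jn; apply/negP; rewrite negbK.
    by apply/eqP/val_inj; rewrite /= jw.
  by rewrite addr0 indicE mem_set ?mul1r/= prednK.
apply: measurable_sum => i; apply: measurable_funM.
  by apply: measurable_indic; rewrite -[X in measurable X]setTI; exact: mlhat.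
by apply: measurable_funD => //; apply: mfn; rewrite ltn0Sn ltn_ord.
Qed.

Let mdevs : measurable_fun setT devs.
Proof.
apply: measurable_sum => i; apply: measurable_funD.
  by apply: (measurableT_comp (@measurable_expR R)); exact: measurable_funM.
by apply: (measurableT_comp (@measurable_expR R)); exact: measurable_funM.
Qed.

Lemma oracle_risk_eps : (\int[P]_w (loss w)%:E <=
  (3 * (risk_cst c0 * S ^+ 2 * (((minn m l)%:R + 1) * l%:R / n%:R) + bias e lam phi l)
   + eps ^+ 2 / 2 + 384 * 1024 * (S ^+ 2 * L / n%:R))%:E)%E.
Proof.
have b0 k : 0 <= bias e lam phi k by exact: (bias_ge0 oe Krep).
have lnn : (0 < l <= n)%N by rewrite l0.
have d0 w : 0 <= devs w by apply: sumr_ge0 => i _; rewrite addr_ge0 ?expR_ge0.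
have k0 : 0 <= 8 * expR (- (4 * L)) by rewrite mulr_ge0 ?expR_ge0.
have t0 : 0 <= th ^- 2 by rewrite invr_ge0 exprn_ge0// ltW.
have a0 : 0 <= 2 * (4 * L) ^+ 2 by rewrite mulr_ge0 ?sqr_ge0.
have e0 : 0 <= eps ^+ 2 / 2 by rewrite divr_ge0 ?sqr_ge0.
have md : measurable_fun setT (fun w => 2 * (4 * L) ^+ 2 + 8 * expR (- (4 * L)) * devs w).
  by apply: measurable_funD => //; exact: measurable_funM.
have mb : measurable_fun setT (fun w => fnorm2 (Ahat l w - Kc l) + bias e lam phi l).
  by apply: measurable_funD => //; exact: mfn.
apply: (integral_mono_le mloss _ _ pathwise).
- apply: measurable_funD; first by apply: measurable_funD => //; exact: measurable_funM.
  by apply: measurable_funM => //; exact: measurable_funM.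
- by move=> w; rewrite addr_ge0 ?fnorm2_ge0.
apply: (@le_trans _ _ (3 * (risk_cst c0 * S ^+ 2 * (((minn m l)%:R + 1) * l%:R / n%:R) + bias e lam phi l)
   + eps ^+ 2 / 2 + 8 * (th ^- 2 * (2 * (4 * L) ^+ 2 + 8 * expR (- (4 * L)) * (n%:R * (expR L + expR L)))))%:E).
  apply: integral_add_le.
  - by apply: measurable_funD => //; exact: measurable_funM.
  - by apply: measurable_funM => //; exact: measurable_funM.
  - by move=> w; rewrite addr_ge0// mulr_ge0// addr_ge0 ?fnorm2_ge0.
  - by move=> w; rewrite !mulr_ge0// addr_ge0// mulr_ge0.
  - apply: integral_add_le => //; last exact: integral_cst_le.
    + exact: measurable_funM.
    + by move=> w; rewrite mulr_ge0// addr_ge0 ?fnorm2_ge0.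
    apply: integral_scale_le => //.
      by move=> w; rewrite addr_ge0 ?fnorm2_ge0.
    apply: integral_add_le => //; [exact: mfn| | |exact: integral_cst_le].
      by move=> w; exact: fnorm2_ge0.
    exact: Ahat_risk.
  apply: integral_scale_le => //.
  - exact: measurable_funM.
  - by move=> w; rewrite mulr_ge0// addr_ge0// mulr_ge0.
  apply: integral_scale_le => //.
  - by move=> w; rewrite addr_ge0// mulr_ge0.
  apply: integral_add_le => //; [exact: measurable_funM| |exact: integral_cst_le|].
    by move=> w; rewrite mulr_ge0.
  exact: integral_scale_le.
rewrite lee_fin lerD2l.
have small : 8 * expR (- (4 * L)) * (n%:R * (expR L + expR L)) <= 16 * L ^+ 2.
  have -> : 8 * expR (- (4 * L)) * (n%:R * (expR L + expR L)) = 16 * (expR (- (4 * L)) * (n%:R * expR L)) by ring.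
  rewrite ler_pM2l// nL -!expRD (@le_trans _ _ 1)//.
    by rewrite -[leRHS]expR0 ler_expR; have := L1; lra.
  by rewrite expr_ge1 ?(ltW L0).
apply: (@le_trans _ _ (8 * (th ^- 2 * (48 * L ^+ 2)))).
  do 2 (apply: ler_wpM2l => //); move: small; rewrite exprMn; move: (8 * _ * _) (L ^+ 2) => x y; lra.
rewrite th2 le_eqVlt; apply/orP; left; apply/eqP; field.
by rewrite !gt_eqF.
Qed.

End Target.

(** With [eps] of order [S / sqrt n], its contribution is below the price
[(1 + ln n) / n] of the selection. *)
Lemma oracle_risk l : (0 < l <= n)%N -> (risk P e K Ahat lhat <=
  (3 * (risk_cst c0 * S ^+ 2 * (((minn m l)%:R + 1) * l%:R / n%:R) + bias e lam phi l)
   + (384 * 1024 + 1) * (S ^+ 2 * (1 + ln n%:R) / n%:R))%:E)%E.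
Proof.
move=> /andP[l0 ln_]; pose eps := S / Num.sqrt n%:R.
have eps0 : 0 < eps by rewrite divr_gt0// sqrtr_gt0.
have -> : risk P e K Ahat lhat = (\int[P]_w (fnorm2 (Ahat (lhat w) w - Kc (lhat w)) + bias e lam phi (lhat w))%:E)%E.
  rewrite /risk unlock; apply: eq_integral => w _; congr EFin.
  exact: (loss_split oe Krep).
apply: (le_trans (oracle_risk_eps l0 ln_ eps0)); rewrite lee_fin -addrA lerD2l.
have ln0 : 0 <= ln (n%:R : R) by rewrite ln_ge0// ler1n (leq_trans _ n2).
have -> : eps ^+ 2 = S ^+ 2 / n%:R by rewrite expr_div_n sqr_sqrtr// ltW.
have q0 : 0 <= S ^+ 2 / n%:R by rewrite divr_ge0 ?sqr_ge0// ltW.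
have qz := mulr_ge0 q0 ln0.
have -> : S ^+ 2 * (1 + ln n%:R) / n%:R = S ^+ 2 / n%:R + S ^+ 2 / n%:R * ln n%:R by ring.
have key (c q u : R) : 0 <= q -> 0 <= u -> q / 2 + c * (q + u) <= (c + 1) * (q + u).
  by move=> q0' u0; rewrite mulrDl mul1r addrC lerD2l; lra.
exact: key.
Qed.

End Risk.

(** * Choice of the truncation level *)

Section Rates.
Context {R : realType}.

Lemma powRE (a x : R) : 0 < a -> a `^ x = expR (x * ln a).
Proof. by move=> a0; rewrite /powR gt_eqF. Qed.

Lemma exp_ln_nat k : (0 < k)%N -> expR (ln k%:R) = k%:R :> R.
Proof. by move=> k0; rewrite lnK// posrE ltr0n. Qed.

(** The level is the integer part of [exp u]. *)
Lemma truncation_level n (s u : R) : (0 < n)%N -> 0 <= s -> 0 <= u <= ln n%:R ->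
  exists l, [/\ (0 < l <= n)%N, l%:R <= expR u &
    l.+1%:R `^ (- (2 * s)) <= expR (- (2 * s) * u)].
Proof.
move=> n0 s0 /andP[u0 un]; have x1 : 1 <= expR u by rewrite -expR0 ler_expR.
have x0 := expR_ge0 u; have /andP[lx xl] := truncn_itv x0.
exists (Num.truncn (expR u)); split=> //.
  rewrite truncn_gt0 x1 -(ler_nat R) (le_trans lx)//.
  by rewrite -(exp_ln_nat n0) ler_expR.
rewrite powRE ?ltr0n// ler_expR !mulNr lerN2 ler_wpM2l ?mulr_ge0//.
by rewrite -ler_expR exp_ln_nat// ltW.
Qed.

(** [ln n = a * (ln n / a)], and [w <= exp w]. *)
Lemma log_rate n (a v : R) : (0 < n)%N -> 0 < a -> a^-1 * ln n%:R - ln n%:R <= v ->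
  (1 + ln n%:R) / n%:R <= (1 + a) * expR v.
Proof.
move=> n0 a0 av; have N0 : 0 < n%:R :> R by rewrite ltr0n.
have X0 : 0 <= ln n%:R :> R by rewrite ln_ge0// ler1n.
have [w wE] : exists w, w = a^-1 * ln n%:R by eexists.
have w0 : 0 <= w by rewrite wE mulr_ge0// invr_ge0 ltW.
rewrite -wE in av.
have Xw : ln n%:R = a * w by rewrite wE mulVKf// gt_eqF.
rewrite ler_pdivrMr// -mulrA -{2}(exp_ln_nat n0) -expRD {1}Xw mulrDl mul1r.
have h : expR w <= expR (v + ln n%:R) by rewrite ler_expR; lra.
have h1 := expR_ge1Dx w; apply: lerD; first by lra.
by rewrite ler_pM2l//; lra.
Qed.

(** At the level of order [exp u] all the terms are compared with the same power
[exp v]; the two alternatives bound [min(r, l)] by [r] or by [l]. *)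
Lemma level_bound n r (s S2 B B' u v : R) : (0 < n)%N -> (0 < r)%N -> 0 <= s ->
  0 <= S2 -> 0 <= B -> 0 <= B' -> 0 <= u <= ln n%:R ->
  ln r%:R + u - ln n%:R <= v \/ 2 * u - ln n%:R <= v ->
  (1 + ln n%:R) / n%:R <= (2 * s + 2) * expR v ->
  B' * expR (- (2 * s) * u) <= B * expR v ->
  exists2 l, (0 < l <= n)%N &
    S2 * ((minn r l * l)%:R / n%:R + (1 + ln n%:R) / n%:R) + B' * l.+1%:R `^ (- (2 * s))
    <= (S2 * (2 * s + 3) + B) * expR v.
Proof.
move=> n0 r0 s0 S0 B0 B0' u01 hv hlog hb.
have [l [ln_ lx lt]] := truncation_level n0 s0 u01; exists l => //.
have N0 : 0 < n%:R :> R by rewrite ltr0n.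
have dim : (minn r l * l)%:R / n%:R <= expR v.
  have NE : n%:R^-1 = expR (- ln n%:R) :> R by rewrite expRN exp_ln_nat.
  rewrite NE; case: hv => hv.
    apply: (@le_trans _ _ (expR (ln r%:R + u - ln n%:R))); last by rewrite ler_expR.
    rewrite expRD ler_wpM2r ?expR_ge0// expRD exp_ln_nat//.
    apply: (@le_trans _ _ (r * l)%:R); first by rewrite ler_nat leq_mul2r geq_minl orbT.
    by rewrite natrM ler_wpM2l.
  apply: (@le_trans _ _ (expR (2 * u - ln n%:R))); last by rewrite ler_expR.
  rewrite expRD ler_wpM2r ?expR_ge0//.
  apply: (@le_trans _ _ (l * l)%:R); first by rewrite ler_nat leq_mul2r geq_minr orbT.
  by rewrite natrM (_ : 2 * u = u + u) ?expRD ?ler_pM//; ring.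
have -> : (S2 * (2 * s + 3) + B) * expR v =
  S2 * (expR v + (2 * s + 2) * expR v) + B * expR v by ring.
apply: lerD; first by rewrite ler_wpM2l// lerD.
by apply: le_trans hb; rewrite ler_wpM2l.
Qed.

Section Exponents.
Variables (n r : nat) (s S2 B : R).
Hypotheses (n0 : (0 < n)%N) (r0 : (0 < r)%N) (s0 : 0 < s) (S0 : 0 <= S2) (B0 : 0 <= B).
Let N0 : 0 < n%:R :> R. Proof. by rewrite ltr0n. Qed.
Let Q0 : 0 < r%:R :> R. Proof. by rewrite ltr0n. Qed.
Let X0 : 0 <= ln n%:R :> R. Proof. by rewrite ln_ge0// ler1n. Qed.
Let Y0 : 0 <= ln r%:R :> R. Proof. by rewrite ln_ge0// ler1n. Qed.
Let k0 : 0 < 2 * s + 1 :> R. Proof. by rewrite addr_gt0// mulr_gt0. Qed.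
Let h0 : 0 < s + 1 :> R. Proof. by rewrite addr_gt0. Qed.

Let cst b : R := S2 * (2 * s + 3) + b.
Let total l b : R :=
  S2 * ((minn r l * l)%:R / n%:R + (1 + ln n%:R) / n%:R) + b * l.+1%:R `^ (- (2 * s)).

Let logk v : - (2 * s / (2 * s + 1)) * ln n%:R <= v ->
  (1 + ln n%:R) / n%:R <= (2 * s + 2) * expR v.
Proof.
move=> hv; rewrite (_ : 2 * s + 2 = 1 + (2 * s + 1)); last by ring.
apply: log_rate => //; apply: le_trans hv; rewrite le_eqVlt; apply/orP; left; apply/eqP.
by field; rewrite gt_eqF.
Qed.

Let logh v : - (s / (s + 1)) * ln n%:R <= v ->
  (1 + ln n%:R) / n%:R <= (2 * s + 2) * expR v.
Proof.
move=> hv; apply: (@le_trans _ _ ((1 + (s + 1)) * expR v)); last first.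
  by rewrite ler_wpM2r ?expR_ge0//; have := s0; lra.
apply: log_rate => //; apply: le_trans hv; rewrite le_eqVlt; apply/orP; left; apply/eqP.
by field; rewrite gt_eqF.
Qed.

(** Level [n^(1/(2s+1))]. *)
Lemma rate_eigen_rank : exists2 l, (0 < l <= n)%N &
  total l (r%:R * B) <= cst B * (r%:R * n%:R `^ (- (2 * s / (2 * s + 1)))).
Proof.
rewrite powRE// -{2}(exp_ln_nat r0) -expRD.
have uk : (2 * s + 1)^-1 * ln n%:R <= ln n%:R.
  by rewrite ler_piMl// invf_le1//; have := s0; lra.
apply: (@level_bound n r s S2 B (r%:R * B) ((2 * s + 1)^-1 * ln n%:R)) => //.
- exact: ltW.
- exact: mulr_ge0.
- by rewrite uk mulr_ge0// invr_ge0 ltW.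
- left; rewrite -addrA lerD2l le_eqVlt; apply/orP; left; apply/eqP.
  by field; rewrite gt_eqF.
- by apply: logk; rewrite lerDr.
rewrite mulrAC mulrC ler_wpM2l// -{1}(exp_ln_nat r0) -expRD ler_expR lerD2l.
rewrite le_eqVlt; apply/orP; left; apply/eqP; field; by rewrite gt_eqF.
Qed.

(** Level [(r n)^(1/(2s+2))], which the hypothesis on [r] keeps below [n]. *)
Lemma rate_eigen_level : r%:R <= n%:R `^ (1 + 2 * s) -> exists2 l, (0 < l <= n)%N &
  total l (r%:R * B) <= cst B * (r%:R `^ (1 / (s + 1)) * n%:R `^ (- (s / (s + 1)))).
Proof.
rewrite !powRE// -expRD -{1}(exp_ln_nat r0) ler_expR => rn.
have YX : (s + 1)^-1 * ln r%:R <= (s + 1)^-1 * ((1 + 2 * s) * ln n%:R).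
  by rewrite ler_wpM2l// invr_ge0 ltW.
apply: (@level_bound n r s S2 B (r%:R * B) ((2 * (s + 1))^-1 * (ln r%:R + ln n%:R))) => //.
- exact: ltW.
- exact: mulr_ge0.
- apply/andP; split; first by rewrite mulr_ge0 ?addr_ge0// invr_ge0 mulr_ge0// ltW.
  by rewrite mulrC ler_pdivrMr ?mulr_gt0//; move: rn; rewrite !mulrDl !mulrDr; lra.
- right; rewrite le_eqVlt; apply/orP; left; apply/eqP.
  by field; rewrite gt_eqF.
- by apply: logh; rewrite lerDr mulr_ge0// divr_ge0// ltW.
rewrite mulrAC mulrC ler_wpM2l// -{1}(exp_ln_nat r0) -expRD ler_expR.
rewrite le_eqVlt; apply/orP; left; apply/eqP; field; by rewrite gt_eqF.
Qed.

(** Level [(n/r)^(1/(2s+1))]. *)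
Lemma rate_sobolev_rank : (r <= n)%N -> exists2 l, (0 < l <= n)%N &
  total l B <= cst B * (r%:R / n%:R) `^ (2 * s / (2 * s + 1)).
Proof.
move=> rn; have YX : ln r%:R <= ln n%:R :> R by rewrite ler_ln ?posrE// ler_nat.
rewrite powRE ?divr_gt0// ln_div ?posrE//.
have uk : (2 * s + 1)^-1 <= 1 by rewrite invf_le1//; have := s0; lra.
have k1 : 0 <= (2 * s + 1)^-1 by rewrite invr_ge0 ltW.
apply: (@level_bound n r s S2 B B ((2 * s + 1)^-1 * (ln n%:R - ln r%:R))) => //.
- exact: ltW.
- rewrite mulr_ge0 ?subr_ge0//=; apply: (@le_trans _ _ (ln n%:R - ln r%:R)).
    by rewrite ler_piMl// subr_ge0.
  by rewrite lerBlDr lerDl.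
- left; rewrite le_eqVlt; apply/orP; left; apply/eqP.
  by field; rewrite gt_eqF.
- apply: logk; rewrite mulrBr mulNr lerDr.
  by apply: mulr_ge0 => //; apply: divr_ge0; [rewrite mulr_ge0// ltW|exact: ltW].
rewrite ler_wpM2l// ler_expR.
rewrite le_eqVlt; apply/orP; left; apply/eqP; field; by rewrite gt_eqF.
Qed.

(** Level [n^(1/(2s+2))]. *)
Lemma rate_sobolev_level : exists2 l, (0 < l <= n)%N &
  total l B <= cst B * n%:R `^ (- (s / (s + 1))).
Proof.
rewrite powRE//.
apply: (@level_bound n r s S2 B B ((2 * (s + 1))^-1 * ln n%:R)) => //.
- exact: ltW.
- rewrite mulr_ge0 ?invr_ge0 ?mulr_ge0 ?(ltW h0)//= ler_piMl// invf_le1 ?mulr_gt0//.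
  by have := s0; lra.
- right; rewrite le_eqVlt; apply/orP; left; apply/eqP.
  by field; rewrite gt_eqF.
- exact: logh.
rewrite ler_wpM2l// ler_expR.
rewrite le_eqVlt; apply/orP; left; apply/eqP; field; by rewrite gt_eqF.
Qed.

End Exponents.

End Rates.

(** * The risk bounds *)

Section RiskBounds.
Context {R : realType}.

Lemma oracle_constants (rc sel S2 x p q b : R) : 0 <= rc -> 0 <= sel -> 0 <= S2 ->
  0 <= p -> 0 <= q -> 0 <= b -> x <= 2 * p ->
  3 * (rc * S2 * x + b) + sel * (S2 * q) <= (6 * rc + sel + 3) * (S2 * (p + q) + b).
Proof.
move=> rc0 sel0 S0 p0 q0 b0 xp; have h := ler_wpM2l (mulr_ge0 rc0 S0) xp.
have -> : (6 * rc + sel + 3) * (S2 * (p + q) + b) =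
   3 * (rc * S2 * (2 * p) + b) + sel * (S2 * q) +
   (6 * (rc * (S2 * q + b)) + sel * (S2 * p + b) + 3 * (S2 * p + S2 * q)) by ring.
have h1 : 0 <= 6 * (rc * (S2 * q + b)) + sel * (S2 * p + b) + 3 * (S2 * p + S2 * q).
  by rewrite !addr_ge0 ?mulr_ge0// !addr_ge0 ?mulr_ge0.
move: h h1; lra.
Qed.

(** The number [m] of eigenvalues is replaced by the bound [r]; as [r] and [l] are
positive, [min (m, l) + 1 <= 2 min (r, l)]. *)
Lemma uniform_oracle : exists2 C0 : R, 0 < C0 &
  forall (c lmax sigma : R) n r m e K (lam : 'I_m -> R) (phi : 'I_m -> R -> R)
    d (T : measurableType d) (P : probability T R) Ahat lhat,
  c = 1408 -> 0 < lmax -> (2 <= n)%N -> ~~ odd n -> orthonormal_basis e ->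
  spectral_rep lam phi K -> (m <= r)%N -> (1 <= r)%N -> (opnorm K <= lmax%:E)%E ->
  aggregated_estimator P c lmax sigma n e K Ahat lhat ->
  forall l, (0 < l <= n)%N ->
  (risk P e K Ahat lhat <=
    (C0 * ((lmax + sigma ^+ 2) ^+ 2 * ((minn r l * l)%:R / n%:R + (1 + ln n%:R) / n%:R)
           + bias e lam phi l))%:E)%E.
Proof.
have [rc [rcE rc0]] : exists rc : R, rc = risk_cst 1408 /\ 0 <= rc.
  eexists; split; first by []; rewrite /risk_cst; apply: addr_ge0; last exact: ler0n.
  apply: addr_ge0; first by apply: mulr_ge0; [exact: ler0n|exact: sqr_ge0].
  apply: mulr_ge0; last exact: expR_ge0.
  by apply: mulr_ge0; [exact: ler0n|apply: exprn_ge0; exact: ler0n].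
have [sel [selE sel0]] : exists sel : R, sel = 384 * 1024 + 1 /\ 0 <= sel.
  eexists; split; first by []; apply: addr_ge0; last exact: ler01.
  by apply: mulr_ge0; exact: ler0n.
exists (6 * rc + sel + 3) => [|c lmax sigma n r m e K lam phi d T P Ahat lhat cE].
  by rewrite ltr_wpDl// addr_ge0// mulr_ge0.
move=> lmax0 n2 ne be Krep mr r1 Klm [X [Y [wn YX Amin mlh lhmin]]] l ln_.
have n0 : 0 < n%:R :> R by rewrite ltr0n (leq_trans _ n2).
have b0 : 0 <= bias e lam phi l by apply: (bias_ge0 _ Krep); case: be.
have := oracle_risk be Krep wn YX lmax0 Klm n2 ne (fun l h => (Amin l h).1)
  (fun l h => (Amin l h).2) mlh lhmin cE ln_.
move=> /le_trans; apply; rewrite lee_fin cE -rcE -selE.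
set S2 := (lmax + sigma ^+ 2) ^+ 2; have S20 : 0 <= S2 by exact: sqr_ge0.
have dim : ((minn m l)%:R + 1) * l%:R / n%:R <= 2 * ((minn r l * l)%:R / n%:R) :> R.
  rewrite mulrA ler_wpM2r ?invr_ge0 ?(ltW n0)// natrM mulrA ler_wpM2r// mulr_natl mulr2n.
  case/andP: ln_ => l0 _; apply: lerD; rewrite ?ler_nat ?ler1n.
    by rewrite leq_min geq_minr (leq_trans (geq_minl _ _)).
  by rewrite leq_min r1.
have p0 : 0 <= (minn r l * l)%:R / n%:R :> R by rewrite divr_ge0// ltW.
have q0 : 0 <= (1 + ln n%:R) / n%:R :> R.
  by rewrite divr_ge0 ?(ltW n0)// addr_ge0// ln_ge0// ler1n (leq_trans _ n2).
rewrite -[S2 * (1 + _) / _]mulrA.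
exact: oracle_constants.
Qed.

Lemma bias_eigen (e : nat -> R -> R) m (lam : 'I_m -> R) phi K r (s cstar lmax : R) l :
  orthonormal_basis e -> spectral_rep lam phi K -> 0 <= s -> 0 <= lmax -> (m <= r)%N ->
  (opnorm K <= lmax%:E)%E -> (forall j, (snorm e s (phi j) <= cstar%:E)%E) ->
  bias e lam phi l <= r%:R * (2 * lmax ^+ 2 * cstar ^+ 2) * l.+1%:R `^ (- (2 * s)).
Proof.
move=> be Krep s0 lm0 mr Klm sn; apply: (le_trans (bias_tail e Krep l)).
have [_ lam0 [Lphi phiphi] _] := Krep.
set E := _ `^ _; have E0 : 0 <= E by exact: powR_ge0.
have hp p : lam p ^+ 2 * tail e phi l p <= lmax ^+ 2 * (cstar ^+ 2 * E).
  have tle : tail e phi l p <= cstar ^+ 2 * E.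
    have := snorm_tail be l s0 (Lphi p) (sn p).
    by rewrite phiphi eqxx.
  apply: (@le_trans _ _ (lam p ^+ 2 * (cstar ^+ 2 * E))).
    by rewrite ler_wpM2l ?sqr_ge0.
  apply: ler_wpM2r; first by rewrite mulr_ge0 ?sqr_ge0.
  rewrite lerXn2r ?nnegrE ?(ltW (lam0 p))//.
  exact: eigenvalue_le Krep _ Klm p.
have h : \sum_p lam p ^+ 2 * tail e phi l p <= r%:R * (lmax ^+ 2 * (cstar ^+ 2 * E)).
  apply: (le_trans (ler_sum _ (fun p _ => hp p))).
  rewrite sumr_const card_ord -[leLHS]mulr_natl ler_wpM2r ?ler_nat//.
  by apply: mulr_ge0; [exact: sqr_ge0|apply: mulr_ge0; [exact: sqr_ge0|]].
have := ler_wpM2l (ler0n R 2) h; rewrite (_ : r%:R * (2 * _ * _) * E = 2 * (r%:R * (lmax ^+ 2 * (cstar ^+ 2 * E))))//; ring.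
Qed.

Lemma bias_sobolev (e : nat -> R -> R) m (lam : 'I_m -> R) phi K (s rho : R) l :
  orthonormal_basis e -> spectral_rep lam phi K -> 0 <= s ->
  (snormsq e s K <= rho%:E)%E ->
  bias e lam phi l <= 2 * rho ^+ 2 * l.+1%:R `^ (- (2 * s)).
Proof.
move=> be Krep s0 sn; apply: (le_trans (bias_tail e Krep l)).
by rewrite -mulrA ler_wpM2l// (snormsq_tail be Krep).
Qed.

End RiskBounds.

Theorem theorem13 (R : realType) :
  exists2 c : R, 0 < c &
  [/\ (forall (lmax sigma cstar s : R),
         0 < lmax -> 0 < sigma -> 0 < cstar -> 0 < s ->
         exists2 C : R, 0 < C &
         forall (n r : nat) (e : nat -> R -> R),
           (2 <= n)%N -> ~~ odd n -> orthonormal_basis e ->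
           (1 <= r)%N -> r%:R <= n%:R `^ (1 + 2 * s) ->
           uniform_risk_bound c lmax sigma n e
             (class_eigen e r s cstar lmax)
             (C * Num.min
                (r%:R * n%:R `^ (- (2 * s / (2 * s + 1))))
                (r%:R `^ (1 / (s + 1)) * n%:R `^ (- (s / (s + 1)))))),
      (forall (lmax sigma rho s : R),
         0 < lmax -> 0 <= sigma -> 1 <= rho -> 0 < s ->
         exists2 C : R, 0 < C &
         forall (n r : nat) (e : nat -> R -> R),
           (2 <= n)%N -> ~~ odd n -> orthonormal_basis e ->
           (1 <= r)%N ->
           rho ^+ 2 <= (lmax + sigma ^+ 2) ^+ 2
             * Num.min (r%:R * n%:R `^ (2 * s)) (n%:R `^ (1 + 2 * s)) ->
           uniform_risk_bound c lmax sigma n e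
             (class_sobolev e r s rho lmax)
             (C * Num.min
                ((r%:R / n%:R) `^ (2 * s / (2 * s + 1)))
                (n%:R `^ (- (s / (s + 1))))))
    & (forall (lmax sigma : R),
         0 < lmax -> 0 < sigma ->
         exists2 C : R, 0 < C &
         forall (n r l : nat) (e : nat -> R -> R),
           (2 <= n)%N -> ~~ odd n -> orthonormal_basis e ->
           (1 <= r)%N -> (1 <= l)%N ->
           ln n%:R <= (minn r l * l)%:R :> R -> (l <= n)%N ->
           uniform_risk_bound c lmax sigma n e
             (class_fin e r l lmax)
             (C * ((minn r l * l)%:R / n%:R)))].
Proof.
have [C0 C0_gt0 oracle] := @uniform_oracle R.
(* 1408 = 64 * 22: the exponents in [bad_event_le] are then [- 22 l], against
   [18 l] for the size of the net and [l] for the exponential moments. *)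
have [c cE] : exists c : R, c = 1408 by eexists.
exists c; first by rewrite cE ltr0n.
split.
- move=> lmax sigma cstar s lm0 sg0 cs0 s0.
  pose S2 := (lmax + sigma ^+ 2) ^+ 2; pose B := 2 * lmax ^+ 2 * cstar ^+ 2.
  have S20 : 0 < S2 by rewrite exprn_gt0// ltr_wpDr// sqr_ge0.
  have B0 : 0 <= B by rewrite /B -mulrA mulr_ge0// mulr_ge0 ?sqr_ge0.
  exists (C0 * (S2 * (2 * s + 3) + B)).
    by rewrite mulr_gt0// ltr_wpDr// mulr_gt0// addr_gt0// mulr_gt0.
  move=> n r e n2 ne be r1 rn K [[m [lam [phi [mr Krep sn]]]] Klm] d T P Ahat lhat est.
  have n0 : (0 < n)%N by exact: leq_trans n2.
  have step l b : (0 < l <= n)%N ->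
      S2 * ((minn r l * l)%:R / n%:R + (1 + ln n%:R) / n%:R)
        + r%:R * B * l.+1%:R `^ (- (2 * s)) <= (S2 * (2 * s + 3) + B) * b ->
      (risk P e K Ahat lhat <= (C0 * (S2 * (2 * s + 3) + B) * b)%:E)%E.
    move=> ln_ hb; apply: (le_trans (oracle _ _ _ _ _ _ _ _ _ _ _ _ _ _ _ cE lm0 n2 ne be Krep mr r1 (ltW Klm) est _ ln_)).
    rewrite lee_fin -mulrA ler_pM2l//; apply: le_trans hb; rewrite lerD2l.
    exact: (bias_eigen l be Krep (ltW s0) (ltW lm0) mr (ltW Klm) sn).
  have [l1 l1n h1] := rate_eigen_rank n0 r1 s0 (ltW S20) B0.
  have [l2 l2n h2] := rate_eigen_level n0 r1 s0 (ltW S20) B0 rn.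
  by rewrite minEle; case: ifP => _; [exact: step h1|exact: step h2].
- move=> lmax sigma rho s lm0 sg0 rho1 s0.
  pose S2 := (lmax + sigma ^+ 2) ^+ 2; pose B := 2 * rho ^+ 2.
  have S20 : 0 < S2 by rewrite exprn_gt0// ltr_wpDr// sqr_ge0.
  have B0 : 0 <= B by rewrite mulr_ge0// sqr_ge0.
  exists (C0 * (S2 * (2 * s + 3) + B)).
    by rewrite mulr_gt0// ltr_wpDr// mulr_gt0// addr_gt0// mulr_gt0.
  move=> n r e n2 ne be r1 _ K [[lam [phi Krep]] Klm sn] d T P Ahat lhat est.
  have n0 : (0 < n)%N by exact: leq_trans n2.
  have step l b : (0 < l <= n)%N ->
      S2 * ((minn r l * l)%:R / n%:R + (1 + ln n%:R) / n%:R)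
        + B * l.+1%:R `^ (- (2 * s)) <= (S2 * (2 * s + 3) + B) * b ->
      (risk P e K Ahat lhat <= (C0 * (S2 * (2 * s + 3) + B) * b)%:E)%E.
    move=> ln_ hb; apply: (le_trans (oracle _ _ _ _ _ _ _ _ _ _ _ _ _ _ _ cE lm0 n2 ne be Krep (leqnn r) r1 Klm est _ ln_)).
    rewrite lee_fin -mulrA ler_pM2l//; apply: le_trans hb; rewrite lerD2l.
    exact: (bias_sobolev l be Krep (ltW s0) sn).
  have [l2 l2n h2] := rate_sobolev_level n0 r1 s0 (ltW S20) B0.
  have [rn|nr] := leqP r n.
    have [l1 l1n h1] := rate_sobolev_rank n0 r1 s0 (ltW S20) B0 rn.
    by rewrite minEle; case: ifP => _; [exact: step h1|exact: step h2].
  rewrite min_r; first exact: step h2.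
  have nr' : n%:R <= r%:R :> R by rewrite ler_nat ltnW.
  have N0 : 0 < n%:R :> R by rewrite ltr0n.
  rewrite !powRE ?divr_gt0 ?(lt_le_trans N0 nr')//.
  rewrite ler_expR; apply: (@le_trans _ _ 0).
    rewrite mulNr oppr_le0 mulr_ge0 ?ln_ge0 ?ler1n//.
    by rewrite divr_ge0 ?addr_ge0// ltW.
  by rewrite mulr_ge0 ?divr_ge0 ?addr_ge0 ?mulr_ge0 ?ln_ge0 ?(ltW s0)// ler_pdivlMr ?mul1r.
- move=> lmax sigma lm0 sg0.
  pose S2 := (lmax + sigma ^+ 2) ^+ 2.
  have S20 : 0 < S2 by rewrite exprn_gt0// ltr_wpDr// sqr_ge0.
  exists (C0 * (S2 * 3)); first by rewrite mulr_gt0// mulr_gt0.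
  move=> n r l e n2 ne be r1 l1 lnle l_n K [[m [lam [phi [mr Krep]]]] KS Klm] d T P Ahat lhat est.
  have ln_ : (0 < l <= n)%N by rewrite l1.
  have n0 : 0 < n%:R :> R by rewrite ltr0n (leq_trans _ n2).
  apply: (le_trans (oracle _ _ _ _ _ _ _ _ _ _ _ _ _ _ _ cE lm0 n2 ne be Krep mr r1 Klm est _ ln_)).
  rewrite (bias_in_S _ Krep KS) ?addr0; last by case: be.
  rewrite lee_fin -/S2 -[C0 * _ * _]mulrA ler_pM2l// -[S2 * 3 * _]mulrA ler_pM2l// -mulrDl mulrA ler_pM2r ?invr_gt0//.
  have : 1 <= (minn r l * l)%:R :> R by rewrite ler1n muln_gt0 leq_min r1 l1.
  move: lnle; lra.
Qed.
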